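(* When the graph $G$ is a tree or a cycle, the following decision problem is solvable in polynomial time: given an instance $(G,T,d)$ and an integer $k$, decide whether there exists a covering placement $P$ with $|P|\le k$.
   Context: An instance consists of a finite undirected graph $G=(V,E)$ whose edges all have unit length, a set of target vertices $T\subseteq V$, and for each target $t\in T$ a penetration time $d(t)\in\mathbb{N}^+$ (a positive integer). For $u,v\in V$ let $\omega^*_{u,v}$ be the shortest-path distance (number of edges) between $u$ and $v$ in $G$. A covering placement is a set $P=\{p_1,\dots,p_m\}\subseteq V$ of pairwise distinct vertices such that for every target $t\in T$ there exists $p_i\in P$ with $\omega^*_{p_i,t}\le d(t)$. *)

(* Defs.v *)
From Stdlib Require Import List Arith Bool.
Import ListNotations.

(* A graph on vertex set {0,...,n-1} given by a list of undirected edges. *)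
Definition adj (E : list (nat * nat)) (u v : nat) : Prop :=
  In (u, v) E \/ In (v, u) E.

Inductive walk (E : list (nat * nat)) : nat -> nat -> nat -> Prop :=
| walk0 : forall u, walk E u u 0
| walkS : forall u v w l, adj E u v -> walk E v w l -> walk E u w (S l).

Definition is_dist (E : list (nat * nat)) (u v l : nat) : Prop :=
  walk E u v l /\ forall l', walk E u v l' -> l <= l'.

Definition simple_graph (n : nat) (E : list (nat * nat)) : Prop :=
  1 <= n /\
  (forall u v, In (u, v) E -> u < n /\ v < n /\ u <> v) /\
  NoDup E /\
  (forall u v, In (u, v) E -> ~ In (v, u) E).

Definition connected (n : nat) (E : list (nat * nat)) : Prop :=
  forall u v, u < n -> v < n -> exists l, walk E u v l.

Definition is_tree (n : nat) (E : list (nat * nat)) : Prop :=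
  simple_graph n E /\ connected n E /\ length E = n - 1.

Definition degree (E : list (nat * nat)) (v : nat) : nat :=
  length (filter (fun e => (fst e =? v) || (snd e =? v)) E).

Definition is_cycle (n : nat) (E : list (nat * nat)) : Prop :=
  simple_graph n E /\ 3 <= n /\ connected n E /\
  (forall v, v < n -> degree E v = 2).

(* An instance (G, T, d): G = (n, E); the list TD contains the pairs
   (t, d(t)) for t in T. *)
Record instance := mkInstance {
  inst_n : nat;
  inst_E : list (nat * nat);
  inst_TD : list (nat * nat)
}.

Definition valid_targets (I : instance) : Prop :=
  NoDup (map fst (inst_TD I)) /\
  (forall t dt, In (t, dt) (inst_TD I) -> t < inst_n I /\ 1 <= dt).

Definition covering_placement (I : instance) (P : list nat) : Prop :=
  NoDup P /\ (forall p, In p P -> p < inst_n I) /\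
  forall t dt, In (t, dt) (inst_TD I) ->
    exists p l, In p P /\ is_dist (inst_E I) p t l /\ l <= dt.

Definition yes_instance (I : instance) (k : nat) : Prop :=
  exists P, covering_placement I P /\ length P <= k.

Fixpoint bits_aux (fuel n : nat) : list bool :=
  match fuel with
  | 0 => []
  | S f => match n with
           | 0 => []
           | _ => Nat.odd n :: bits_aux f (Nat.div2 n)
           end
  end.
Definition bits (n : nat) : list bool := bits_aux n n.

(* self-delimiting encoding of a natural number: each bit b as [1; b],
   terminated by [0; 0] *)
Definition enc_nat (n : nat) : list bool :=
  flat_map (fun b => [true; b]) (bits n) ++ [false; false].

Definition enc_pair (p : nat * nat) : list bool :=
  enc_nat (fst p) ++ enc_nat (snd p).

Definition enc_list {A} (f : A -> list bool) (l : list A) : list bool :=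
  flat_map (fun x => true :: f x) l ++ [false].

Definition enc_input (I : instance) (k : nat) : list bool :=
  enc_nat (inst_n I) ++ enc_list enc_pair (inst_E I) ++
  enc_list enc_pair (inst_TD I) ++ enc_nat k.

Inductive move := MoveL | MoveR | Stay.

(* States are 0 .. tm_nstates-1; tape symbols are [option bool]
   (None = blank). *)
Record TM := mkTM {
  tm_nstates : nat;
  tm_start : nat;
  tm_accept : nat;
  tm_reject : nat;
  tm_delta : nat -> option bool -> nat * option bool * move
}.

Definition tm_wf (M : TM) : Prop :=
  tm_start M < tm_nstates M /\ tm_accept M < tm_nstates M /\
  tm_reject M < tm_nstates M /\ tm_accept M <> tm_reject M /\
  forall q a, q < tm_nstates M -> fst (fst (tm_delta M q a)) < tm_nstates M.

(* configuration: state, left part of tape (nearest cell first),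
   scanned symbol, right part of tape *)
Record config := mkConfig {
  c_state : nat;
  c_left : list (option bool);
  c_cur : option bool;
  c_right : list (option bool)
}.

Definition init_config (M : TM) (w : list bool) : config :=
  match w with
  | [] => mkConfig (tm_start M) [] None []
  | b :: w' => mkConfig (tm_start M) [] (Some b) (map Some w')
  end.

Definition step (M : TM) (c : config) : config :=
  let q := c_state c in
  if (q =? tm_accept M) || (q =? tm_reject M) then c else
  match tm_delta M q (c_cur c) with
  | (q', a, MoveL) =>
      match c_left c with
      | [] => mkConfig q' [] None (a :: c_right c)
      | x :: l => mkConfig q' l x (a :: c_right c)
      end
  | (q', a, MoveR) =>
      match c_right c with
      | [] => mkConfig q' (a :: c_left c) None []
      | x :: r => mkConfig q' (a :: c_left c) x r
      end
  | (q', a, Stay) => mkConfig q' (c_left c) a (c_right c)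
  end.

Definition decides_within (M : TM) (w : list bool) (t : nat) (b : bool)
  : Prop :=
  exists i, i <= t /\
    c_state (Nat.iter i (step M) (init_config M w)) =
      (if b then tm_accept M else tm_reject M).

(* Main.v *)
(* Fix a vertex [s] that belongs to the placement.  If [G] is a tree or a cycle,
   every nonempty set of vertices avoiding [s] has a member with at most one
   neighbour in the set, so the vertices other than [s] can be removed one by one,
   each being such a "leaf" of what is left.  The balls that miss [s] meet what is
   left in connected sets.  When a leaf [v] is removed, either some ball not yet
   hit meets what is left in [v] alone, and [v] must be chosen, or every such ball
   through [v] also contains the neighbour of [v], and [v] is dispensable.  So this
   greedy choice is optimal for each [s], and one tries all [s].

   The algorithm is written in a language whose only loops run over [0 .. B - 1],
   where [B] is the length of the input, so that its running time is polynomial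
   by its syntactic shape.  Numbers that may be exponential in [B] are read
   saturated at [B], which no distance or vertex count exceeds.  Such programs are
   run by a machine whose tape interleaves all variables, numbers being written in
   unary: walking to the end of the unary number [r] leaves the head in the block
   that holds the [r]-th entry of every array. *)

Require Import Defs.
From Stdlib Require Import List Arith Bool ZArith Lia Classical FunctionalExtensionality.
Import ListNotations.

(** * Structured tape programs and their Turing machines *)

(** Fixing [s] is what a cycle asks for: it has no leaf until some vertex is gone, and a ball that
    avoids [s] is an arc of the path that remains, hence connected there. In a tree fixing [s] is
    harmless, so one search serves both graphs. The empty placement offers no [s]; it is adequate
    only when there are no targets, and that case is tested separately. The obstacle is the cost
    model: the bound must hold for a one-tape machine reading binary numbers. Two facts make it
    polynomial. Registers change only by increments and resets, so for a fixed program their values,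
    and with them the walks along unary numbers, are polynomial in [B]. And [B] bounds the number of
    vertices, because the edges of a tree or a cycle are at least [n - 1] in number and are all
    written out in the input. The exponent is never computed: costs are built from sums and
    products, under which polynomially bounded functions are closed. *)

Inductive tprog :=
| Wr (a : option bool)
| Mv (m : move)
| Sq (p q : tprog)
| Ift (t : option bool -> bool) (p q : tprog)
| Wh (t : option bool -> bool) (p : tprog).

Definition tape := Z -> option bool.

Definition wr (f : tape) (h : Z) (a : option bool) : tape :=
  fun z => if Z.eqb z h then a else f z.

Definition shift (m : move) (h : Z) : Z :=
  match m with MoveL => h - 1 | MoveR => h + 1 | Stay => h end%Z.

(** The count is exact: each write, move and test is one machine step and sequencing is free. A loop
    has a derivation only if it terminates. *)
Inductive ex : tprog -> tape -> Z -> nat -> tape -> Z -> Prop :=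
| ex_wr (f : tape) (h : Z) a : ex (Wr a) f h 1 (wr f h a) h
| ex_mv (f : tape) (h : Z) m : ex (Mv m) f h 1 f (shift m h)
| ex_sq p q (f : tape) (h : Z) n (f1 : tape) (h1 : Z) m (f2 : tape) (h2 : Z) :
    ex p f h n f1 h1 -> ex q f1 h1 m f2 h2 -> ex (Sq p q) f h (n + m) f2 h2
| ex_ift (t : option bool -> bool) p q (f : tape) (h : Z) n (f1 : tape) (h1 : Z) :
    ex (if t (f h) then p else q) f h n f1 h1 ->
    ex (Ift t p q) f h (S n) f1 h1
| ex_wh0 (t : option bool -> bool) p (f : tape) (h : Z) : t (f h) = false -> ex (Wh t p) f h 1 f h
| ex_wh1 (t : option bool -> bool) p (f : tape) (h : Z) n (f1 : tape) (h1 : Z) m (f2 : tape) (h2 : Z) :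
    t (f h) = true -> ex p f h n f1 h1 -> ex (Wh t p) f1 h1 m f2 h2 ->
    ex (Wh t p) f h (S (n + m)) f2 h2.

Definition row := option bool -> nat * option bool * move.

Fixpoint tsize (p : tprog) : nat :=
  match p with
  | Wr _ | Mv _ => 1
  | Sq p q => tsize p + tsize q
  | Ift _ p q => S (tsize p + tsize q)
  | Wh _ p => S (tsize p)
  end.

(** [off] is the state number of the first instruction and [nxt] the state entered on exit; the body
    of a loop exits to the test of that loop. Numbers are known in advance from [tsize], so [Sq]
    needs no jump. *)
Fixpoint flat (p : tprog) (off nxt : nat) : list row :=
  match p with
  | Wr a => [fun _ => (nxt, a, Stay)]
  | Mv m => [fun s => (nxt, s, m)]
  | Sq p q => flat p off (off + tsize p) ++ flat q (off + tsize p) nxt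
  | Ift t p q =>
      (fun s => (if t s then S off else S off + tsize p, s, Stay)) ::
      flat p (S off) nxt ++ flat q (S off + tsize p) nxt
  | Wh t p =>
      (fun s => (if t s then S off else nxt, s, Stay)) :: flat p (S off) off
  end.

Lemma flat_length p : forall off nxt, length (flat p off nxt) = tsize p.
Proof.
  induction p; intros; simpl; rewrite ?length_app, ?IHp1, ?IHp2, ?IHp; auto.
Qed.

Lemma flat_target p : forall off nxt r s,
  In r (flat p off nxt) -> fst (fst (r s)) <= max nxt (off + tsize p).
Proof.
  induction p; intros off nxt r s Hr; simpl in Hr.
  - destruct Hr as [<-|[]]; simpl; lia.
  - destruct Hr as [<-|[]]; simpl; lia.
  - apply in_app_iff in Hr as [Hr|Hr].
    + apply IHp1 with (s := s) in Hr; simpl; lia.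
    + apply IHp2 with (s := s) in Hr; simpl; lia.
  - destruct Hr as [<-|Hr]; [simpl; destruct (t s); lia|].
    apply in_app_iff in Hr as [Hr|Hr].
    + apply IHp1 with (s := s) in Hr; simpl; lia.
    + apply IHp2 with (s := s) in Hr; simpl; lia.
  - destruct Hr as [<-|Hr]; [simpl; destruct (t s); lia|].
    apply IHp with (s := s) in Hr; simpl; lia.
Qed.

(* Control falls through [p] into one extra state that accepts iff the scanned
   cell is nonblank. *)
Definition machine (p : tprog) : TM :=
  let N := tsize p in
  let code := flat p 0 N in
  mkTM (N + 3) 0 (N + 1) (N + 2)
    (fun q a =>
       match nth_error code q with
       | Some r => r a
       | None => (match a with Some _ => N + 1 | None => N + 2 end, a, Stay)
       end).

Lemma machine_wf p : tm_wf (machine p).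
Proof.
  unfold tm_wf, machine; simpl. repeat split; try lia.
  intros q a _. destruct (nth_error _ q) as [r|] eqn:E.
  - apply nth_error_In in E. apply flat_target with (s := a) in E. lia.
  - destruct a; simpl; lia.
Qed.

(** A configuration stores a finite part of the tape only; the default [None] of [nth] supplies the
    blanks beyond it, so that padding does not matter. *)
Definition rep (c : config) (f : tape) (h : Z) : Prop :=
  c_cur c = f h /\
  (forall k, nth k (c_left c) None = f (h - 1 - Z.of_nat k)%Z) /\
  (forall k, nth k (c_right c) None = f (h + 1 + Z.of_nat k)%Z).

Lemma step_rep M c f h q a m :
  rep c f h -> c_state c <> tm_accept M -> c_state c <> tm_reject M ->
  tm_delta M (c_state c) (f h) = (q, a, m) ->
  c_state (step M c) = q /\ rep (step M c) (wr f h a) (shift m h).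
Proof.
  intros (Hc & Hl & Hr) Ha Hj Hd. unfold step.
  apply Nat.eqb_neq in Ha, Hj. rewrite Ha, Hj, Hc, Hd. simpl.
  assert (W : forall z, z <> h -> wr f h a z = f z).
  { intros z Hz. unfold wr. apply Z.eqb_neq in Hz. now rewrite Hz. }
  assert (W0 : wr f h a h = a) by (unfold wr; now rewrite Z.eqb_refl).
  destruct m; simpl.
  (* With [tl] and a default blank, the end of the stored part is treated like any other cell. *)
  - assert (E : match c_left c with
                | [] => mkConfig q [] None (a :: c_right c)
                | x :: l => mkConfig q l x (a :: c_right c)
                end = mkConfig q (tl (c_left c)) (nth 0 (c_left c) None)
                        (a :: c_right c)) by now destruct (c_left c).
    rewrite E; unfold rep; cbn [c_state c_left c_cur c_right].
    split; [reflexivity|repeat split].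
    + rewrite Hl, W by lia. f_equal; lia.
    + intros k. replace (nth k (tl (c_left c)) None) with
        (nth (S k) (c_left c) None) by (destruct (c_left c), k; reflexivity).
      rewrite Hl, W by lia. f_equal; lia.
    + intros [|k]; simpl nth.
      * replace (h - 1 + 1 + Z.of_nat 0)%Z with h by lia. now rewrite W0.
      * rewrite Hr, W by lia. f_equal; lia.
  - assert (E : match c_right c with
                | [] => mkConfig q (a :: c_left c) None []
                | x :: l => mkConfig q (a :: c_left c) x l
                end = mkConfig q (a :: c_left c) (nth 0 (c_right c) None)
                        (tl (c_right c))) by now destruct (c_right c).
    rewrite E; unfold rep; cbn [c_state c_left c_cur c_right].
    split; [reflexivity|repeat split].
    + rewrite Hr, W by lia. f_equal; lia.
    + intros [|k]; simpl nth.
      * replace (h + 1 - 1 - Z.of_nat 0)%Z with h by lia. now rewrite W0.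
      * rewrite Hl, W by lia. f_equal; lia.
    + intros k. replace (nth k (tl (c_right c)) None) with
        (nth (S k) (c_right c) None) by (destruct (c_right c), k; reflexivity).
      rewrite Hr, W by lia. f_equal; lia.
  - unfold rep; cbn [c_state c_left c_cur c_right].
    split; [reflexivity|repeat split]; auto; intros k;
      rewrite ?Hl, ?Hr, W by lia; reflexivity.
Qed.

(** The induction descends into subprograms while the machine remains that of [p0], so the fragment
    may sit anywhere in the code, between [pre] and [post]. *)
Lemma flat_exec p0 p f h n f' h' : ex p f h n f' h' ->
  forall off nxt pre post c,
    flat p0 0 (tsize p0) = pre ++ flat p off nxt ++ post ->
    length pre = off -> c_state c = off -> rep c f h ->
    let c' := Nat.iter n (step (machine p0)) c in
    c_state c' = nxt /\ rep c' f' h'.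
Proof.
  assert (Hrow : forall pre r post c f h, flat p0 0 (tsize p0) = pre ++ r :: post ->
    c_state c = length pre -> rep c f h ->
    let c' := step (machine p0) c in
    c_state c' = fst (fst (r (f h))) /\
    rep c' (wr f h (snd (fst (r (f h))))) (shift (snd (r (f h))) h)).
  { clear. intros pre r post c f h Hcode Hs Hr.
    assert (Hlt : c_state c < tsize p0).
    { rewrite <- (flat_length p0 0 (tsize p0)), Hcode, length_app. simpl. lia. }
    apply step_rep; try assumption; simpl; try lia.
    rewrite Hcode, Hs, nth_error_app2, Nat.sub_diag by lia. simpl.
    now destruct (r (f h)) as [[? ?] ?]. }
  (* Moves and tests write back the scanned symbol, so they leave the tape unchanged. *)
  assert (Wid : forall (f : tape) h, wr f h (f h) = f).
  { intros g k. apply functional_extensionality. intros z. unfold wr.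
    destruct (Z.eqb_spec z k); congruence. }
  induction 1; intros off nxt pre post c Hcode Hpre Hs Hrep; simpl in Hcode;
    subst off.
  - destruct (Hrow _ _ _ c f h Hcode Hs Hrep) as [A B]. simpl in *. auto.
  - destruct (Hrow _ _ _ c f h Hcode Hs Hrep) as [A B]. simpl in *.
    rewrite Wid in B. auto.
  - rewrite Nat.add_comm, Nat.iter_add.
    rewrite <- app_assoc in Hcode.
    destruct (IHex1 _ _ _ _ c Hcode eq_refl Hs Hrep) as [A B].
    rewrite app_assoc in Hcode.
    apply (IHex2 _ _ _ _ _ Hcode); auto.
    rewrite length_app, flat_length. lia.
  - destruct (Hrow _ _ _ c f h Hcode Hs Hrep) as [A B]. simpl in A, B.
    rewrite Wid in B. rewrite Nat.iter_succ_r.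
    destruct (t (f h)).
    + apply (IHex (S (length pre)) nxt (pre ++ [fun s =>
        (if t s then S (length pre) else S (length pre + tsize p), s, Stay)])
        (flat q (S (length pre + tsize p)) nxt ++ post)); auto.
      * rewrite Hcode. simpl. now rewrite <- !app_assoc.
      * rewrite length_app. simpl. lia.
    + apply (IHex (S (length pre + tsize p)) nxt (pre ++ [fun s =>
        (if t s then S (length pre) else S (length pre + tsize p), s, Stay)] ++
        flat p (S (length pre)) nxt) post); auto.
      * rewrite Hcode. simpl. rewrite <- !app_assoc. simpl. now rewrite <- ?app_assoc.
      * rewrite !length_app, flat_length. simpl. lia.
  - destruct (Hrow _ _ _ c f h Hcode Hs Hrep) as [A B]. simpl in *.
    rewrite H in A. rewrite Wid in B. auto.
  - destruct (Hrow _ _ _ c f h Hcode Hs Hrep) as [A B]. simpl in A, B.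
    rewrite H in A. rewrite Wid in B.
    rewrite Nat.iter_succ_r, (Nat.add_comm n m), Nat.iter_add.
    destruct (IHex1 (S (length pre)) (length pre) (pre ++ [fun s =>
        (if t s then S (length pre) else nxt, s, Stay)]) post
        (step (machine p0) c)) as [A' B']; auto.
    + rewrite Hcode. simpl. now rewrite <- app_assoc.
    + rewrite length_app. simpl. lia.
    + apply (IHex2 _ _ _ _ _ Hcode); auto.
Qed.

(* The input is placed from cell 2 on: cell 0 is the home cell of the encoded
   store, and cell 1 a blank gap. *)
Definition input_tape (w : list bool) : tape :=
  fun z => if (z <? 2)%Z then None else nth_error w (Z.to_nat (z - 2)).

Lemma init_rep M w : rep (init_config M w) (input_tape w) 2.
Proof.
  assert (Hmap : forall (l : list bool) k, nth k (map Some l) None = nth_error l k).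
  { induction l; intros [|k]; simpl; auto. }
  assert (Hlt : forall k, (2 - 1 - Z.of_nat k <? 2)%Z = true)
    by (intros; apply Z.ltb_lt; lia).
  assert (Hge : forall k, (2 + 1 + Z.of_nat k <? 2)%Z = false)
    by (intros; apply Z.ltb_ge; lia).
  unfold rep, input_tape. destruct w as [|b w]; simpl c_cur; simpl c_left;
    simpl c_right; (split; [reflexivity|split; intros k]); rewrite ?Hlt, ?Hge.
  - now destruct k.
  - replace (Z.to_nat (2 + 1 + Z.of_nat k - 2)) with (S k) by lia. now destruct k.
  - now destruct k.
  - replace (Z.to_nat (2 + 1 + Z.of_nat k - 2)) with (S k) by lia. exact (Hmap w k).
Qed.

Lemma machine_decides p w n f h :
  ex p (input_tape w) 2 n f h ->
  decides_within (machine p) w (S n)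
    (match f h with Some _ => true | None => false end).
Proof.
  intros H. pose proof (flat_exec p _ _ _ _ _ _ H 0 (tsize p) [] []
    (init_config (machine p) w)) as Hex.
  rewrite app_nil_r in Hex.
  destruct (Hex eq_refl eq_refl) as [A B].
  { now destruct w. }
  { apply init_rep. }
  exists (S n). split; [lia|]. simpl.
  set (c := Nat.iter n _ _) in *.
  (* State [tsize p] lies just past the code, so the default row applies; this is the one step added
     to [n]. *)
  assert (Hd : tm_delta (machine p) (c_state c) (f h) =
    (match f h with Some _ => tsize p + 1 | None => tsize p + 2 end, f h, Stay)).
  { simpl. rewrite A, (proj2 (nth_error_None _ _)); [reflexivity|].
    rewrite flat_length. lia. }
  apply step_rep with (c := c) in Hd as [Hd _]; simpl; try lia; [|assumption].
  rewrite Hd. now destruct (f h).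
Qed.

(** * Runs with an upper bound on the cost *)

Definition run p f h N f' h' := exists n, n <= N /\ ex p f h n f' h'.

Lemma run_le p f h N N' f' h' : N <= N' -> run p f h N f' h' -> run p f h N' f' h'.
Proof. intros H (n & Hn & E). exists n. split; [lia|auto]. Qed.

Lemma run_sq p q f h N f1 h1 M f2 h2 :
  run p f h N f1 h1 -> run q f1 h1 M f2 h2 -> run (Sq p q) f h (N + M) f2 h2.
Proof.
  intros (n & Hn & E) (m & Hm & E'). exists (n + m). split; [lia|].
  econstructor; eauto.
Qed.

Lemma run_wr f h a : run (Wr a) f h 1 (wr f h a) h.
Proof. exists 1. split; auto. constructor. Qed.

Lemma run_mv f h m : run (Mv m) f h 1 f (shift m h).
Proof. exists 1. split; auto. constructor. Qed.

Lemma run_ift (t : option bool -> bool) p q f h N f1 h1 :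
  run (if t (f h) then p else q) f h N f1 h1 -> run (Ift t p q) f h (S N) f1 h1.
Proof. intros (n & Hn & E). exists (S n). split; [lia|]. now constructor. Qed.

Lemma run_wh_stop (t : option bool -> bool) p f h :
  t (f h) = false -> run (Wh t p) f h 1 f h.
Proof. exists 1. split; auto. now constructor. Qed.

Lemma run_wh_step (t : option bool -> bool) p f h N f1 h1 M f2 h2 :
  t (f h) = true -> run p f h N f1 h1 -> run (Wh t p) f1 h1 M f2 h2 ->
  run (Wh t p) f h (S (N + M)) f2 h2.
Proof.
  intros Ht (n & Hn & E) (m & Hm & E'). exists (S (n + m)). split; [lia|].
  econstructor; eauto.
Qed.

Definition full (a : option bool) : bool :=
  match a with Some _ => true | None => false end.
Definition blank (a : option bool) : bool := negb (full a).

Fixpoint mvn (m : move) (k : nat) : tprog :=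
  match k with 0 => Mv Stay | S k => Sq (Mv m) (mvn m k) end.

Lemma run_mvnL k : forall f h, run (mvn MoveL k) f h (k + 1) f (h - Z.of_nat k)%Z.
Proof.
  induction k; intros; simpl mvn.
  - replace (h - Z.of_nat 0)%Z with (shift Stay h) by (simpl; lia). apply run_mv.
  - apply (run_sq _ _ _ _ 1 _ _ (k + 1) _ _ (run_mv _ _ _)).
    replace (h - Z.of_nat (S k))%Z with (shift MoveL h - Z.of_nat k)%Z
      by (simpl shift; lia). apply IHk.
Qed.

Lemma run_mvnR k : forall f h, run (mvn MoveR k) f h (k + 1) f (h + Z.of_nat k)%Z.
Proof.
  induction k; intros; simpl mvn.
  - replace (h + Z.of_nat 0)%Z with (shift Stay h) by (simpl; lia). apply run_mv.
  - apply (run_sq _ _ _ _ 1 _ _ (k + 1) _ _ (run_mv _ _ _)).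
    replace (h + Z.of_nat (S k))%Z with (shift MoveR h + Z.of_nat k)%Z
      by (simpl shift; lia). apply IHk.
Qed.

(** * Interleaved tracks on the tape *)

Definition mark (b : bool) : option bool := if b then Some true else None.

Lemma full_mark b : full (mark b) = b.
Proof. now destruct b. Qed.

(* Cell [j] of track [i] is the tape cell [-(j * per + i)]; track 0 carries the
   single home mark. *)
Definition pos (per i j : nat) : Z := (- Z.of_nat (j * per + i))%Z.

Definition cell (tr : nat -> nat -> bool) (i j : nat) : option bool :=
  mark (if i =? 0 then j =? 0 else tr i j).

(** The store grows to the left and the input lies to the right, so neither ever has to be
    shifted. *)
Definition lay (per : nat) (tr : nat -> nat -> bool) (w : list bool) : tape :=
  fun z => if (z <=? 0)%Z
           then cell tr (Z.to_nat (- z) mod per) (Z.to_nat (- z) / per)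
           else input_tape w z.

Definition set2 (tr : nat -> nat -> bool) (i j : nat) (b : bool) :=
  fun i' j' => if (i' =? i) && (j' =? j) then b else tr i' j'.

Lemma lay_pos per tr w i j : i < per -> lay per tr w (pos per i j) = cell tr i j.
Proof.
  intros Hi. unfold lay, pos.
  replace (- Z.of_nat (j * per + i) <=? 0)%Z with true
    by (symmetry; apply Z.leb_le; lia).
  replace (Z.to_nat (- - Z.of_nat (j * per + i))) with (i + j * per) by lia.
  rewrite Nat.Div0.mod_add, Nat.div_add, Nat.mod_small, Nat.div_small by lia.
  f_equal.
Qed.

Lemma wr_lay per tr w i j b : 0 < i < per ->
  wr (lay per tr w) (pos per i j) (mark b) = lay per (set2 tr i j b) w.
Proof.
  intros Hi. apply functional_extensionality. intros z. unfold wr.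
  destruct (Z.eqb_spec z (pos per i j)) as [->|Hz].
  - rewrite lay_pos by lia. unfold cell, set2. rewrite !Nat.eqb_refl.
    destruct (Nat.eqb_spec i 0); [lia|reflexivity].
  - unfold lay. destruct (Z.leb_spec z 0); [|reflexivity].
    set (m := Z.to_nat (- z)). unfold cell, set2.
    destruct (Nat.eqb_spec (m mod per) 0); [reflexivity|].
    destruct (Nat.eqb_spec (m mod per) i); [|reflexivity].
    destruct (Nat.eqb_spec (m / per) j); [|reflexivity].
    exfalso. apply Hz. pose proof (Nat.div_mod_eq m per) as E.
    unfold pos. subst i j m. nia.
Qed.

(** Positions are negative, so home is to the right. After [i] moves the head is on track 0, where
    the home cell alone is nonblank. *)
Definition home (per i : nat) : tprog :=
  Sq (mvn MoveR i) (Wh blank (mvn MoveR per)).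

Definition goto (per r i : nat) : tprog :=
  Sq (mvn MoveL r) (Sq (Wh full (mvn MoveL per)) (Sq (mvn MoveR r) (mvn MoveL i))).

Definition unary (tr : nat -> nat -> bool) (i n : nat) : Prop :=
  forall j, tr i j = (j <? n).

Lemma run_home per tr w i n : i < per ->
  run (home per i) (lay per tr w) (pos per i n) ((n + 2) * (per + 2)) (lay per tr w) 0%Z.
Proof.
  intros Hi.
  assert (H : run (Wh blank (mvn MoveR per)) (lay per tr w) (pos per 0 n)
    (n * (per + 2) + 1) (lay per tr w) 0%Z).
  { induction n.
    - apply run_wh_stop. change (lay per tr w 0%Z) with (lay per tr w (pos per 0 0)).
      rewrite lay_pos by lia. reflexivity.
    - eapply run_le; [|eapply run_wh_step; [|apply run_mvnR|]].
      3: { replace (pos per 0 (S n) + Z.of_nat per)%Z with (pos per 0 n)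
             by (unfold pos; lia). exact IHn. }
      + lia.
      + rewrite lay_pos by lia. reflexivity. }
  eapply run_le; [|eapply run_sq; [apply run_mvnR|]].
  2: { replace (pos per i n + Z.of_nat i)%Z with (pos per 0 n)
         by (unfold pos; lia). exact H. }
  nia.
Qed.

Lemma run_seek per tr w i n : 0 < i < per -> unary tr i n ->
  run (Wh full (mvn MoveL per)) (lay per tr w) (pos per i 0)
    (n * (per + 2) + 1) (lay per tr w) (pos per i n).
Proof.
  intros Hi Hu.
  assert (H : forall d j, j + d = n ->
    run (Wh full (mvn MoveL per)) (lay per tr w) (pos per i j)
    (d * (per + 2) + 1) (lay per tr w) (pos per i n)).
  { assert (Hc : forall j, full (lay per tr w (pos per i j)) = (j <? n)).
    { intros j. rewrite lay_pos by lia. unfold cell.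
      destruct (Nat.eqb_spec i 0); [lia|]. now rewrite full_mark, Hu. }
    induction d; intros j Hj.
    - replace j with n by lia. apply run_wh_stop. rewrite Hc. apply Nat.ltb_irrefl.
    - eapply run_le; [|eapply run_wh_step; [|apply run_mvnL|]].
      3: { replace (pos per i j - Z.of_nat per)%Z with (pos per i (S j))
             by (unfold pos; lia). apply IHd. lia. }
      + lia.
      + rewrite Hc. apply Nat.ltb_lt. lia. }
  apply H. lia.
Qed.

Lemma run_goto per tr w r i n : 0 < r < per -> i < per -> unary tr r n ->
  run (goto per r i) (lay per tr w) 0%Z ((n + 4) * (per + 2)) (lay per tr w) (pos per i n).
Proof.
  intros Hr Hi Hu.
  eapply run_le; [|eapply run_sq; [apply run_mvnL|eapply run_sq; [|
    eapply run_sq; [apply run_mvnR|]]]].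
  2: { replace (0 - Z.of_nat r)%Z with (pos per r 0) by (unfold pos; lia).
       apply run_seek; eassumption. }
  2: { replace (pos per i n) with (pos per r n + Z.of_nat r - Z.of_nat i)%Z
         by (unfold pos; lia). apply run_mvnL. }
  nia.
Qed.

Definition put (per r i : nat) (b : bool) : tprog :=
  Sq (goto per r i) (Sq (Wr (mark b)) (home per i)).

Lemma run_put per tr w r i n b : 0 < r < per -> 0 < i < per -> unary tr r n ->
  run (put per r i b) (lay per tr w) 0%Z ((2 * n + 7) * (per + 2))
    (lay per (set2 tr i n b) w) 0%Z.
Proof.
  intros Hr Hi Hu.
  eapply run_le; [|eapply run_sq; [apply run_goto; eauto; lia|
    eapply run_sq; [apply run_wr|]]].
  2: { rewrite wr_lay by lia. apply run_home. lia. }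
  nia.
Qed.

Definition erase (per r : nat) : tprog :=
  Sq (mvn MoveL r) (Sq (Wh full (Sq (Wr None) (mvn MoveL per))) (home per r)).

Lemma run_erase per tr w r n : 0 < r < per -> unary tr r n ->
  run (erase per r) (lay per tr w) 0%Z ((3 * n + 7) * (per + 2))
    (lay per (fun i j => if i =? r then false else tr i j) w) 0%Z.
Proof.
  intros Hr Hu.
  set (tr' := fun i j => if i =? r then false else tr i j).
  (* The tape changes in every round: in [trj] the first [j] marks of track [r] are gone and the
     other tracks are intact. *)
  assert (H : forall d j trj, j + d = n ->
    (forall k, trj r k = (j <=? k) && (k <? n)) ->
    (forall i k, i <> r -> trj i k = tr i k) ->
    run (Wh full (Sq (Wr None) (mvn MoveL per))) (lay per trj w) (pos per r j)
    (d * (per + 3) + 1) (lay per tr' w) (pos per r n)).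
  { induction d; intros j trj Hj Ha Ho.
    - replace j with n in * by lia.
      replace tr' with trj.
      2: { apply functional_extensionality. intros i.
           apply functional_extensionality. intros k. unfold tr'.
           destruct (Nat.eqb_spec i r) as [->|]; [|auto].
           rewrite Ha. destruct (Nat.leb_spec n k), (Nat.ltb_spec k n); simpl; lia. }
      apply run_wh_stop. rewrite lay_pos by lia. unfold cell.
      destruct (Nat.eqb_spec r 0); [lia|].
      rewrite full_mark, Ha, Nat.ltb_irrefl. apply andb_false_r.
    - eapply run_le; [|eapply run_wh_step; [|eapply run_sq; [apply run_wr|apply run_mvnL]|]].
      3: { replace (pos per r j - Z.of_nat per)%Z with (pos per r (S j))
             by (unfold pos; lia).
           change (@None bool) with (mark false). rewrite wr_lay by lia. apply IHd; [lia| |].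
           - intros k. unfold set2. rewrite Nat.eqb_refl, Ha, andb_true_l.
             destruct (Nat.eqb_spec k j), (Nat.leb_spec (S j) k),
               (Nat.leb_spec j k); try lia; reflexivity.
           - intros i k Hik. unfold set2.
             destruct (Nat.eqb_spec i r); [lia|]. simpl. auto. }
      + lia.
      + rewrite lay_pos by lia. unfold cell.
        destruct (Nat.eqb_spec r 0); [lia|]. rewrite full_mark, Ha.
        apply andb_true_iff. split; [apply Nat.leb_le|apply Nat.ltb_lt]; lia. }
  eapply run_le; [|eapply run_sq; [apply run_mvnL|eapply run_sq; [|apply run_home; lia]]].
  2: { replace (0 - Z.of_nat r)%Z with (pos per r 0) by (unfold pos; lia).
       apply H with (d := n); [lia| |reflexivity].
       intros k. rewrite Hu. reflexivity. }
  nia.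
Qed.

(** * Bounded-loop programs on unary registers and bit arrays *)

Record store := mkStore { regs : nat -> nat; arrs : nat -> nat -> bool }.

Definition setr (r v : nat) (s : store) : store :=
  mkStore (fun x => if x =? r then v else regs s x) (arrs s).
Definition setb (a j : nat) (b : bool) (s : store) : store :=
  mkStore (regs s) (set2 (arrs s) a j b).

Lemma store_ext s s' : arrs s = arrs s' -> (forall r, regs s r = regs s' r) -> s = s'.
Proof.
  destruct s, s'; simpl. intros -> H. f_equal. now apply functional_extensionality.
Qed.

Ltac eqb_cases :=
  repeat match goal with
  | |- context [?a =? ?b] => destruct (Nat.eqb_spec a b)
  | H : context [?a =? ?b] |- _ => destruct (Nat.eqb_spec a b)
  end.

Ltac store_eq :=
  apply store_ext; [reflexivity | intros ?r; cbn [setr setb regs arrs]; eqb_cases; subst; try lia; auto].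

Inductive cmd :=
| Skip
| Seq (c d : cmd)
| Inc (r : nat)
| Zero (r : nat)
| Put (a r : nat) (b : bool)
| IfLt (r1 r2 : nat) (c d : cmd)
| IfBit (a r : nat) (c d : cmd)
| For (r : nat) (c : cmd).

(** [B] is a parameter here, whereas the machine reads it from register 0; [comp_run] assumes that
    the two agree. A loop leaves its register at 0, which keeps registers out of scope clear. *)
Fixpoint sem (B : nat) (c : cmd) (s : store) : store :=
  match c with
  | Skip => s
  | Seq c d => sem B d (sem B c s)
  | Inc r => setr r (S (regs s r)) s
  | Zero r => setr r 0 s
  | Put a r b => setb a (regs s r) b s
  | IfLt r1 r2 c d => if regs s r1 <? regs s r2 then sem B c s else sem B d s
  | IfBit a r c d => if arrs s a (regs s r) then sem B c s else sem B d s
  | For r c =>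
      setr r 0 (Nat.iter B (fun s => let s' := sem B c s in setr r (S (regs s' r)) s')
                  (setr r 0 s))
  end.

Fixpoint assigns (r : nat) (c : cmd) : bool :=
  match c with
  | Skip | Put _ _ _ => false
  | Seq c d | IfLt _ _ c d | IfBit _ _ c d => assigns r c || assigns r d
  | Inc r' | Zero r' => r =? r'
  | For r' c => (r =? r') || assigns r c
  end.

(* Register 0 holds the loop bound and is never assigned. *)
Fixpoint ok (KR KA : nat) (c : cmd) : bool :=
  match c with
  | Skip => true
  | Seq c d => ok KR KA c && ok KR KA d
  | Inc r | Zero r => (0 <? r) && (r <? KR)
  | Put a r _ => (a <? KA) && (r <? KR)
  | IfLt r1 r2 c d => (r1 <? KR) && (r2 <? KR) && ok KR KA c && ok KR KA d
  | IfBit a r c d => (a <? KA) && (r <? KR) && ok KR KA c && ok KR KA d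
  | For r c => (0 <? r) && (r <? KR) && negb (assigns r c) && ok KR KA c
  end.

Lemma sem_frame B r c : forall s, assigns r c = false -> regs (sem B c s) r = regs s r.
Proof.
  induction c; intros s H; simpl in *; auto.
  - apply orb_false_iff in H as [H1 H2]. rewrite IHc2, IHc1; auto.
  - now rewrite H.
  - now rewrite H.
  - apply orb_false_iff in H as [H1 H2]. destruct (_ <? _); auto.
  - apply orb_false_iff in H as [H1 H2]. destruct (arrs _ _ _); auto.
  - apply orb_false_iff in H as [H1 H2]. rewrite H1.
    generalize B at 1. intros n. induction n; simpl.
    + now rewrite H1.
    + rewrite H1, IHc; auto.
Qed.

Lemma ok_assigns0 KR KA c : ok KR KA c = true -> assigns 0 c = false.
Proof.
  assert (Hr : forall r, (0 <? r) = true -> (0 =? r) = false)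
    by (intros [|r]; [discriminate|reflexivity]).
  induction c; intros H; cbn [ok assigns] in *;
    repeat match goal with
    | H : _ && _ = true |- _ => apply andb_true_iff in H as [? ?]
    end; rewrite ?IHc1, ?IHc2, ?IHc, ?Hr by assumption; reflexivity.
Qed.

(** Increments are the only way up, so counting them bounds the rise of every register additively;
    copying or doubling in one command would spoil this. A branch adds both sides instead of taking
    the maximum, to stay with sums and products. *)
Fixpoint growth (B : nat) (c : cmd) : nat :=
  match c with
  | Skip | Zero _ | Put _ _ _ => 0
  | Inc _ => 1
  | Seq c d | IfLt _ _ c d | IfBit _ _ c d => growth B c + growth B d
  | For _ c => B * S (growth B c)
  end.

Definition regs_le (V : nat) (s : store) : Prop := forall r, regs s r <= V.

Lemma regs_le_iter B V r c g n s :
  (forall V s, regs_le V s -> regs_le (V + g) (sem B c s)) -> regs_le V s ->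
  regs_le (V + n * S g)
    (Nat.iter n (fun s => let s' := sem B c s in setr r (S (regs s' r)) s') (setr r 0 s)).
Proof.
  intros Hc Hs. induction n; intros x; simpl.
  - specialize (Hs x). destruct (_ =? _); lia.
  - pose proof (Hc _ _ IHn x). pose proof (Hc _ _ IHn r). simpl in *.
    destruct (_ =? _); lia.
Qed.

Lemma sem_regs_le B c : forall V s, regs_le V s -> regs_le (V + growth B c) (sem B c s).
Proof.
  induction c; intros V s H x; simpl.
  - specialize (H x). lia.
  - pose proof (IHc2 _ _ (IHc1 _ _ H) x). lia.
  - pose proof (H x). pose proof (H r). destruct (_ =? _); lia.
  - pose proof (H x). destruct (_ =? _); lia.
  - specialize (H x). lia.
  - destruct (_ <? _); [pose proof (IHc1 _ _ H x)|pose proof (IHc2 _ _ H x)]; lia.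
  - destruct (arrs _ _ _); [pose proof (IHc1 _ _ H x)|pose proof (IHc2 _ _ H x)]; lia.
  - pose proof (regs_le_iter B V r c (growth B c) B s IHc H x).
    destruct (_ =? _); [lia|assumption].
Qed.

(** * Compiling bounded-loop programs to the tape *)

Definition period (KR KA : nat) : nat := S (KR + KA).

Definition tracks (KR : nat) (s : store) : nat -> nat -> bool :=
  fun t j => if t =? 0 then false
             else if t <=? KR then j <? regs s (t - 1) else arrs s (t - 1 - KR) j.

(** In unary, cell [regs s r1] of the track of [r2] is full iff [regs s r1 < regs s r2], so a
    comparison is one walk and one look. The loop test is this comparison with register 0, which is
    on track 1. *)
Fixpoint comp (KR KA : nat) (c : cmd) : tprog :=
  let per := period KR KA in
  match c with
  | Skip => Mv Stay
  | Seq c d => Sq (comp KR KA c) (comp KR KA d)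
  | Inc r => put per (S r) (S r) true
  | Zero r => erase per (S r)
  | Put a r b => put per (S r) (S (KR + a)) b
  | IfLt r1 r2 c d =>
      Sq (goto per (S r1) (S r2))
        (Ift full (Sq (home per (S r2)) (comp KR KA c))
                  (Sq (home per (S r2)) (comp KR KA d)))
  | IfBit a r c d =>
      Sq (goto per (S r) (S (KR + a)))
        (Ift full (Sq (home per (S (KR + a))) (comp KR KA c))
                  (Sq (home per (S (KR + a))) (comp KR KA d)))
  | For r c =>
      Sq (erase per (S r)) (Sq (goto per (S r) 1)
        (Sq (Wh full (Sq (home per 1) (Sq (comp KR KA c)
               (Sq (put per (S r) (S r) true) (goto per (S r) 1)))))
            (Sq (home per 1) (erase per (S r)))))
  end.

(** One bound for all tape primitives; [3 * V + 7] comes from [erase], the dearest of them. *)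
Definition unit_cost (KR KA V : nat) : nat := (3 * V + 7) * (period KR KA + 2).

(** Both branches of a test are charged, and every round of a loop is charged at [V'], which bounds
    the registers throughout the loop. *)
Fixpoint cost (KR KA B : nat) (c : cmd) (V : nat) : nat :=
  match c with
  | Skip => 1
  | Inc _ | Zero _ | Put _ _ _ => unit_cost KR KA V
  | Seq c d => cost KR KA B c V + cost KR KA B d (V + growth B c)
  | IfLt _ _ c d | IfBit _ _ c d =>
      2 * unit_cost KR KA V + 1 + cost KR KA B c V + cost KR KA B d V
  | For _ c =>
      let V' := V + B + B * S (growth B c) in
      (B + 4) * (4 * unit_cost KR KA V' + cost KR KA B c V' + 2)
  end.

Section Compile.
Variables KR KA : nat.
Let per := period KR KA.

Lemma tracks_unary s r : r < KR -> unary (tracks KR s) (S r) (regs s r).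
Proof.
  intros Hr j. unfold tracks. simpl Nat.eqb. cbv iota.
  destruct (Nat.leb_spec (S r) KR); [|lia]. now rewrite Nat.sub_succ, Nat.sub_0_r.
Qed.

Lemma tracks_arr s a : tracks KR s (S (KR + a)) = arrs s a.
Proof.
  apply functional_extensionality. intros j. unfold tracks. simpl Nat.eqb. cbv iota.
  destruct (Nat.leb_spec (S (KR + a)) KR); [lia|]. do 2 f_equal. lia.
Qed.

Lemma tracks_inc s r : r < KR ->
  set2 (tracks KR s) (S r) (regs s r) true = tracks KR (setr r (S (regs s r)) s).
Proof.
  intros Hr. apply functional_extensionality. intros t.
  apply functional_extensionality. intros j. unfold set2, tracks. simpl regs. simpl arrs.
  destruct (Nat.eqb_spec t (S r)) as [->|].
  - simpl Nat.eqb. cbv iota. rewrite Nat.sub_succ, Nat.sub_0_r, Nat.eqb_refl, andb_true_l.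
    destruct (Nat.leb_spec (S r) KR); [|lia].
    destruct (Nat.eqb_spec j (regs s r)), (Nat.ltb_spec j (regs s r)),
      (Nat.ltb_spec j (S (regs s r))); try lia; reflexivity.
  - rewrite andb_false_l. destruct (Nat.eqb_spec t 0); [reflexivity|].
    destruct (Nat.eqb_spec (t - 1) r); [lia|reflexivity].
Qed.

Lemma tracks_zero s r : r < KR ->
  (fun i j => if i =? S r then false else tracks KR s i j) = tracks KR (setr r 0 s).
Proof.
  intros Hr. apply functional_extensionality. intros t.
  apply functional_extensionality. intros j. unfold tracks. simpl regs. simpl arrs.
  destruct (Nat.eqb_spec t (S r)) as [->|]; simpl Nat.eqb; cbv iota.
  - rewrite Nat.sub_succ, Nat.sub_0_r, Nat.eqb_refl.
    destruct (Nat.leb_spec (S r) KR); [|lia]. reflexivity.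
  - destruct (Nat.eqb_spec t 0); [reflexivity|].
    destruct (Nat.eqb_spec (t - 1) r); [lia|reflexivity].
Qed.

Lemma tracks_setb s a j b :
  set2 (tracks KR s) (S (KR + a)) j b = tracks KR (setb a j b s).
Proof.
  apply functional_extensionality. intros t.
  apply functional_extensionality. intros k. unfold set2, tracks. simpl regs. simpl arrs.
  destruct (Nat.eqb_spec t (S (KR + a))) as [->|].
  - simpl Nat.eqb. cbv iota. destruct (Nat.leb_spec (S (KR + a)) KR); [lia|].
    unfold set2. replace (S (KR + a) - 1 - KR) with a by lia.
    now rewrite Nat.eqb_refl.
  - destruct (Nat.eqb_spec t 0); [reflexivity|].
    destruct (Nat.leb_spec t KR); [reflexivity|].
    unfold set2. destruct (Nat.eqb_spec (t - 1 - KR) a); [lia|reflexivity].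
Qed.

Let unit V := unit_cost KR KA V.

Lemma exec_goto s w V r i : r < KR -> i < per -> regs_le V s ->
  run (goto per (S r) i) (lay per (tracks KR s) w) 0 (unit V)
    (lay per (tracks KR s) w) (pos per i (regs s r)).
Proof.
  intros Hr Hi HV. eapply run_le; [|apply run_goto; [|assumption|now apply tracks_unary]].
  - specialize (HV r). unfold unit, unit_cost. fold per. nia.
  - unfold per, period. lia.
Qed.

Lemma exec_home tr w V i n : i < per -> n <= V ->
  run (home per i) (lay per tr w) (pos per i n) (unit V) (lay per tr w) 0.
Proof.
  intros Hi HV. eapply run_le; [|apply run_home; assumption].
  unfold unit, unit_cost. fold per. nia.
Qed.

Lemma exec_inc s w V r : r < KR -> regs_le V s ->
  run (put per (S r) (S r) true) (lay per (tracks KR s) w) 0 (unit V)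
    (lay per (tracks KR (setr r (S (regs s r)) s)) w) 0.
Proof.
  intros Hr HV. rewrite <- tracks_inc by assumption.
  eapply run_le; [|apply run_put; [| |now apply tracks_unary]].
  - specialize (HV r). unfold unit, unit_cost. fold per. nia.
  - unfold per, period. lia.
  - unfold per, period. lia.
Qed.

Lemma exec_zero s w V r : r < KR -> regs_le V s ->
  run (erase per (S r)) (lay per (tracks KR s) w) 0 (unit V)
    (lay per (tracks KR (setr r 0 s)) w) 0.
Proof.
  intros Hr HV. rewrite <- tracks_zero by assumption.
  eapply run_le; [|apply run_erase; [|now apply tracks_unary]].
  - specialize (HV r). unfold unit, unit_cost. fold per. nia.
  - unfold per, period. lia.
Qed.

Lemma exec_put s w V a r b : r < KR -> a < KA -> regs_le V s ->
  run (put per (S r) (S (KR + a)) b) (lay per (tracks KR s) w) 0 (unit V)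
    (lay per (tracks KR (setb a (regs s r) b s)) w) 0.
Proof.
  intros Hr Ha HV. rewrite <- tracks_setb.
  eapply run_le; [|apply run_put; [| |now apply tracks_unary]].
  - specialize (HV r). unfold unit, unit_cost. fold per. nia.
  - unfold per, period. lia.
  - unfold per, period. lia.
Qed.

Lemma exec_test s w V r i b (p q : tprog) N f h :
  r < KR -> 0 < i < per -> regs_le V s -> tracks KR s i (regs s r) = b ->
  run (if b then p else q) (lay per (tracks KR s) w) 0 N f h ->
  run (Sq (goto per (S r) i) (Ift full (Sq (home per i) p) (Sq (home per i) q)))
    (lay per (tracks KR s) w) 0 (2 * unit V + 1 + N) f h.
Proof.
  intros Hr Hi HV Hb Hrun.
  eapply run_le; [|eapply run_sq; [apply exec_goto with (V := V); auto; lia|apply run_ift]].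
  2: { rewrite lay_pos by lia. unfold cell.
       destruct (Nat.eqb_spec i 0); [lia|]. rewrite full_mark, Hb.
       replace (if b then Sq (home per i) p else Sq (home per i) q)
         with (Sq (home per i) (if b then p else q)) by now destruct b.
       eapply run_sq; [apply exec_home with (V := V); [lia|apply HV]|exact Hrun]. }
  lia.
Qed.

Theorem comp_run B w c : forall s V,
  ok KR KA c = true -> 0 < KR -> regs s 0 = B -> regs_le V s ->
  run (comp KR KA c) (lay per (tracks KR s) w) 0 (cost KR KA B c V)
    (lay per (tracks KR (sem B c s)) w) 0.
Proof.
  induction c; intros s V Hok HK HB HV; cbn [comp cost sem]; simpl in Hok;
    fold per; repeat (apply andb_true_iff in Hok as [Hok ?]);
    repeat match goal with
    | H : (_ <? _) = true |- _ => apply Nat.ltb_lt in H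
    | H : negb _ = true |- _ => apply negb_true_iff in H
    end.
  - apply run_mv.
  - apply run_sq with (lay per (tracks KR (sem B c1 s)) w) 0%Z; [now apply IHc1|].
    apply IHc2; auto.
    + rewrite sem_frame; auto. eapply ok_assigns0; eauto.
    + now apply sem_regs_le.
  - now apply exec_inc.
  - now apply exec_zero.
  - now apply exec_put.
  - eapply run_le; [|eapply exec_test with (V := V) (N := cost KR KA B c1 V + cost KR KA B c2 V); auto].
    + unfold unit. lia.
    + unfold per, period. lia.
    + rewrite (tracks_unary s r2) by assumption.
      destruct (regs s r1 <? regs s r2); [apply run_le with (cost KR KA B c1 V)|
        apply run_le with (cost KR KA B c2 V)]; auto; lia.
  - eapply run_le; [|eapply exec_test with (V := V) (N := cost KR KA B c1 V + cost KR KA B c2 V); auto].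
    + unfold unit. lia.
    + unfold per, period. lia.
    + rewrite tracks_arr.
      destruct (arrs _ _ _); [apply run_le with (cost KR KA B c1 V)|
        apply run_le with (cost KR KA B c2 V)]; auto; lia.
  - set (body := fun s => let s' := sem B c s in setr r (S (regs s' r)) s').
    set (st := fun n => Nat.iter n body (setr r 0 s)).
    set (V' := V + B + B * S (growth B c)).
    assert (Hp : 1 < per) by (unfold per, period; lia).
    assert (Hc0 : assigns 0 c = false) by (eapply ok_assigns0; eauto).
    assert (Hr : forall n, regs (st n) r = n).
    { induction n.
      - simpl. now rewrite Nat.eqb_refl.
      - change (st (S n)) with (body (st n)). unfold body. simpl.
        now rewrite Nat.eqb_refl, sem_frame, IHn. }
    assert (HB' : forall n, regs (st n) 0 = B).
    { induction n.
      - change (st 0) with (setr r 0 s). cbn [setr regs].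
        destruct (Nat.eqb_spec 0 r); [lia|auto].
      - change (st (S n)) with (body (st n)). unfold body. cbn [setr regs].
        destruct (Nat.eqb_spec 0 r); [lia|]. now rewrite sem_frame. }
    assert (HVn : forall n, regs_le (V + n * S (growth B c)) (st n)).
    { intros n. apply regs_le_iter; [intros; now apply sem_regs_le|assumption]. }
    assert (HV' : forall n, n <= B -> regs_le V' (st n)).
    { intros n Hn x. specialize (HVn n x). unfold V'. nia. }
    assert (HV0 : regs_le V' s) by (intros x; specialize (HV x); unfold V'; lia).
    set (iter_cost := 4 * unit V' + cost KR KA B c V' + 1).
    assert (Hloop : forall d j, j + d = B ->
      run (Wh full (Sq (home per 1) (Sq (comp KR KA c)
               (Sq (put per (S r) (S r) true) (goto per (S r) 1)))))
        (lay per (tracks KR (st j)) w) (pos per 1 j) (d * iter_cost + 1)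
        (lay per (tracks KR (st B)) w) (pos per 1 B)).
    (* The head is at cell [j] of track 1, the unary form of register 0, so the scanned cell decides
       [j < B]. *)
    { assert (Hcell : forall j, full (lay per (tracks KR (st j)) w (pos per 1 j)) = (j <? B)).
      { intros j. rewrite lay_pos by lia. unfold cell. simpl.
        rewrite full_mark, (tracks_unary (st j) 0 HK j), HB'. reflexivity. }
      induction d; intros j Hj.
      - replace j with B by lia. apply run_wh_stop. rewrite Hcell. apply Nat.ltb_irrefl.
      - eapply run_le; [|eapply run_wh_step; [|eapply run_sq;
          [apply exec_home with (V := V')|eapply run_sq; [apply IHc with (V := V')|
           eapply run_sq; [apply exec_inc with (V := V')|
             apply exec_goto with (V := V')]]]|]]; auto; try lia.
        6: { change (setr r (S (regs (sem B c (st j)) r)) (sem B c (st j))) with (st (S j)).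
             rewrite Hr. apply IHd. lia. }
        + unfold iter_cost. lia.
        + rewrite Hcell. apply Nat.ltb_lt. lia.
        + apply HV'. lia.
        + intros x. pose proof (sem_regs_le B c _ _ (HVn j) x). unfold V'. nia.
        + apply (HV' (S j)). lia. }
    change (Nat.iter B body (setr r 0 s)) with (st B).
    eapply run_le; [|eapply run_sq; [apply exec_zero with (V := V')|
      eapply run_sq; [apply exec_goto with (V := V') (r := r)|
      eapply run_sq; [|eapply run_sq; [apply exec_home with (V := V') (n := B)|
        apply exec_zero with (V := V')]]]]]; auto; try lia.
    3: { change (setr r 0 s) with (st 0). rewrite Hr. apply Hloop. reflexivity. }
    + fold V'. unfold iter_cost, unit.
      generalize (unit_cost KR KA V') (cost KR KA B c V'). intros; nia.
    + apply (HV' 0). lia.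
Qed.
End Compile.

(** * Moving the input into the store *)

Definition init_store (v : list bool) : store :=
  mkStore (fun r => if r =? 0 then length v else 0)
          (fun a j => if a =? 0 then nth j (rev v) false else false).

(** Register 0 counts the symbols moved so far and thus points at the next free cell of array 0;
    after the last symbol it holds the loop bound. *)
Definition push (KR KA : nat) (b : bool) : tprog :=
  Sq (put (period KR KA) 1 (S KR) b) (put (period KR KA) 1 1 true).

Definition is1 (a : option bool) : bool :=
  match a with Some true => true | _ => false end.

(* Takes symbols off the right end of the input, hence [init_store] holds the
   input in reverse. *)
Definition load_step (KR KA : nat) : tprog :=
  let back b := Sq (Wr None) (Sq (Mv MoveL) (Sq (Wh full (Mv MoveL)) (Sq (Mv MoveL)
                  (Sq (push KR KA b) (mvn MoveR 2))))) in
  Sq (Wh full (Mv MoveR)) (Sq (Mv MoveL) (Ift is1 (back true) (back false))).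

(** The first write sets the home mark in cell 0. Cell 1 stays blank and stops the leftward
    scans. *)
Definition load (KR KA : nat) : tprog :=
  Sq (mvn MoveL 2) (Sq (Wr (Some true)) (Sq (mvn MoveR 2)
    (Sq (Wh full (load_step KR KA)) (mvn MoveL 2)))).

Lemma run_scanR f : forall n h, (forall k, k < n -> full (f (h + Z.of_nat k)%Z) = true) ->
  full (f (h + Z.of_nat n)%Z) = false ->
  run (Wh full (Mv MoveR)) f h (2 * n + 1) f (h + Z.of_nat n)%Z.
Proof.
  induction n; intros h Hf Hn.
  - rewrite Z.add_0_r in *. now apply run_wh_stop.
  - eapply run_le; [|eapply run_wh_step; [|apply run_mv|]].
    3: { replace (h + Z.of_nat (S n))%Z with (shift MoveR h + Z.of_nat n)%Z
           by (simpl shift; lia). apply IHn.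
         - intros k Hk. specialize (Hf (S k)). simpl shift.
           replace (h + 1 + Z.of_nat k)%Z with (h + Z.of_nat (S k))%Z by lia.
           apply Hf. lia.
         - simpl shift. now replace (h + 1 + Z.of_nat n)%Z with (h + Z.of_nat (S n))%Z by lia. }
    + lia.
    + specialize (Hf 0). rewrite Z.add_0_r in Hf. apply Hf. lia.
Qed.

Lemma run_scanL f : forall n h, (forall k, k < n -> full (f (h - Z.of_nat k)%Z) = true) ->
  full (f (h - Z.of_nat n)%Z) = false ->
  run (Wh full (Mv MoveL)) f h (2 * n + 1) f (h - Z.of_nat n)%Z.
Proof.
  induction n; intros h Hf Hn.
  - rewrite Z.sub_0_r in *. now apply run_wh_stop.
  - eapply run_le; [|eapply run_wh_step; [|apply run_mv|]].
    3: { replace (h - Z.of_nat (S n))%Z with (shift MoveL h - Z.of_nat n)%Z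
           by (simpl shift; lia). apply IHn.
         - intros k Hk. specialize (Hf (S k)). simpl shift.
           replace (h - 1 - Z.of_nat k)%Z with (h - Z.of_nat (S k))%Z by lia.
           apply Hf. lia.
         - simpl shift. now replace (h - 1 - Z.of_nat n)%Z with (h - Z.of_nat (S n))%Z by lia. }
    + lia.
    + specialize (Hf 0). rewrite Z.sub_0_r in Hf. apply Hf. lia.
Qed.

Lemma lay_input per tr w k : lay per tr w (2 + Z.of_nat k)%Z = nth_error w k.
Proof.
  unfold lay, input_tape.
  destruct (Z.leb_spec (2 + Z.of_nat k) 0); [lia|].
  destruct (Z.ltb_spec (2 + Z.of_nat k) 2); [lia|]. f_equal. lia.
Qed.

Lemma full_nth_error (w : list bool) k : full (nth_error w k) = (k <? length w).
Proof.
  destruct (Nat.ltb_spec k (length w)) as [H|H].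
  - apply nth_error_Some in H. now destruct (nth_error w k).
  - apply nth_error_None in H. now rewrite H.
Qed.

Section Load.
Variables KR KA : nat.
Hypothesis HKR : 0 < KR.
Hypothesis HKA : 0 < KA.
Let per := period KR KA.

Lemma wr_lay_input tr u b :
  wr (lay per tr (u ++ [b])) (2 + Z.of_nat (length u)) None = lay per tr u.
Proof.
  apply functional_extensionality. intros z. unfold wr.
  destruct (Z.eqb_spec z (2 + Z.of_nat (length u))) as [->|Hz].
  - rewrite lay_input. symmetry. now apply nth_error_None.
  - unfold lay. destruct (Z.leb_spec z 0); [reflexivity|].
    unfold input_tape. destruct (Z.ltb_spec z 2); [reflexivity|].
    destruct (Nat.lt_ge_cases (Z.to_nat (z - 2)) (length u)) as [Hlt|Hge].
    + now apply nth_error_app1.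
    + rewrite nth_error_app2 by assumption. rewrite !(proj2 (nth_error_None _ _));
        auto. simpl. lia.
Qed.

Lemma run_push v w b :
  run (push KR KA b) (lay per (tracks KR (init_store v)) w) 0
    (2 * unit_cost KR KA (length v))
    (lay per (tracks KR (init_store (b :: v))) w) 0.
Proof.
  assert (HV : regs_le (length v) (init_store v)).
  { intros r. simpl. destruct (r =? 0); lia. }
  eapply run_le; [|eapply run_sq].
  2: { replace (S KR) with (S (KR + 0)) by lia.
       apply (exec_put KR KA (init_store v) w (length v) 0 0 b); auto. }
  2: { replace (init_store (b :: v)) with
         (let s := setb 0 (regs (init_store v) 0) b (init_store v) in
          setr 0 (S (regs s 0)) s).
       - apply exec_inc with (V := length v); auto.
       - unfold setb, setr, init_store. cbn [regs arrs]. f_equal.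
         + apply functional_extensionality. intros r. now destruct r.
         + apply functional_extensionality. intros a.
           apply functional_extensionality. intros j. unfold set2.
           destruct a as [|a]; [|reflexivity]. cbn [Nat.eqb andb rev].
           destruct (Nat.eqb_spec j (length v)) as [->|Hj].
           * rewrite app_nth2, length_rev, Nat.sub_diag; rewrite ?length_rev; auto.
           * destruct (Nat.lt_ge_cases j (length v)) as [Hlt|Hge].
             -- rewrite app_nth1; rewrite ?length_rev; auto.
             -- rewrite !nth_overflow; rewrite ?length_app, ?length_rev; simpl; auto; lia. }
  fold (unit_cost KR KA (length v)). lia.
Qed.

(** [u] is still on the tape and [v] has been moved; symbols leave from the right end, hence the
    reversed induction. Each one costs two scans of the remaining input and a walk into the store,
    linear in the input length. *)
Lemma run_load_loop : forall u v,
  run (Wh full (load_step KR KA)) (lay per (tracks KR (init_store v)) u) 2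
    (length u * (10 * (length (u ++ v) + 2) + 2 * unit_cost KR KA (length (u ++ v))) + 1)
    (lay per (tracks KR (init_store (u ++ v))) []) 2.
Proof.
  induction u as [|b u IH] using rev_ind; intros v.
  - apply run_wh_stop. change 2%Z with (2 + Z.of_nat 0)%Z. now rewrite lay_input.
  - eapply run_le; [|eapply run_wh_step with (h1 := 2%Z)
      (f1 := lay per (tracks KR (init_store (b :: v))) u)].
    + assert (Hm : unit_cost KR KA (length v) <= unit_cost KR KA (length (u ++ b :: v)))
        by (unfold unit_cost; rewrite length_app; simpl length; nia).
      instantiate (1 := length u * (10 * (length (u ++ b :: v) + 2) +
        2 * unit_cost KR KA (length (u ++ b :: v))) + 1).
      instantiate (1 := 9 * (length (u ++ b :: v) + 2) +
        2 * unit_cost KR KA (length (u ++ b :: v))).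
      rewrite <- app_assoc. simpl app. rewrite (length_app u [b]). simpl length. lia.
    + change 2%Z with (2 + Z.of_nat 0)%Z. rewrite lay_input, full_nth_error, length_app.
      apply Nat.ltb_lt. simpl. lia.
    + set (tr := tracks KR (init_store v)).
      eapply run_le; [|eapply run_sq; [apply run_scanR with (n := length (u ++ [b]))|
        eapply run_sq; [apply run_mv|apply run_ift]]].
      2: { intros k Hk. rewrite lay_input, full_nth_error. now apply Nat.ltb_lt. }
      2: { rewrite lay_input, full_nth_error. apply Nat.ltb_irrefl. }
      2: { replace (shift MoveL (2 + Z.of_nat (length (u ++ [b]))))
             with (2 + Z.of_nat (length u))%Z by (unfold shift; rewrite length_app; cbn [length]; lia).
           rewrite lay_input, nth_error_app2, Nat.sub_diag by lia. cbn [nth_error is1].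
           match goal with |- run ?p _ _ _ _ _ => replace p with
             (Sq (Wr None) (Sq (Mv MoveL) (Sq (Wh full (Mv MoveL)) (Sq (Mv MoveL)
                (Sq (push KR KA b) (mvn MoveR 2)))))) by now destruct b end.
           eapply run_sq; [apply run_wr|]. rewrite wr_lay_input.
           eapply run_sq; [apply run_mv|].
           eapply run_sq; [apply run_scanL with (n := length u)|].
           - intros k Hk.
             replace (shift MoveL (2 + Z.of_nat (length u)) - Z.of_nat k)%Z
               with (2 + Z.of_nat (length u - 1 - k))%Z by (unfold shift; lia).
             rewrite lay_input, full_nth_error. apply Nat.ltb_lt. lia.
           - replace (shift MoveL (2 + Z.of_nat (length u)) - Z.of_nat (length u))%Z
               with 1%Z by (unfold shift; lia).
             reflexivity.
           - eapply run_sq; [apply run_mv|].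
             replace (shift MoveL (shift MoveL (2 + Z.of_nat (length u)) - Z.of_nat (length u)))
               with 0%Z by (unfold shift; lia).
             eapply run_sq; [apply run_push|].
             apply (run_mvnR 2 _ 0%Z). }
      assert (Hm : unit_cost KR KA (length v) <= unit_cost KR KA (length (u ++ b :: v)))
        by (unfold unit_cost; rewrite length_app; simpl length; nia).
      rewrite !length_app. rewrite !length_app in Hm. simpl length in *. lia.
    + rewrite <- app_assoc. simpl app. apply IH.
Qed.

Lemma run_load w :
  run (load KR KA) (input_tape w) 2
    (length w * (10 * (length w + 2) + 2 * unit_cost KR KA (length w)) + 11)
    (lay per (tracks KR (init_store w)) []) 0.
Proof.
  eapply run_le; [|eapply run_sq; [apply run_mvnL|eapply run_sq; [apply run_wr|
    eapply run_sq; [apply run_mvnR|eapply run_sq; [|apply (run_mvnL 2 _ 2%Z)]]]]].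
  2: { replace (wr (input_tape w) (2 - Z.of_nat 2) (Some true))
         with (lay per (tracks KR (init_store [])) w).
       - change (2 - Z.of_nat 2 + Z.of_nat 2)%Z with 2%Z.
         pose proof (run_load_loop w []) as H. rewrite app_nil_r in H. exact H.
       - apply functional_extensionality. intros z. unfold wr, lay.
         change (2 - Z.of_nat 2)%Z with 0%Z.
         destruct (Z.eqb_spec z 0) as [->|Hz].
         + simpl Z.leb. cbv iota. rewrite Nat.Div0.div_0_l, Nat.Div0.mod_0_l. reflexivity.
         + destruct (Z.leb_spec z 0); [|reflexivity].
           unfold input_tape. destruct (Z.ltb_spec z 2); [|lia].
           unfold cell. set (m := Z.to_nat (- z)). pose proof (Nat.div_mod_eq m per) as E.
           destruct (Nat.eqb_spec (m mod per) 0).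
           * destruct (Nat.eqb_spec (m / per) 0); [|reflexivity]. subst m. nia.
           * unfold tracks. destruct (Nat.eqb_spec (m mod per) 0); [lia|].
             destruct (_ <=? KR).
             -- cbn [init_store regs length].
                destruct (m mod per - 1 =? 0); reflexivity.
             -- cbn [init_store arrs rev]. destruct (_ =? 0); [|reflexivity].
                destruct (m / per); reflexivity. }
  lia.
Qed.
End Load.

(** * Polynomial bounds on the cost *)

Definition poly_bounded (f : nat -> nat) : Prop :=
  exists c e, forall x, f x <= c * x ^ e + c.

(** The summand 1 is for [x = 0] and [e = 0], where the left side is [0 ^ 0 = 1]. *)
Lemma pow_le_add x e e' : x ^ e <= x ^ (e + e') + 1.
Proof.
  destruct x as [|x].
  - destruct e; simpl; lia.
  - pose proof (Nat.pow_le_mono_r (S x) e (e + e')). lia.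
Qed.

Lemma poly_const k : poly_bounded (fun _ => k).
Proof. exists k, 0. intros. lia. Qed.

Lemma poly_id : poly_bounded (fun x => x).
Proof. exists 1, 1. intros. simpl. lia. Qed.

Lemma poly_add f g : poly_bounded f -> poly_bounded g -> poly_bounded (fun x => f x + g x).
Proof.
  intros (c & e & Hf) (c' & e' & Hg). exists (2 * (c + c')), (e + e'). intros x.
  specialize (Hf x). specialize (Hg x).
  pose proof (pow_le_add x e e') as H1. pose proof (pow_le_add x e' e) as H2.
  rewrite (Nat.add_comm e' e) in H2. nia.
Qed.

Lemma poly_mul f g : poly_bounded f -> poly_bounded g -> poly_bounded (fun x => f x * g x).
Proof.
  intros (c & e & Hf) (c' & e' & Hg). exists (3 * (c * c')), (e + e'). intros x.
  pose proof (pow_le_add x e e') as H1. pose proof (pow_le_add x e' e) as H2.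
  rewrite (Nat.add_comm e' e) in H2.
  rewrite (Nat.mul_le_mono _ _ _ _ (Hf x) (Hg x)).
  replace ((c * x ^ e + c) * (c' * x ^ e' + c'))
    with (c * c' * (x ^ e * x ^ e' + x ^ e + x ^ e' + 1)) by ring.
  rewrite <- Nat.pow_add_r.
  replace (3 * (c * c') * x ^ (e + e') + 3 * (c * c'))
    with (c * c' * (3 * x ^ (e + e') + 3)) by ring.
  apply Nat.mul_le_mono_l. lia.
Qed.

Lemma poly_growth c : poly_bounded (fun B => growth B c).
Proof.
  induction c; simpl; auto using poly_const, poly_add.
  apply poly_mul; [apply poly_id|].
  apply (poly_add (fun _ => 1) _ (poly_const 1) IHc).
Qed.

Lemma poly_unit_cost KR KA V : poly_bounded V ->
  poly_bounded (fun B => unit_cost KR KA (V B)).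
Proof.
  intros HV. unfold unit_cost.
  apply poly_mul; [|apply poly_const].
  apply poly_add; [apply poly_mul|]; auto using poly_const.
Qed.

Lemma poly_cost KR KA c : forall V, poly_bounded V ->
  poly_bounded (fun B => cost KR KA B c (V B)).
Proof.
  induction c; intros V HV; cbn [cost]; auto using poly_const, poly_unit_cost.
  - apply poly_add; [apply IHc1, HV|].
    apply (IHc2 (fun B => V B + growth B c1)). auto using poly_add, poly_growth.
  - auto 7 using poly_add, poly_mul, poly_const, poly_unit_cost.
  - auto 7 using poly_add, poly_mul, poly_const, poly_unit_cost.
  - assert (HV' : poly_bounded (fun B => V B + B + B * S (growth B c))).
    { repeat apply poly_add; auto using poly_id.
      apply (poly_growth (For 0 c)). }
    apply (poly_mul (fun B => B + 4)); [auto using poly_add, poly_const, poly_id|].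
    specialize (IHc _ HV'). apply (poly_unit_cost KR KA) in HV'.
    auto 7 using poly_add, poly_mul, poly_const.
Qed.

Theorem cmd_machine KR KA c ans :
  ok KR KA c = true -> ans < KR -> 0 < KA ->
  exists (M : TM) (C e : nat), tm_wf M /\
    forall w, decides_within M w (C * length w ^ e + C)
      (0 <? regs (sem (length w) c (init_store w)) ans).
Proof.
  intros Hok Hans HKA.
  assert (HKR : 0 < KR) by lia.
  (* From home, [S ans] cells to the left is the first cell of the track of register [ans]:
     nonblank, and so accepted by [machine], iff that register is positive. *)
  set (p := Sq (load KR KA) (Sq (comp KR KA c) (mvn MoveL (S ans)))).
  set (T := fun n => n * (10 * (n + 2) + 2 * unit_cost KR KA n) + 11 +
                     (cost KR KA n c n + (S ans + 1)) + 1).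
  assert (HT : poly_bounded T).
  { pose proof (poly_cost KR KA c (fun n => n) poly_id).
    pose proof (poly_unit_cost KR KA (fun n => n) poly_id).
    unfold T. auto 10 using poly_add, poly_mul, poly_const, poly_id. }
  destruct HT as (C & e & HT). exists (machine p), C, e. split; [apply machine_wf|].
  intros w.
  assert (Hrun : run p (input_tape w) 2 (T (length w) - 1)
    (lay (period KR KA) (tracks KR (sem (length w) c (init_store w))) [])
    (0 - Z.of_nat (S ans))%Z).
  { eapply run_le; [|eapply run_sq; [apply run_load; assumption|
      eapply run_sq; [apply comp_run with (B := length w) (V := length w); auto|apply run_mvnL]]].
    - unfold T. lia.
    - intros r. simpl. destruct (r =? 0); lia. }
  destruct Hrun as (n & Hn & Hex). apply machine_decides in Hex as (i & Hi & Hs).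
  exists i. split.
  - rewrite Hi. specialize (HT (length w)). unfold T in *. lia.
  - rewrite Hs. replace (0 - Z.of_nat (S ans))%Z with (pos (period KR KA) (S ans) 0)
      by (unfold pos; lia).
    rewrite lay_pos by (unfold period; lia). unfold cell.
    simpl Nat.eqb. cbv iota. rewrite (tracks_unary KR KA _ ans Hans 0).
    now destruct (0 <? _).
Qed.

(** * Programs with quantifiers and two-dimensional arrays *)

(* [D r] is a data register, [V i] the i-th innermost loop variable. *)
Inductive ref := D (r : nat) | V (i : nat).

Inductive bexp :=
| Lt (x y : ref)
| Bit1 (a : nat) (x : ref)
| Bit2 (a : nat) (x y : ref)
| Not (e : bexp)
| And (e f : bexp)
| Ex (e : bexp).

Inductive prog :=
| PSkip
| PSeq (p q : prog)
| PInc (r : nat)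
| PZero (r : nat)
| PPut1 (a : nat) (x : ref) (b : bool)
| PPut2 (a : nat) (x y : ref) (b : bool)
| PIf (e : bexp) (p q : prog)
| PFor (p : prog).

Definition val (env : list nat) (s : store) (x : ref) : nat :=
  match x with D r => regs s r | V i => nth i env 0 end.

(** The row-major index for [i] and [j] below [B]. The minima make the formula true for all
    arguments of [lower_index], whose loops count no further than [B]. *)
Definition index (B i j : nat) : nat := min B i * B + min B j.

Fixpoint anyb (n : nat) (f : nat -> bool) : bool :=
  match n with 0 => false | S n => anyb n f || f n end.

Fixpoint loop {A} (n : nat) (f : nat -> A -> A) (s : A) : A :=
  match n with 0 => s | S n => f n (loop n f s) end.

Fixpoint eval (B : nat) (env : list nat) (s : store) (e : bexp) : bool :=
  match e with
  | Lt x y => val env s x <? val env s y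
  | Bit1 a x => arrs s a (val env s x)
  | Bit2 a x y => arrs s a (index B (val env s x) (val env s y))
  | Not e => negb (eval B env s e)
  | And e f => eval B env s e && eval B env s f
  | Ex e => anyb B (fun i => eval B (i :: env) s e)
  end.

Fixpoint psem (B : nat) (env : list nat) (p : prog) (s : store) : store :=
  match p with
  | PSkip => s
  | PSeq p q => psem B env q (psem B env p s)
  | PInc r => setr r (S (regs s r)) s
  | PZero r => setr r 0 s
  | PPut1 a x b => setb a (val env s x) b s
  | PPut2 a x y b => setb a (index B (val env s x) (val env s y)) b s
  | PIf e p q => if eval B env s e then psem B env p s else psem B env q s
  | PFor p => loop B (fun i => psem B (i :: env) p) s
  end.

Definition wf_ref (KD n : nat) (x : ref) : bool :=
  match x with D r => r <? KD | V i => i <? n end.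

Fixpoint wf_bexp (KD n : nat) (e : bexp) : bool :=
  match e with
  | Lt x y | Bit2 _ x y => wf_ref KD n x && wf_ref KD n y
  | Bit1 _ x => wf_ref KD n x
  | Not e => wf_bexp KD n e
  | And e f => wf_bexp KD n e && wf_bexp KD n f
  | Ex e => wf_bexp KD (S n) e
  end.

Fixpoint wf_prog (KD n : nat) (p : prog) : bool :=
  match p with
  | PSkip => true
  | PSeq p q => wf_prog KD n p && wf_prog KD n q
  | PInc r | PZero r => r <? KD
  | PPut1 _ x _ => wf_ref KD n x
  | PPut2 _ x y _ => wf_ref KD n x && wf_ref KD n y
  | PIf e p q => wf_bexp KD n e && wf_prog KD n p && wf_prog KD n q
  | PFor p => wf_prog KD (S n) p
  end.

Section Lower.
Variable KD : nat.

(* Register [KD] holds two-dimensional indices and is 0 between uses; the loop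
   variable and the quantifier flag of nesting level [n] follow it. *)
Definition var (n : nat) : nat := S KD + 2 * n.
Definition flag (n : nat) : nat := S (S KD) + 2 * n.

(** De Bruijn indices become levels: with [n] loops open, the [i]-th innermost has level
    [n - 1 - i]. *)
Definition lower_ref (n : nat) (x : ref) : nat :=
  match x with D r => r | V i => var (n - 1 - i) end.

Definition lower_index (n : nat) (x y : ref) : cmd :=
  Seq (For (var n) (IfLt (var n) (lower_ref n x) (For (var (S n)) (Inc KD)) Skip))
      (For (var n) (IfLt (var n) (lower_ref n y) (Inc KD) Skip)).

(** Tests are compiled with their two continuations, so that only [Ex] has to store a truth value.
    Scratch registers are cleared before a continuation starts, and [KD], being 0 between uses,
    serves as the constant 0 against which a flag is tested. [And] duplicates [d], which enlarges a
    fixed program by a constant factor only. *)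
Fixpoint lower_if (n : nat) (e : bexp) (c d : cmd) : cmd :=
  match e with
  | Lt x y => IfLt (lower_ref n x) (lower_ref n y) c d
  | Bit1 a x => IfBit a (lower_ref n x) c d
  | Bit2 a x y => Seq (lower_index n x y)
                    (IfBit a KD (Seq (Zero KD) c) (Seq (Zero KD) d))
  | Not e => lower_if n e d c
  | And e f => lower_if n e (lower_if n f c d) d
  | Ex e =>
      Seq (For (var n) (lower_if (S n) e (Seq (Zero (flag n)) (Inc (flag n))) Skip))
          (IfLt KD (flag n) (Seq (Zero (flag n)) c) d)
  end.

Fixpoint lower (n : nat) (p : prog) : cmd :=
  match p with
  | PSkip => Skip
  | PSeq p q => Seq (lower n p) (lower n q)
  | PInc r => Inc r
  | PZero r => Zero r
  | PPut1 a x b => Put a (lower_ref n x) b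
  | PPut2 a x y b => Seq (lower_index n x y) (Seq (Put a KD b) (Zero KD))
  | PIf e p q => lower_if n e (lower n p) (lower n q)
  | PFor p => For (var n) (lower (S n) p)
  end.

(* [E] lists the loop variables and quantifier flags in scope. *)
Fixpoint embed (E : list (nat * nat)) (s : store) : store :=
  match E with
  | [] => mkStore (fun r => if r <? KD then regs s r else 0) (arrs s)
  | (i, b) :: E => setr (var (length E)) i (setr (flag (length E)) b (embed E s))
  end.

Lemma embed_data E s r : r < KD -> regs (embed E s) r = regs s r.
Proof.
  intros Hr. induction E as [|[i b] E IH]; simpl.
  - apply Nat.ltb_lt in Hr. now rewrite Hr.
  - unfold var, flag. eqb_cases; lia.
Qed.

Lemma embed_free E s r : r = KD \/ var (length E) <= r -> regs (embed E s) r = 0.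
Proof.
  unfold var. induction E as [|[i b] E IH]; simpl; intros Hr.
  - destruct (Nat.ltb_spec r KD); [lia|auto].
  - unfold var, flag. eqb_cases; try lia.
Qed.

Lemma embed_arrs E s : arrs (embed E s) = arrs s.
Proof. induction E as [|[i b] E IH]; simpl; auto. Qed.

Lemma embed_ref E s x : wf_ref KD (length E) x = true ->
  regs (embed E s) (lower_ref (length E) x) = val (map fst E) s x.
Proof.
  destruct x as [r|i]; simpl; intros H; apply Nat.ltb_lt in H.
  - now apply embed_data.
  - revert i H. induction E as [|[j b] E IH]; intros i H; simpl in *; [lia|].
    destruct i as [|i].
    + replace (length E - 0 - 0) with (length E) by lia. now rewrite Nat.eqb_refl.
    + rewrite <- IH by lia. unfold var, flag. eqb_cases; try lia.
      f_equal. lia.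
Qed.

Lemma embed_setr E s r v : r < KD -> setr r v (embed E s) = embed E (setr r v s).
Proof.
  intros Hr. induction E as [|[i b] E IH]; simpl.
  - store_eq. apply Nat.ltb_lt in Hr. now rewrite Hr.
  - rewrite <- IH. unfold var, flag. store_eq.
Qed.

Lemma embed_setb E s a j b : setb a j b (embed E s) = embed E (setb a j b s).
Proof.
  induction E as [|[i v] E IH]; simpl.
  - reflexivity.
  - rewrite <- IH. reflexivity.
Qed.

Lemma embed_push E s i b :
  setr (var (length E)) i (setr (flag (length E)) b (embed E s)) = embed ((i, b) :: E) s.
Proof. reflexivity. Qed.

Lemma embed_push0 E s i : setr (var (length E)) i (embed E s) = embed ((i, 0) :: E) s.
Proof.
  simpl. store_eq. apply embed_free. right. unfold var, flag. lia.
Qed.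

(** [X j] is the store before round [j] with the loop register taken out, that is, set to 0; loop
    invariants can then ignore that register. *)
Lemma sem_For B r c (X : nat -> store) s :
  X 0 = s -> (forall j, j <= B -> regs (X j) r = 0) ->
  (forall j, j < B -> sem B c (setr r j (X j)) = setr r j (X (S j))) ->
  sem B (For r c) s = X B.
Proof.
  intros H0 Hz Hs. cbn [sem]. cbv zeta.
  assert (H : forall j, j <= B ->
    Nat.iter j (fun s => setr r (S (regs (sem B c s) r)) (sem B c s)) (setr r 0 s)
    = setr r j (X j)).
  { induction j; intros Hj.
    - now rewrite H0.
    - simpl Nat.iter. rewrite IHj, Hs by lia. store_eq. }
  rewrite H by lia. specialize (Hz B). store_eq.
Qed.

Lemma sem_Seq B c d s : sem B (Seq c d) s = sem B d (sem B c s).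
Proof. reflexivity. Qed.

Lemma sem_IfLt B r1 r2 c d s : sem B (IfLt r1 r2 c d) s =
  if regs s r1 <? regs s r2 then sem B c s else sem B d s.
Proof. reflexivity. Qed.

Lemma sem_lower_index B n x y E s : n = length E ->
  wf_ref KD n x = true -> wf_ref KD n y = true ->
  sem B (lower_index n x y) (embed E s) =
  setr KD (index B (val (map fst E) s x) (val (map fst E) s y)) (embed E s).
Proof.
  intros -> Hx Hy. unfold lower_index.
  pose proof (embed_ref E s x Hx) as Rx. pose proof (embed_ref E s y Hy) as Ry.
  assert (Hneq : forall x, wf_ref KD (length E) x = true ->
    lower_ref (length E) x <> KD /\ lower_ref (length E) x < var (length E)).
  { intros [r|i] H; apply Nat.ltb_lt in H; unfold lower_ref, var; lia. }
  apply Hneq in Hx as [Hx1 Hx2]. apply Hneq in Hy as [Hy1 Hy2]. clear Hneq.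
  set (vx := val _ s x) in *. set (vy := val _ s y) in *.
  assert (Hv : forall r, var (length E) <= r -> regs (embed E s) r = 0)
    by (intros; apply embed_free; auto).
  rewrite sem_Seq.
  rewrite (sem_For B (var (length E)) _ (fun j => setr KD (min j vx * B) (embed E s)) (embed E s)).
  - rewrite (sem_For B (var (length E)) _
      (fun j => setr KD (min B vx * B + min j vy) (embed E s))).
    + reflexivity.
    + store_eq.
    + intros j _. unfold var in *. cbn [setr regs]. eqb_cases; try lia. apply Hv. lia.
    + intros j _. rewrite sem_IfLt.
      replace (regs (setr (var (length E)) j (setr KD (min B vx * B + min j vy) (embed E s)))
        (var (length E))) with j by (cbn [setr regs]; now rewrite Nat.eqb_refl).
      replace (regs (setr (var (length E)) j (setr KD (min B vx * B + min j vy) (embed E s)))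
        (lower_ref (length E) y)) with vy by (cbn [setr regs]; eqb_cases; lia).
      destruct (Nat.ltb_spec j vy).
      * unfold var in *. cbn [sem]. store_eq.
      * unfold var in *. cbn [sem]. store_eq.
  - store_eq. symmetry. apply embed_free. auto.
  - intros j _. unfold var in *. cbn [setr regs]. eqb_cases; try lia. apply Hv. lia.
  - intros j _. rewrite sem_IfLt.
    replace (regs (setr (var (length E)) j (setr KD (min j vx * B) (embed E s)))
      (var (length E))) with j by (cbn [setr regs]; now rewrite Nat.eqb_refl).
    replace (regs (setr (var (length E)) j (setr KD (min j vx * B) (embed E s)))
      (lower_ref (length E) x)) with vx by (cbn [setr regs]; eqb_cases; lia).
    destruct (Nat.ltb_spec j vx).
    + rewrite (sem_For B (var (S (length E))) _
        (fun i => setr (var (length E)) j (setr KD (min j vx * B + i) (embed E s)))).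
      * replace (min (S j) vx) with (S (min j vx)) by lia. rewrite Nat.mul_succ_l.
        unfold var in *. store_eq.
      * unfold var in *. store_eq.
      * intros i _. unfold var in *. cbn [setr regs]. eqb_cases; try lia. apply Hv. lia.
      * intros i _. unfold var in *. cbn [sem]. store_eq.
    + replace (min (S j) vx) with (min j vx) by lia. reflexivity.
Qed.

Lemma sem_lower_if B e : forall n E c d s, n = length E -> wf_bexp KD n e = true ->
  sem B (lower_if n e c d) (embed E s) =
  if eval B (map fst E) s e then sem B c (embed E s) else sem B d (embed E s).
Proof.
  assert (Hclear : forall E s k, setr KD 0 (setr KD k (embed E s)) = embed E s).
  { intros. store_eq. symmetry. apply embed_free. auto. }
  induction e; intros n E c d s Hn Hwf; simpl in Hwf;
    repeat (apply andb_true_iff in Hwf as [Hwf ?]); cbn [lower_if eval].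
  - cbn [sem]. subst n. now rewrite !embed_ref.
  - cbn [sem]. subst n. rewrite embed_ref by assumption. now rewrite embed_arrs.
  - rewrite sem_Seq.
    rewrite sem_lower_index by assumption. cbn [sem].
    rewrite Hclear. cbn [setr regs arrs].
    now rewrite Nat.eqb_refl, embed_arrs.
  - rewrite IHe by assumption. now destruct (eval _ _ _ e).
  - rewrite IHe1 by assumption. destruct (eval _ _ _ e1); [|reflexivity].
    now rewrite IHe2.
  - rewrite sem_Seq. subst n.
    set (ex j := anyb j (fun i => eval B (i :: map fst E) s e)).
    rewrite (sem_For B (var (length E)) _
      (fun j => setr (flag (length E)) (if ex j then 1 else 0) (embed E s))).
    + cbn [sem]. cbn [setr regs].
      replace (KD =? flag (length E)) with false
        by (symmetry; apply Nat.eqb_neq; unfold flag; lia).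
      rewrite Nat.eqb_refl, embed_free by auto. fold (ex B).
      assert (Hz : setr (flag (length E)) 0 (embed E s) = embed E s).
      { store_eq. symmetry. apply embed_free. unfold flag, var. lia. }
      destruct (ex B); cbv iota.
      * change (0 <? 1) with true. cbv iota. f_equal.
        etransitivity; [|exact Hz]. store_eq.
      * change (0 <? 0) with false. cbv iota. now rewrite Hz.
    + store_eq. symmetry. apply embed_free. unfold flag, var. lia.
    + intros j _. unfold flag, var. cbn [setr regs]. eqb_cases; try lia.
      apply embed_free. unfold var. lia.
    + intros j _. rewrite embed_push, IHe by auto.
      cbn [map fst]. change (ex (S j)) with (ex j || eval B (j :: map fst E) s e).
      destruct (eval B (j :: map fst E) s e).
      * rewrite orb_true_r. cbn [sem embed]. unfold flag, var. store_eq.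
      * rewrite orb_false_r. reflexivity.
Qed.

Theorem sem_lower B p : forall n E s, n = length E -> wf_prog KD n p = true ->
  sem B (lower n p) (embed E s) = embed E (psem B (map fst E) p s).
Proof.
  induction p; intros n E s Hn Hwf; simpl in Hwf;
    repeat (apply andb_true_iff in Hwf as [Hwf ?]); cbn [lower psem].
  - reflexivity.
  - cbn [sem]. now rewrite IHp1, IHp2.
  - apply Nat.ltb_lt in Hwf. cbn [sem]. now rewrite embed_data, embed_setr.
  - apply Nat.ltb_lt in Hwf. cbn [sem]. now rewrite embed_setr.
  - cbn [sem]. subst n. now rewrite embed_ref, embed_setb.
  - rewrite sem_Seq.
    rewrite sem_lower_index by assumption. cbn [sem setr regs]. rewrite Nat.eqb_refl.
    rewrite <- embed_setb. store_eq. symmetry. apply embed_free. auto.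
  - rewrite sem_lower_if by assumption. destruct (eval _ _ _ _); auto.
  - subst n. rewrite (sem_For B (var (length E)) _
      (fun j => embed E (loop j (fun i => psem B (i :: map fst E) p) s))); auto.
    + intros j _. apply embed_free. auto.
    + intros j _. rewrite !embed_push0. now apply IHp.
Qed.
End Lower.

Theorem prog_machine KD KR KA p ans :
  ok KR KA (lower KD 0 p) = true -> wf_prog KD 0 p = true ->
  0 < KD -> ans < KD -> KD <= KR -> 0 < KA ->
  exists (M : TM) (C e : nat), tm_wf M /\
    forall w, decides_within M w (C * length w ^ e + C)
      (0 <? regs (psem (length w) [] p (init_store w)) ans).
Proof.
  intros Hok Hwf HKD Hans HKR HKA.
  destruct (cmd_machine KR KA (lower KD 0 p) ans Hok) as (M & C & e & HM & H); [lia|auto|].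
  exists M, C, e. split; [assumption|]. intros w. specialize (H w).
  assert (He : init_store w = embed KD [] (init_store w)).
  { apply store_ext; [reflexivity|]. intros r. simpl.
    destruct (Nat.eqb_spec r 0), (Nat.ltb_spec r KD); lia. }
  rewrite He, sem_lower, embed_data in H by auto. exact H.
Qed.

(** * Greedy hitting sets on peelable graphs *)

Lemma anyb_spec n f : anyb n f = true <-> exists i, i < n /\ f i = true.
Proof.
  induction n; simpl.
  - split; [discriminate|intros (i & Hi & _); lia].
  - rewrite orb_true_iff, IHn. split.
    + intros [(i & Hi & Hf)|Hf]; [exists i|exists n]; auto.
    + intros (i & Hi & Hf). destruct (Nat.eq_dec i n) as [->|]; [auto|].
      left. exists i. split; [lia|auto].
Qed.

Lemma loop_inv {A} (P : nat -> A -> Prop) n f s :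
  P 0 s -> (forall j x, j < n -> P j x -> P (S j) (f j x)) -> P n (loop n f s).
Proof.
  intros H0 Hs. assert (H : forall m, m <= n -> P m (loop m f s)); [|auto].
  induction m; intros Hm; simpl; [assumption|]. apply Hs; [lia|]. apply IHm. lia.
Qed.

Section Greedy.
Variable B : nat.
Variables A M : nat -> nat -> bool.

Record peeling := mkPeeling {
  inside : nat -> bool;
  unhit : nat -> bool;
  chosen : nat
}.

Definition leaf (W : nat -> bool) (v : nat) : bool :=
  W v && negb (anyb B (fun u => anyb B (fun u' =>
    W u && W u' && A v u && A v u' && negb (u =? u')))).

Definition forced (W U : nat -> bool) (v : nat) : bool :=
  anyb B (fun t => U t && M t v && negb (anyb B (fun u => W u && M t u && negb (u =? v)))).

Definition visit (v : nat) (s : peeling) : peeling :=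
  if leaf (inside s) v then
    let b := forced (inside s) (unhit s) v in
    mkPeeling (fun x => inside s x && negb (x =? v))
              (if b then fun t => unhit s t && negb (M t v) else unhit s)
              (if b then S (chosen s) else chosen s)
  else s.

(** In a peelable set every pass removes at least one vertex while any is left, so [B] passes empty
    it whatever the order of the visits. *)
Definition peel (s : peeling) : peeling := loop B (fun _ => loop B visit) s.

Definition bounded (W : nat -> bool) : Prop := forall x, W x = true -> x < B.

Lemma leaf_spec W v : bounded W -> leaf W v = true <->
  W v = true /\ forall u u', W u = true -> W u' = true -> A v u = true -> A v u' = true -> u = u'.
Proof.
  intros HW. unfold leaf. rewrite andb_true_iff, negb_true_iff. split.
  - intros [Hv Hn]. split; [assumption|]. intros u u' Hu Hu' Ha Ha'.
    destruct (Nat.eqb_spec u u') as [|Hne]; [assumption|].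
    rewrite <- not_true_iff_false, anyb_spec in Hn. exfalso. apply Hn.
    exists u. split; [auto|]. apply anyb_spec. exists u'. split; [auto|].
    rewrite Hu, Hu', Ha, Ha'. apply Nat.eqb_neq in Hne. now rewrite Hne.
  - intros [Hv Hl]. split; [assumption|]. rewrite <- not_true_iff_false, anyb_spec.
    intros (u & _ & Hu). apply anyb_spec in Hu as (u' & _ & Hu').
    rewrite !andb_true_iff, negb_true_iff, Nat.eqb_neq in Hu'.
    destruct Hu' as [[[[H1 H2] H3] H4] H5]. auto.
Qed.

Lemma forced_spec W U v : bounded W -> bounded U -> forced W U v = true <->
  exists t, U t = true /\ M t v = true /\ forall u, W u = true -> M t u = true -> u = v.
Proof.
  intros HW HU. unfold forced. rewrite anyb_spec. split.
  - intros (t & _ & Ht). rewrite !andb_true_iff, negb_true_iff in Ht.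
    destruct Ht as [[H1 H2] H3]. exists t. repeat split; auto. intros u Hu Hm.
    destruct (Nat.eqb_spec u v) as [|Hne]; [assumption|].
    rewrite <- not_true_iff_false, anyb_spec in H3. exfalso. apply H3.
    exists u. split; [auto|]. apply Nat.eqb_neq in Hne. now rewrite Hu, Hm, Hne.
  - intros (t & H1 & H2 & H3). exists t. split; [auto|].
    rewrite H1, H2. simpl. rewrite negb_true_iff, <- not_true_iff_false, anyb_spec.
    intros (u & _ & Hu). rewrite !andb_true_iff, negb_true_iff, Nat.eqb_neq in Hu.
    destruct Hu as [[Hu1 Hu2] Hu3]. auto.
Qed.

(** Connectedness by cuts instead of paths: every split of [C] into two nonempty sides is crossed by
    an edge. Removing a leaf then requires no rerouting. *)
Definition conn (C : nat -> bool) : Prop :=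
  forall X : nat -> bool, (exists x, C x = true /\ X x = true) ->
    (exists y, C y = true /\ X y = false) ->
    exists x y, C x = true /\ X x = true /\ C y = true /\ X y = false /\ A x y = true.

Record peel_inv (s : peeling) : Prop := {
  inv_inside : bounded (inside s);
  inv_unhit : bounded (unhit s);
  inv_meet : forall t, unhit s t = true -> exists x, inside s x = true /\ M t x = true;
  inv_conn : forall t, unhit s t = true -> conn (fun x => inside s x && M t x)
}.

(* [K] points suffice to complete the choices already made. *)
Definition within (s : peeling) (K : nat) : Prop :=
  exists Q, chosen s + length Q <= K /\ (forall q, In q Q -> inside s q = true) /\
    forall t, unhit s t = true -> exists q, In q Q /\ M t q = true.

Hypothesis A_sym : forall u v, A u v = A v u.
Hypothesis A_irr : forall u, A u u = false.

Lemma conn_remove_leaf W C v : bounded W -> leaf W v = true ->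
  (forall x, C x = true -> W x = true) -> conn C -> conn (fun x => C x && negb (x =? v)).
Proof.
  intros HB Hl HC Hconn X (x0 & Hx0 & HXx0) (y0 & Hy0 & HXy0).
  apply leaf_spec in Hl as [Hv Hl]; [|assumption].
  rewrite andb_true_iff, negb_true_iff, Nat.eqb_neq in Hx0, Hy0.
  (* [v] joins the side of its only neighbour, so the crossing edge avoids [v]. *)
  set (side := existsb (fun p => W p && A v p && C p && X p) (seq 0 B)).
  destruct (Hconn (fun x => if x =? v then side else X x)) as (x & y & H1 & H2 & H3 & H4 & H5).
  - exists x0. split; [tauto|]. destruct (Nat.eqb_spec x0 v); tauto.
  - exists y0. split; [tauto|]. destruct (Nat.eqb_spec y0 v); tauto.
  - destruct (Nat.eqb_spec x v) as [->|Hxv], (Nat.eqb_spec y v) as [->|Hyv].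
    + congruence.
    + exfalso. unfold side in H2. apply existsb_exists in H2 as (p & _ & Hp).
      rewrite !andb_true_iff in Hp. destruct Hp as [[[Hp1 Hp2] Hp3] Hp4].
      replace y with p in H4; [congruence|]. apply Hl; auto.
    + exfalso. unfold side in H4. rewrite <- not_true_iff_false in H4. apply H4.
      apply existsb_exists. exists x. split.
      * apply in_seq. specialize (HB x (HC x H1)). lia.
      * rewrite H1, H2, (HC x H1), A_sym, H5. reflexivity.
    + exists x, y. apply Nat.eqb_neq in Hxv, Hyv. rewrite H1, H3, Hxv, Hyv. auto.
Qed.

Lemma remove_length_lt Q v : In v Q -> S (length (remove Nat.eq_dec v Q)) <= length Q.
Proof. intros H. apply (remove_length_lt Nat.eq_dec) in H. lia. Qed.

(** The delicate field is [inv_meet]: an unhit set whose last vertex is [v] makes [v] forced, and is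
    then no longer unhit. *)
Lemma visit_inv v s : peel_inv s -> peel_inv (visit v s).
Proof.
  intros [Hi Hu Hm Hc]. unfold visit.
  destruct (leaf (inside s) v) eqn:Hl; [|constructor; auto].
  assert (Hsub : forall t, unhit (visit v s) t = true -> unhit s t = true).
  { intros t. unfold visit. rewrite Hl. simpl. destruct (forced _ _ _); [|auto].
    rewrite andb_true_iff. tauto. }
  unfold visit in Hsub. rewrite Hl in Hsub. simpl in Hsub.
  constructor; simpl.
  - intros x Hx. apply andb_true_iff in Hx as [Hx _]. auto.
  - intros t Ht. auto.
  - intros t Ht. destruct (forced (inside s) (unhit s) v) eqn:Hf.
    + apply andb_true_iff in Ht as [Ht Htv]. destruct (Hm t Ht) as (x & Hx & Htx).
      exists x. rewrite Hx, Htx. destruct (Nat.eqb_spec x v) as [->|]; [|auto].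
      now rewrite Htx in Htv.
    + destruct (classic (exists x, inside s x = true /\ M t x = true /\ x <> v))
        as [(x & H1 & H2 & H3)|Hno].
      * exists x. apply Nat.eqb_neq in H3. now rewrite H1, H2, H3.
      * exfalso. rewrite <- not_true_iff_false, forced_spec in Hf by assumption.
        apply Hf. exists t. destruct (Hm t Ht) as (x & Hx & Htx).
        assert (Hall : forall u, inside s u = true -> M t u = true -> u = v).
        { intros u H1 H2. destruct (Nat.eq_dec u v); [auto|]. exfalso. apply Hno.
          exists u. auto. }
        specialize (Hall x Hx Htx) as Hxv. subst x. auto.
  - intros t Ht. specialize (Hc t (Hsub t Ht)).
    apply conn_remove_leaf with (W := inside s) (v := v) in Hc; auto.
    + intros X (x & H1 & H2) (y & H3 & H4).
      destruct (Hc X) as (x' & y' & G1 & G2 & G3 & G4 & G5).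
      * exists x. split; [|auto]. rewrite !andb_true_iff in *. tauto.
      * exists y. split; [|auto]. rewrite !andb_true_iff in *. tauto.
      * exists x', y'. rewrite !andb_true_iff in *. tauto.
    + intros x Hx. apply andb_true_iff in Hx. tauto.
Qed.

Lemma visit_within v s K : peel_inv s -> within s K <-> within (visit v s) K.
Proof.
  intros [Hi Hu Hm Hc]. unfold visit.
  destruct (leaf (inside s) v) eqn:Hl; [|reflexivity].
  apply leaf_spec in Hl as [Hv Hl]; [|assumption].
  assert (Hrem : forall Q q, In q (remove Nat.eq_dec v Q) <-> In q Q /\ q <> v).
  { intros Q q. split; [apply in_remove|intros []; now apply in_in_remove]. }
  destruct (forced (inside s) (unhit s) v) eqn:Hf; unfold within; simpl.
  - apply forced_spec in Hf as (t0 & Ht0 & Hm0 & Hv0); [|assumption|assumption].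
    split.
    + intros (Q & Hlen & HQ & Hhit). exists (remove Nat.eq_dec v Q).
      assert (HvQ : In v Q).
      { destruct (Hhit t0 Ht0) as (q & Hq & Hmq). now rewrite <- (Hv0 q (HQ q Hq) Hmq). }
      apply remove_length_lt in HvQ. split; [lia|split].
      * intros q Hq. apply Hrem in Hq as [Hq Hqv]. rewrite (HQ q Hq).
        apply Nat.eqb_neq in Hqv. now rewrite Hqv.
      * intros t Ht. apply andb_true_iff in Ht as [Ht Htv].
        destruct (Hhit t Ht) as (q & Hq & Hmq). exists q. split; [|assumption].
        apply Hrem. split; [assumption|]. intros ->. now rewrite Hmq in Htv.
    + intros (Q & Hlen & HQ & Hhit). exists (v :: Q). simpl. split; [lia|split].
      * intros q [<-|Hq]; [assumption|]. apply HQ, andb_true_iff in Hq. tauto.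
      * intros t Ht. destruct (M t v) eqn:Htv; [exists v; auto|].
        destruct (Hhit t) as (q & Hq & Hmq); [now rewrite Ht, Htv|]. exists q. auto.
  - rewrite <- not_true_iff_false, forced_spec in Hf by assumption. split.
    + intros (Q & Hlen & HQ & Hhit).
      (* Cutting [v] off from the rest of the set yields an edge from [v] to a member; had the set
         no other vertex left, [v] would be forced. *)
      assert (Hnb : forall t, unhit s t = true -> M t v = true ->
        exists p, inside s p = true /\ A v p = true /\ M t p = true).
      { intros t Ht Htv.
        destruct (Hc t Ht (fun x => x =? v)) as (x & y & H1 & H2 & H3 & H4 & H5).
        - exists v. now rewrite Hv, Htv, Nat.eqb_refl.
        - destruct (classic (exists u, inside s u = true /\ M t u = true /\ u <> v))
            as [(u & H1 & H2 & H3)|Hno].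
          + exists u. apply Nat.eqb_neq in H3. now rewrite H1, H2.
          + exfalso. apply Hf. exists t. repeat split; auto. intros u H1 H2.
            destruct (Nat.eq_dec u v); [auto|]. exfalso. apply Hno. exists u. auto.
        - apply Nat.eqb_eq in H2 as ->. exists y. apply andb_true_iff in H3. tauto. }
      destruct (in_dec Nat.eq_dec v Q) as [HvQ|HvQ].
      * pose proof (remove_length_lt Q v HvQ) as Hlt.
        destruct (classic (exists p, inside s p = true /\ A v p = true)) as [(p & Hp & Hvp)|Hno].
        (* Exchange [v] for [p]: as the only neighbour left of the leaf [v], it lies in every unhit
           set that contains [v]. *)
        -- exists (p :: remove Nat.eq_dec v Q). simpl. split; [lia|split].
           ++ intros q [<-|Hq].
              ** rewrite Hp. destruct (Nat.eqb_spec p v) as [->|]; [|reflexivity].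
                 now rewrite A_irr in Hvp.
              ** apply Hrem in Hq as [Hq Hqv]. rewrite (HQ q Hq).
                 apply Nat.eqb_neq in Hqv. now rewrite Hqv.
           ++ intros t Ht. destruct (Hhit t Ht) as (q & Hq & Hmq).
              destruct (Nat.eq_dec q v) as [->|Hqv].
              ** destruct (Hnb t Ht Hmq) as (p' & H1 & H2 & H3). exists p.
                 split; [auto|]. now rewrite (Hl p p').
              ** exists q. split; [|assumption]. right. apply Hrem. auto.
        -- exists (remove Nat.eq_dec v Q). split; [lia|split].
           ++ intros q Hq. apply Hrem in Hq as [Hq Hqv]. rewrite (HQ q Hq).
              apply Nat.eqb_neq in Hqv. now rewrite Hqv.
           ++ intros t Ht. destruct (Hhit t Ht) as (q & Hq & Hmq). exists q.
              split; [|assumption]. apply Hrem. split; [assumption|]. intros ->.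
              destruct (Hnb t Ht Hmq) as (p & H1 & H2 & _). apply Hno. exists p. auto.
      * exists Q. split; [assumption|split; [|assumption]]. intros q Hq.
        rewrite (HQ q Hq). destruct (Nat.eqb_spec q v) as [->|]; [contradiction|reflexivity].
    + intros (Q & Hlen & HQ & Hhit). exists Q. split; [assumption|split; [|assumption]].
      intros q Hq. apply HQ, andb_true_iff in Hq. tauto.
Qed.

(** 1-degeneracy: for finite [W0] and a simple graph [A], this says that the graph induced on [W0]
    is a forest. *)
Definition peelable (W0 : nat -> bool) : Prop :=
  forall W, (forall x, W x = true -> W0 x = true) -> (exists x, W x = true) ->
    exists v, W v = true /\ forall u u', W u = true -> W u' = true ->
      A v u = true -> A v u' = true -> u = u'.

Definition subset (W W' : nat -> bool) : Prop := forall x, W x = true -> W' x = true.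

Lemma visit_subset v s : subset (inside (visit v s)) (inside s).
Proof.
  intros x. unfold visit. destruct (leaf _ v); simpl; [|auto].
  rewrite andb_true_iff. tauto.
Qed.

Lemma pass_subset n s : subset (inside (loop n visit s)) (inside s).
Proof.
  apply (loop_inv (fun _ x => subset (inside x) (inside s))); [intros x Hx; auto|].
  intros j x _ IH y Hy. apply IH. eapply visit_subset; eauto.
Qed.

(** A leaf stays a leaf while other vertices disappear, so it still is one when the pass reaches
    it. *)
Lemma pass_removes s v : bounded (inside s) -> leaf (inside s) v = true ->
  inside (loop B visit s) v = false.
Proof.
  intros HB Hl. apply leaf_spec in Hl as [Hv Hl]; [|assumption].
  pose proof (HB v Hv) as HvB.
  assert (H : forall n, v < n -> inside (loop n visit s) v = false).
  { induction n; intros Hn; [lia|]. simpl.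
    pose proof (visit_subset n (loop n visit s)) as Hsub.
    destruct (Nat.eq_dec v n) as [->|Hne].
    - pose proof (pass_subset n s) as Hp. set (s' := loop n visit s) in *.
      destruct (inside s' n) eqn:Hs'.
      + unfold visit. replace (leaf (inside s') n) with true.
        * simpl. now rewrite Nat.eqb_refl, andb_false_r.
        * symmetry. apply leaf_spec; [intros x Hx; auto|]. split; auto.
      + apply not_true_iff_false. intros Ht. apply Hsub in Ht. congruence.
    - apply not_true_iff_false. intros Ht. apply Hsub in Ht. rewrite IHn in Ht; [discriminate|lia]. }
  auto.
Qed.

Definition card (W : nat -> bool) : nat := length (filter W (seq 0 B)).

Lemma card_subset W W' v : subset W W' -> v < B -> W' v = true -> W v = false ->
  card W < card W'.
Proof.
  intros Hs Hv H1 H2. unfold card. apply Nat.lt_le_trans with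
    (length (v :: filter W (seq 0 B))); [simpl; lia|].
  apply NoDup_incl_length.
  - constructor; [|apply NoDup_filter, seq_NoDup].
    intros Hin. apply filter_In in Hin. destruct Hin. congruence.
  - intros x [<-|Hx].
    + apply filter_In. split; [apply in_seq; lia|assumption].
    + apply filter_In in Hx as [Hx Hw]. apply filter_In. auto.
Qed.

(** Visits preserve [within]. Once no vertex is left, [inv_meet] leaves no unhit set either, and the
    empty list is the best completion. *)
Lemma peel_spec s K : peel_inv s -> peelable (inside s) ->
  chosen (peel s) <= K <-> within s K.
Proof.
  intros Hinv Hp. unfold peel.
  assert (H : peel_inv (loop B (fun _ => loop B visit) s) /\
    (within s K <-> within (loop B (fun _ => loop B visit) s) K) /\
    subset (inside (loop B (fun _ => loop B visit) s)) (inside s) /\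
    card (inside (loop B (fun _ => loop B visit) s)) <= B - B).
  { apply (loop_inv (fun j x => peel_inv x /\ (within s K <-> within x K) /\
      subset (inside x) (inside s) /\ card (inside x) <= B - j)).
    - repeat split; auto; try (intros x; auto; fail); try apply Hinv.
      unfold card. rewrite filter_length_le, length_seq. lia.
    - intros j x Hj (H1 & H2 & H3 & H4).
      assert (Hpass : peel_inv (loop B visit x) /\ (within s K <-> within (loop B visit x) K)).
      { apply (loop_inv (fun _ y => peel_inv y /\ (within s K <-> within y K))); [auto|].
        intros i y _ [G1 G2]. split; [now apply visit_inv|].
        rewrite G2. now apply visit_within. }
      destruct Hpass as [G1 G2]. split; [assumption|split; [assumption|split]].
      + intros y Hy. apply H3. eapply pass_subset; eauto.
      + destruct (classic (exists y, inside (loop B visit x) y = true)) as [Hne|He].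
        * destruct Hne as (y & Hy). destruct (Hp (inside x) H3) as (v & Hv & Hlv).
          { exists y. eapply pass_subset; eauto. }
          assert (Hlf : leaf (inside x) v = true).
          { apply leaf_spec; [apply H1|auto]. }
          apply pass_removes in Hlf; [|apply H1].
          assert (card (inside (loop B visit x)) < card (inside x)); [|lia].
          apply card_subset with v; auto; [apply pass_subset|].
          now apply (inv_inside _ H1).
        * assert (E : filter (inside (loop B visit x)) (seq 0 B) = []).
          { destruct (filter _ _) as [|y l] eqn:E; [reflexivity|]. exfalso. apply He.
            exists y. assert (Hin : In y (y :: l)) by now left. rewrite <- E in Hin.
            apply filter_In in Hin. tauto. }
          unfold card. rewrite E. simpl. lia. }
  destruct H as (H1 & H2 & _ & H4). rewrite H2. clear H2.
  set (x := loop B _ s) in *.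
  assert (He : forall y, inside x y = false).
  { intros y. apply not_true_iff_false. intros Hy.
    assert (Hin : In y (filter (inside x) (seq 0 B))).
    { apply filter_In. split; [|assumption]. apply in_seq.
      pose proof (inv_inside _ H1 y Hy). lia. }
    unfold card in H4. destruct (filter _ _); [contradiction|simpl in H4; lia]. }
  assert (Hu : forall t, unhit x t = false).
  { intros t. apply not_true_iff_false. intros Ht.
    destruct (inv_meet _ H1 t Ht) as (y & Hy & _). now rewrite He in Hy. }
  split.
  - intros HK. exists []. simpl. split; [lia|split].
    + contradiction.
    + intros t Ht. now rewrite Hu in Ht.
  - intros (Q & HQ & _). lia.
Qed.
End Greedy.

(** * Trees and cycles *)

Lemma walk_dist E u v l : walk E u v l -> exists l', is_dist E u v l' /\ l' <= l.
Proof.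
  induction l as [l IH] using (well_founded_induction lt_wf). intros Hw.
  destruct (classic (exists l', walk E u v l' /\ l' < l)) as [(l' & Hw' & Hl')|Hno].
  - destruct (IH l' Hl' Hw') as (l'' & H1 & H2). exists l''. split; [auto|lia].
  - exists l. split; [split; [assumption|]|lia]. intros l' Hw'.
    destruct (Nat.le_gt_cases l l'); [auto|]. exfalso. apply Hno. eauto.
Qed.

Lemma dist_unique E u v l l' : is_dist E u v l -> is_dist E u v l' -> l = l'.
Proof.
  intros [H1 H2] [H3 H4]. specialize (H2 _ H3). specialize (H4 _ H1). lia.
Qed.

Lemma dist_step E u v l : is_dist E u v (S l) ->
  exists w, adj E u w /\ is_dist E w v l.
Proof.
  intros [Hw Hmin]. inversion Hw as [|? w ? ? Ha Hw']; subst. exists w.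
  split; [assumption|]. split; [assumption|]. intros l' H.
  apply le_S_n, Hmin. econstructor; eauto.
Qed.

(** Turns distances and parent edges into functions; over a finite range, induction takes the place
    of an axiom of choice. *)
Lemma finite_choice {Y} (y0 : Y) (R : nat -> Y -> Prop) n :
  (forall v, v < n -> exists y, R v y) -> exists f, forall v, v < n -> R v (f v).
Proof.
  induction n; intros H.
  - exists (fun _ => y0). intros v Hv. lia.
  - destruct IHn as (f & Hf); [auto|]. destruct (H n) as (y & Hy); [lia|].
    exists (fun v => if v =? n then y else f v). intros v Hv.
    destruct (Nat.eqb_spec v n) as [->|]; [assumption|]. apply Hf. lia.
Qed.

Section Graph.
Variable n : nat.
Variable E : list (nat * nat).
Hypothesis HG : simple_graph n E.

Lemma adj_bound u v : adj E u v -> u < n /\ v < n /\ u <> v.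
Proof.
  destruct HG as (_ & H & _). intros [Ha|Ha]; apply H in Ha; intuition.
Qed.

Lemma walk_bound u v l : walk E u v l -> v < n -> u < n.
Proof. intros Hw Hv. inversion Hw; subst; [assumption|]. now apply adj_bound in H. Qed.

(* The vertices of a shortest walk have pairwise distinct distances to its end. *)
Lemma dist_lt u v l : is_dist E u v l -> v < n -> l < n.
Proof.
  intros Hd Hv.
  assert (H : forall k, k <= l -> exists x, is_dist E x v k).
  { assert (H : forall d k, k + d = l -> exists x, is_dist E x v k).
    { induction d; intros k Hk; [exists u; now replace k with l by lia|].
      destruct (IHd (S k)) as (x & Hx); [lia|].
      apply dist_step in Hx as (w & _ & Hw). eauto. }
    intros k Hk. apply (H (l - k)). lia. }
  destruct (finite_choice 0 (fun k x => is_dist E x v k) (S l)) as (f & Hf).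
  { intros k Hk. apply H. lia. }
  assert (Hlen : length (map f (seq 0 (S l))) <= length (seq 0 n)).
  { apply NoDup_incl_length.
    - apply NoDup_map_NoDup_ForallPairs; [|apply seq_NoDup].
      intros a b Ha Hb Hab. apply in_seq in Ha, Hb.
      eapply dist_unique; [apply Hf; lia|]. rewrite Hab. apply Hf. lia.
    - intros x Hx. apply in_map_iff in Hx as (k & <- & Hk). apply in_seq in Hk.
      apply in_seq. split; [lia|]. destruct (Hf k) as [Hw _]; [lia|].
      apply (walk_bound _ _ _ Hw Hv). }
  rewrite length_map, !length_seq in Hlen. lia.
Qed.

Definition peelable_from (s : nat) : Prop :=
  forall W : nat -> bool, (forall x, W x = true -> x < n /\ x <> s) ->
    (exists x, W x = true) ->
    exists v, W v = true /\ forall u u', W u = true -> W u' = true ->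
      adj E v u -> adj E v u' -> u = u'.

Lemma unpeelable W : ~ (exists v, W v = true /\ forall u u', W u = true -> W u' = true ->
      adj E v u -> adj E v u' -> u = u') ->
  forall v, W v = true -> exists u u', W u = true /\ W u' = true /\
    adj E v u /\ adj E v u' /\ u <> u'.
Proof.
  intros Hno v Hv. apply NNPP. intros H. apply Hno. exists v. split; [assumption|].
  intros u u' H1 H2 H3 H4. apply NNPP. intros H5. apply H. exists u, u'. auto.
Qed.

(* With degree 2, a set all of whose members have two neighbours inside is
   closed under adjacency, so it would contain [s]. *)
Lemma cycle_peelable s : is_cycle n E -> s < n -> peelable_from s.
Proof.
  intros (_ & Hn & Hconn & Hdeg) Hs W HW (x & Hx). apply NNPP. intros Hno.
  pose proof (unpeelable W Hno) as H2.
  assert (Hclosed : forall v y, W v = true -> adj E v y -> W y = true).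
  { intros v y Hv Hy. apply NNPP. intros HWy.
    destruct (H2 v Hv) as (u & u' & Hu & Hu' & Ha & Ha' & Hne).
    assert (Hedge : forall z, adj E v z -> exists e, In e E /\ (e = (v, z) \/ e = (z, v))).
    { intros z [Hz|Hz]; eauto. }
    destruct (Hedge u Ha) as (e1 & I1 & E1). destruct (Hedge u' Ha') as (e2 & I2 & E2).
    destruct (Hedge y Hy) as (e3 & I3 & E3).
    assert (y <> u) by (intros ->; auto). assert (y <> u') by (intros ->; auto).
    (* A neighbour [y] outside [W] would give [v] a third edge, distinct from those to [u] and
       [u']. *)
    assert (Hlen : length [e1; e2; e3] <=
      length (filter (fun e => (fst e =? v) || (snd e =? v)) E)).
    { apply NoDup_incl_length.
      - apply adj_bound in Ha, Ha', Hy.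
        repeat constructor; simpl; intuition; subst; intuition congruence.
      - assert (Hv' : forall e z, In e E -> e = (v, z) \/ e = (z, v) ->
          In e (filter (fun e => (fst e =? v) || (snd e =? v)) E)).
        { intros e z He Hez. apply filter_In. split; [assumption|].
          destruct Hez as [->| ->]; simpl; rewrite Nat.eqb_refl; auto using orb_true_r. }
        intros e [<-|[<-|[<-|[]]]]; eauto. }
    specialize (Hdeg v). unfold degree in Hdeg. rewrite Hdeg in Hlen by (now apply HW).
    simpl in Hlen. lia. }
  destruct (Hconn x s) as (l & Hw); [now apply HW|assumption|].
  assert (Hs' : W s = true).
  { clear Hs Hno H2. revert Hx. induction Hw; eauto. }
  apply HW in Hs'. lia.
Qed.

(* Every edge joins a vertex to its parent, since the [n - 1] parent edges
   exhaust [E]; so a vertex with two neighbours in [W] has a deeper one in [W]. *)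
Lemma tree_peelable s : is_tree n E -> s < n -> peelable_from s.
Proof.
  intros (_ & Hconn & Hlen) Hs W HW (x & Hx). apply NNPP. intros Hno.
  pose proof (unpeelable W Hno) as H2.
  assert (Hdist : forall v, v < n -> exists l, is_dist E v s l).
  { intros v Hv. destruct (Hconn v s Hv Hs) as (l & Hl).
    apply walk_dist in Hl as (l' & Hl' & _). eauto. }
  destruct (finite_choice 0 _ n Hdist) as (depth & Hdepth).
  (* [f v] is the edge from [v] to a parent [p], one step closer to [s]; the root has no parent, and
     its value is arbitrary. *)
  destruct (finite_choice (0, 0) (fun v e => v <> s -> In e E /\ exists p,
    (e = (v, p) \/ e = (p, v)) /\ depth v = S (depth p)) n) as (f & Hf).
  { intros v Hv. destruct (Nat.eq_dec v s) as [->|Hvs]; [exists (0, 0); congruence|].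
    pose proof (Hdepth v Hv) as Hd. destruct (depth v) as [|l] eqn:El.
    { destruct Hd as [Hw _]. inversion Hw. congruence. }
    apply dist_step in Hd as (w & Ha & Hw). pose proof (adj_bound _ _ Ha) as (_ & Hwn & _).
    assert (depth w = l) by (eapply dist_unique; eauto).
    destruct Ha as [Ha|Ha]; [exists (v, w)|exists (w, v)]; intros _;
      split; auto; exists w; split; auto; lia. }
  set (L := filter (fun v => negb (v =? s)) (seq 0 n)).
  assert (HL : forall v, In v L <-> v < n /\ v <> s).
  { intros v. unfold L. rewrite filter_In, in_seq, negb_true_iff, Nat.eqb_neq. lia. }
  assert (HLnd : NoDup L) by apply NoDup_filter, seq_NoDup.
  assert (HLlen : n - 1 <= length L).
  { assert (length (seq 0 n) <= length (s :: L)).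
    { apply NoDup_incl_length; [apply seq_NoDup|]. intros v Hv. apply in_seq in Hv.
      destruct (Nat.eq_dec v s); [now left|right]. apply HL. lia. }
    rewrite length_seq in H. simpl in H. lia. }
  (* If two vertices shared their parent edge, each would be the parent of the other and hence less
     deep than it. *)
  assert (Hinj : forall v w, In v L -> In w L -> f v = f w -> v = w).
  { intros v w Hv Hw Hvw. apply HL in Hv as [Hv Hvs]. apply HL in Hw as [Hw Hws].
    destruct (Hf v Hv Hvs) as (_ & p & Hp & Hdp).
    destruct (Hf w Hw Hws) as (_ & q & Hq & Hdq). rewrite Hvw in Hp.
    destruct Hp as [Hp|Hp], Hq as [Hq|Hq]; rewrite Hp in Hq; inversion Hq; subst; auto; lia. }
  assert (Hall : incl E (map f L)).
  { apply NoDup_length_incl.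
    - apply NoDup_map_NoDup_ForallPairs; [|assumption]. intros v w; auto.
    - rewrite length_map, Hlen. assumption.
    - intros e He. apply in_map_iff in He as (v & <- & Hv). apply HL in Hv as [Hv Hvs].
      now apply Hf. }
  assert (Hside : forall v u, adj E v u ->
    depth u = S (depth v) \/ (In v L /\ (f v = (v, u) \/ f v = (u, v)))).
  { intros v u Ha.
    assert (He : exists e, In e E /\ (e = (v, u) \/ e = (u, v))) by (destruct Ha; eauto).
    destruct He as (e & He & Hvu). apply Hall, in_map_iff in He as (w & <- & Hw).
    pose proof (proj1 (HL w) Hw) as [Hwn Hws].
    destruct (Hf w Hwn Hws) as (_ & p & Hp & Hdp).
    destruct Hp as [Hp|Hp], Hvu as [Hvu|Hvu]; rewrite Hp in Hvu; inversion Hvu; subst; auto. }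
  assert (Hdeep : forall k, exists v, W v = true /\ k <= depth v).
  { induction k; [exists x; split; [assumption|lia]|].
    destruct IHk as (v & Hv & Hk).
    destruct (H2 v Hv) as (u & u' & Hu & Hu' & Ha & Ha' & Hne).
    destruct (Hside v u Ha) as [Hd|[_ Hp]]; [exists u; split; [assumption|lia]|].
    destruct (Hside v u' Ha') as [Hd|[_ Hp']]; [exists u'; split; [assumption|lia]|].
    exfalso. apply Hne. pose proof (adj_bound _ _ Ha). pose proof (adj_bound _ _ Ha').
    destruct Hp as [Hp|Hp], Hp' as [Hp'|Hp']; rewrite Hp in Hp'; inversion Hp'; subst; auto;
      congruence. }
  destruct (Hdeep n) as (v & Hv & Hdv). apply HW in Hv as [Hv _].
  pose proof (dist_lt _ _ _ (Hdepth v Hv) Hs). lia.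
Qed.

(** * Balls and their connectedness *)

Variable B : nat.
Hypothesis HB : n <= B.

Definition adjb (u v : nat) : bool :=
  existsb (fun e => ((fst e =? u) && (snd e =? v)) || ((fst e =? v) && (snd e =? u))) E.

Lemma adjb_spec u v : adjb u v = true <-> adj E u v.
Proof.
  unfold adjb, adj. rewrite existsb_exists. split.
  - intros ([a b] & He & H). simpl in H.
    rewrite orb_true_iff, !andb_true_iff, !Nat.eqb_eq in H.
    destruct H as [[-> ->]|[-> ->]]; auto.
  - intros [H|H]; eexists; (split; [exact H|]); simpl; rewrite !Nat.eqb_refl;
      simpl; auto using orb_true_r.
Qed.

Lemma adjb_sym u v : adjb u v = adjb v u.
Proof. apply eq_true_iff_eq. rewrite !adjb_spec. unfold adj. tauto. Qed.

Lemma adjb_irr u : adjb u u = false.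
Proof.
  apply not_true_iff_false. rewrite adjb_spec. intros H. apply adj_bound in H. tauto.
Qed.

Fixpoint ball (t j v : nat) : bool :=
  match j with
  | 0 => v =? t
  | S j => ball t j v || anyb B (fun u => ball t j u && adjb v u)
  end.

Lemma ball_spec t j : forall v, ball t j v = true <-> exists l, l <= j /\ walk E v t l.
Proof.
  induction j; intros v; simpl.
  - rewrite Nat.eqb_eq. split.
    + intros ->. exists 0. split; [lia|constructor].
    + intros (l & Hl & Hw). inversion Hw; subst; [auto|lia].
  - rewrite orb_true_iff, IHj, anyb_spec. split.
    + intros [(l & Hl & Hw)|(u & _ & Hu)]; [exists l; split; [lia|auto]|].
      apply andb_true_iff in Hu as [Hu Ha]. apply IHj in Hu as (l & Hl & Hw).
      apply adjb_spec in Ha. exists (S l). split; [lia|]. econstructor; eauto.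
    + intros (l & Hl & Hw). inversion Hw as [|? u ? l' Ha Hw']; subst.
      * left. exists 0. split; [lia|constructor].
      * right. exists u. pose proof (adj_bound _ _ Ha). split; [lia|].
        apply andb_true_iff. split; [|now apply adjb_spec].
        apply IHj. exists l'. split; [lia|auto].
Qed.

(** Distances are below [n <= B], so capping the radius at [B] loses nothing; this is why [d] may be
    read saturated. *)
Lemma ball_dist t d v : t < n ->
  ball t (min B d) v = true <-> exists l, is_dist E v t l /\ l <= d.
Proof.
  intros Ht. rewrite ball_spec. split.
  - intros (l & Hl & Hw). apply walk_dist in Hw as (l' & Hd & Hl'). exists l'.
    split; [auto|lia].
  - intros (l & Hd & Hl). pose proof (dist_lt _ _ _ Hd Ht). exists l.
    split; [lia|apply Hd].
Qed.

(** Each vertex of the ball walks to the centre inside the ball, since the rest of a walk is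
    shorter. Given a cut, a walk from the side opposite to [t] has to cross it. *)
Lemma conn_ball t j W : (forall v, ball t j v = true -> W v = true) ->
  conn adjb (fun x => W x && ball t j x).
Proof.
  intros HW X (x & Hx & HXx) (y & Hy & HXy).
  apply andb_true_iff in Hx as [_ Hx]. apply andb_true_iff in Hy as [_ Hy].
  assert (Hin : forall v, ball t j v = true -> W v && ball t j v = true).
  { intros v Hv. now rewrite (HW v Hv), Hv. }
  assert (Hcross : forall b v l, walk E v t l -> l <= j -> X v = b -> X t = negb b ->
    exists a c, ball t j a = true /\ X a = b /\ ball t j c = true /\ X c = negb b /\
      adj E a c).
  { intros b v l Hw. induction Hw as [t|v u t l Ha Hw IH]; intros Hl Hv Ht.
    - destruct b; simpl in Ht; congruence.
    - destruct (bool_dec (X u) b) as [Hu|Hu].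
      + destruct IH as (a & c & H); auto; [lia|]. exists a, c. exact H.
      + exists v, u. repeat split; auto.
        * apply ball_spec. exists (S l). split; [auto|]. econstructor; eauto.
        * apply ball_spec. exists l. split; [lia|auto].
        * destruct (X u), b; simpl; congruence. }
  apply ball_spec in Hx as (l & Hl & Hwx). apply ball_spec in Hy as (l' & Hl' & Hwy).
  destruct (bool_dec (X t) true) as [Ht|Ht%not_true_is_false].
  - destruct (Hcross false y l' Hwy Hl' HXy Ht) as (a & c & H1 & H3 & H4 & H5 & H6).
    exists c, a. rewrite !Hin, adjb_sym by assumption. apply adjb_spec in H6. auto.
  - destruct (Hcross true x l Hwx Hl HXx Ht) as (a & c & H1 & H3 & H4 & H5 & H6).
    exists a, c. rewrite !Hin by assumption. apply adjb_spec in H6. auto.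
Qed.
End Graph.

(** * The greedy search on an instance *)

Section Instance.
Variables (I : instance) (B k : nat).
Let n := inst_n I.
Let E := inst_E I.
Let TD := inst_TD I.
Hypothesis Hgraph : is_tree n E \/ is_cycle n E.
Hypothesis Hval : valid_targets I.
Hypothesis HB : n <= B.

Definition targetb (t : nat) : bool := existsb (fun p => fst p =? t) TD.

Definition coverb (t v : nat) : bool :=
  existsb (fun p => (fst p =? t) && ball E B t (min B (snd p)) v) TD.

(** [chosen] starts at 1 because [s] itself is already paid for. *)
Definition start (s : nat) : peeling :=
  mkPeeling (fun x => (x <? n) && negb (x =? s))
            (fun t => targetb t && negb (coverb t s)) 1.

Lemma graph_simple : simple_graph n E.
Proof. destruct Hgraph as [H|H]; apply H. Qed.

Lemma targetb_spec t : targetb t = true <-> exists d, In (t, d) TD.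
Proof.
  unfold targetb. rewrite existsb_exists. split.
  - intros ([t' d] & H & Ht). apply Nat.eqb_eq in Ht. simpl in Ht. subst. eauto.
  - intros (d & H). exists (t, d). split; [assumption|]. apply Nat.eqb_refl.
Qed.

(** [coverb] is a disjunction over the whole list because the program accumulates balls entry by
    entry; as no target is listed twice, only one entry contributes. *)
Lemma coverb_ball t d v : In (t, d) TD -> coverb t v = ball E B t (min B d) v.
Proof.
  intros H. apply eq_true_iff_eq. unfold coverb. rewrite existsb_exists. split.
  - intros ([t' d'] & H' & Hb). simpl in Hb. apply andb_true_iff in Hb as [Ht Hb].
    apply Nat.eqb_eq in Ht. subst t'.
    replace d with d'; [assumption|].
    destruct Hval as [Hnd _]. fold TD in Hnd. clear - H H' Hnd.
    induction TD as [|[a b] l IH]; [contradiction|]. simpl in Hnd. inversion Hnd; subst.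
    destruct H as [H|H], H' as [H'|H'].
    + congruence.
    + inversion H; subst. exfalso. apply H2. now apply (in_map fst) in H'.
    + inversion H'; subst. exfalso. apply H2. now apply (in_map fst) in H.
    + auto.
  - intros Hb. exists (t, d). split; [assumption|]. simpl. now rewrite Nat.eqb_refl.
Qed.

Lemma coverb_spec t d v : In (t, d) TD ->
  coverb t v = true <-> exists l, is_dist E v t l /\ l <= d.
Proof.
  intros H. rewrite (coverb_ball _ _ _ H). apply ball_dist with n; [|assumption|].
  - apply graph_simple.
  - now apply Hval in H.
Qed.

(** A ball that misses [s] lies wholly among the remaining vertices, so it is connected there and
    contains its own centre. *)
Lemma start_inv s : peel_inv B (adjb E) coverb (start s).
Proof.
  assert (Ht : forall t, unhit (start s) t = true -> exists d, In (t, d) TD /\ t < n /\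
    forall x, coverb t x = true -> (x <? n) && negb (x =? s) = true).
  { intros t Ht. simpl in Ht. apply andb_true_iff in Ht as [Ht Hs].
    apply targetb_spec in Ht as (d & Hd). exists d. split; [assumption|].
    assert (Htn : t < n) by now apply Hval in Hd. split; [assumption|].
    intros x Hx. apply andb_true_iff. split.
    - apply (coverb_spec t d) in Hx as (l & [Hw _] & _); [|assumption].
      apply Nat.ltb_lt. eapply walk_bound; eauto. apply graph_simple.
    - apply negb_true_iff, Nat.eqb_neq. intros ->. now rewrite Hx in Hs. }
  constructor.
  - intros x Hx. simpl in Hx. apply andb_true_iff in Hx as [Hx _].
    apply Nat.ltb_lt in Hx. lia.
  - intros t H. destruct (Ht t H) as (d & _ & Hn & _). lia.
  - intros t H. destruct (Ht t H) as (d & Hd & Hn & Hx). exists t.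
    assert (Hc : coverb t t = true).
    { apply (coverb_spec t d); [assumption|]. exists 0. split; [|lia].
      split; [constructor|lia]. }
    split; [now apply Hx|assumption].
  - intros t H. destruct (Ht t H) as (d & Hd & Hn & Hx).
    pose proof (conn_ball n E graph_simple B HB t (min B d)
      (fun x => (x <? n) && negb (x =? s))) as Hc.
    assert (Heq : forall x, coverb t x = ball E B t (min B d) x)
      by (intros; now apply coverb_ball).
    intros X HX HY. simpl in *. setoid_rewrite Heq in HX. setoid_rewrite Heq in HY.
    setoid_rewrite Heq. apply Hc; auto. intros v Hv. apply Hx. now rewrite Heq.
Qed.

Lemma start_peelable s : s < n -> peelable (adjb E) (inside (start s)).
Proof.
  intros Hs W HW Hne.
  assert (Hp : peelable_from n E s).
  { destruct Hgraph as [H|H].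
    - apply tree_peelable; auto. apply graph_simple.
    - apply cycle_peelable; auto. apply graph_simple. }
  destruct (Hp W) as (v & Hv & Hl); auto.
  - intros x Hx. apply HW in Hx. simpl in Hx.
    rewrite andb_true_iff, negb_true_iff, Nat.ltb_lt, Nat.eqb_neq in Hx. exact Hx.
  - exists v. split; [assumption|]. intros u u' Hu Hu' Ha Ha'.
    apply Hl; auto; now apply adjb_spec.
Qed.

(** Any member of a nonempty placement can play [s]; the empty placement covers only the empty set
    of targets. *)
Theorem yes_instance_greedy : yes_instance I k <->
  TD = [] \/ exists s, s < n /\ chosen (peel B (adjb E) coverb (start s)) <= k.
Proof.
  assert (Hspec : forall s, s < n ->
    chosen (peel B (adjb E) coverb (start s)) <= k <-> within coverb (start s) k).
  { intros s Hs. apply peel_spec.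
    - apply adjb_sym.
    - apply adjb_irr with n. apply graph_simple.
    - apply start_inv.
    - now apply start_peelable. }
  split.
  - intros (P & (Hnd & Hin & Hcov) & Hlen). destruct P as [|s Q].
    { left. destruct TD as [|[t d] l] eqn:Etd; [reflexivity|]. exfalso.
      destruct (Hcov t d) as (p & _ & [] & _). fold TD. rewrite Etd. now left. }
    right. exists s. assert (Hs : s < n) by (apply Hin; now left). split; [assumption|].
    apply Hspec; [assumption|]. inversion Hnd as [|? ? HsQ HndQ]; subst.
    exists Q. simpl in Hlen. split; [simpl; lia|split].
    + intros q Hq. simpl. apply andb_true_iff. split.
      * apply Nat.ltb_lt, Hin. now right.
      * apply negb_true_iff, Nat.eqb_neq. congruence.
    + intros t Ht. simpl in Ht. apply andb_true_iff in Ht as [Ht Hts].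
      apply targetb_spec in Ht as (d & Hd).
      destruct (Hcov t d Hd) as (p & l & Hp & Hl).
      assert (Hc : coverb t p = true) by (apply (coverb_spec t d); eauto).
      exists p. destruct Hp as [<-|Hp]; [now rewrite Hc in Hts|auto].
  - intros [Htd|(s & Hs & Hg)].
    + exists []. split; [|simpl; lia]. split; [constructor|split].
      * contradiction.
      * intros t d H. fold TD in H. rewrite Htd in H. contradiction.
    + apply Hspec in Hg as (Q & Hlen & HQ & Hhit); [|assumption].
      (* [within] allows repetitions in [Q]; a placement does not. *)
      simpl in Hlen. exists (nodup Nat.eq_dec (s :: Q)). split.
      * split; [apply NoDup_nodup|split].
        -- intros p Hp. apply nodup_In in Hp as [<-|Hp]; [assumption|].
           apply HQ in Hp. simpl in Hp. apply andb_true_iff in Hp as [Hp _].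
           now apply Nat.ltb_lt in Hp.
        -- intros t d Hd.
           assert (Hc : exists p, In p (s :: Q) /\ coverb t p = true).
           { destruct (coverb t s) eqn:Hts; [exists s; split; [now left|assumption]|].
             destruct (Hhit t) as (q & Hq & Hc).
             - simpl. rewrite Hts, andb_true_r. apply targetb_spec. eauto.
             - exists q. split; [now right|assumption]. }
           destruct Hc as (p & Hp & Hc). apply (coverb_spec t d) in Hc as (l & Hl); [|assumption].
           exists p, l. split; [now apply nodup_In|exact Hl].
      * transitivity (length (s :: Q)); [|simpl; lia].
        apply NoDup_incl_length; [apply NoDup_nodup|]. intros p Hp. now apply nodup_In in Hp.
Qed.
End Instance.

(** * The solver: parsing *)

(** Syntactic frame conditions, so that what a concrete program leaves alone is settled by
    computation. *)
Fixpoint passigns (r : nat) (p : prog) : bool :=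
  match p with
  | PInc r' | PZero r' => r =? r'
  | PSeq p q | PIf _ p q => passigns r p || passigns r q
  | PFor p => passigns r p
  | _ => false
  end.

Fixpoint pputs (a : nat) (p : prog) : bool :=
  match p with
  | PPut1 a' _ _ | PPut2 a' _ _ _ => a =? a'
  | PSeq p q | PIf _ p q => pputs a p || pputs a q
  | PFor p => pputs a p
  | _ => false
  end.

Lemma psem_regs_frame B r p : forall env s, passigns r p = false ->
  regs (psem B env p s) r = regs s r.
Proof.
  induction p; intros env s H; simpl in *; auto;
    try (apply orb_false_iff in H as [H1 H2]).
  - now rewrite IHp2, IHp1.
  - now rewrite H.
  - now rewrite H.
  - destruct (eval _ _ _ _); auto.
  - apply (loop_inv (fun _ x => regs x r = regs s r)); [auto|].
    intros j x _ Hx. now rewrite IHp.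
Qed.

Lemma psem_arrs_frame B a p : forall env s, pputs a p = false ->
  arrs (psem B env p s) a = arrs s a.
Proof.
  induction p; intros env s H; simpl in *; auto;
    try (apply orb_false_iff in H as [H1 H2]).
  - now rewrite IHp2, IHp1.
  - apply functional_extensionality. intros j. unfold set2. now rewrite H.
  - apply functional_extensionality. intros j. unfold set2. now rewrite H.
  - destruct (eval _ _ _ _); auto.
  - apply (loop_inv (fun _ x => arrs x a = arrs s a)); [auto|].
    intros j x _ Hx. now rewrite IHp.
Qed.

Lemma setr_id r s : setr r (regs s r) s = s.
Proof. store_eq. Qed.

Lemma setr_same r v s : regs (setr r v s) r = v.
Proof. cbn [setr regs]. now rewrite Nat.eqb_refl. Qed.

Lemma setr_other r r' v s : r' <> r -> regs (setr r v s) r' = regs s r'.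
Proof. intros H. cbn [setr regs]. apply Nat.eqb_neq in H. now rewrite H. Qed.

(* Addition saturating at the loop bound. *)
Definition p_add (r q : nat) : prog :=
  PFor (PIf (And (Lt (V 0) (D q)) (Lt (D r) (D 0))) (PInc r) PSkip).

Lemma psem_add B env r q s : r <> q -> r <> 0 -> regs s 0 = B -> regs s r <= B ->
  psem B env (p_add r q) s = setr r (min B (regs s r + min B (regs s q))) s.
Proof.
  intros Hrq Hr0 HB Hr. cbn [psem p_add].
  apply (loop_inv (fun j x => x = setr r (min B (regs s r + min j (regs s q))) s)).
  - rewrite Nat.min_0_l, Nat.add_0_r, Nat.min_r by assumption. symmetry. apply setr_id.
  - intros j x Hj ->. cbn [eval val nth].
    rewrite setr_same, !setr_other, HB by auto.
    destruct (Nat.ltb_spec j (regs s q)), (Nat.ltb_spec (min B (regs s r + min j (regs s q))) B);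
      cbn [andb]; store_eq.
Qed.

(* Register allocation of the solver: 0 loop bound, 1 constant zero, 2 input
   position, 3 weight of the next bit (saturated), 4 scratch, 5 end-of-number flag,
   6 number of vertices, 7 and 8 the pair being read, 9 budget [k], 10 points chosen,
   11 answer (nonzero for yes), 12 end-of-list flag, 13 and 14 reversal.
   Arrays: 0 reversed input, 1 input, 2 adjacency, 3 targets, 4 balls (row [t] is
   the ball of target [t]), 5 and 6 the ball being grown, 7 vertices left, 8 targets
   not yet hit. *)
Definition read_bit (dst : nat) : prog :=
  PIf (Lt (D 1) (D 5)) PSkip
    (PIf (Bit1 1 (D 2))
       (PSeq (PInc 2) (PSeq (PIf (Bit1 1 (D 2)) (p_add dst 3) PSkip)
         (PSeq (PInc 2) (PSeq (PZero 4) (PSeq (p_add 4 3) (p_add 3 4))))))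
       (PSeq (PInc 2) (PSeq (PInc 2) (PInc 5)))).

Definition parse_nat (dst : nat) : prog :=
  PSeq (PZero dst) (PSeq (PZero 3) (PSeq (PInc 3) (PSeq (PZero 5) (PFor (read_bit dst))))).

Definition parse_list (item : prog) : prog :=
  PSeq (PZero 12) (PFor (PIf (Lt (D 1) (D 12)) PSkip
    (PIf (Bit1 1 (D 2)) (PSeq (PInc 2) item) (PSeq (PInc 2) (PInc 12))))).

Fixpoint bits_value (l : list bool) : nat :=
  match l with [] => 0 | b :: l => Nat.b2n b + 2 * bits_value l end.

Lemma bits_value_bits n : bits_value (bits n) = n.
Proof.
  unfold bits. assert (H : forall f m, m <= f -> bits_value (bits_aux f m) = m); [|auto].
  induction f; intros m Hm; [simpl; lia|].
  destruct m as [|m]; [reflexivity|]. cbn [bits_aux bits_value].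
  rewrite IHf.
  - pose proof (Nat.div2_odd (S m)). lia.
  - pose proof (Nat.div2_decr m f). simpl. destruct m; [lia|].
    pose proof (Nat.div2_decr m (m)). lia.
Qed.

Definition code (l : list bool) : list bool :=
  flat_map (fun b => [true; b]) l ++ [false; false].

Lemma code_length l : length (code l) = 2 * length l + 2.
Proof.
  unfold code. rewrite length_app. simpl.
  assert (length (flat_map (fun b : bool => [true; b]) l) = 2 * length l); [|lia].
  induction l; simpl; lia.
Qed.

Section Parse.
Variable w : list bool.
Let B := length w.

Definition base (s : store) : Prop :=
  regs s 0 = B /\ regs s 1 = 0 /\ forall j, arrs s 1 j = nth j w false.

Definition cursor (s : store) (rest : list bool) : Prop := skipn (regs s 2) w = rest.

Lemma cursor_cons s b rest : base s -> cursor s (b :: rest) ->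
  arrs s 1 (regs s 2) = b /\ skipn (S (regs s 2)) w = rest.
Proof.
  intros (_ & _ & Hw) Hc. rewrite Hw. unfold cursor in Hc. generalize dependent (regs s 2).
  clear. induction w as [|a l IH]; intros p Hp.
  - now rewrite skipn_nil in Hp.
  - destruct p as [|p]; simpl in *.
    + inversion Hp. auto.
    + now apply IH.
Qed.

Lemma cursor_length s rest : cursor s rest -> length rest <= B.
Proof. intros <-. rewrite length_skipn. unfold B. lia. Qed.

(** [acc] is the true value of the [i] bits read so far, least significant first; the registers hold
    it and the weight [2 ^ i] capped at [B]. *)
Definition reading (dst m i : nat) (bs rest : list bool) (s : store) : Prop :=
  base s /\ regs s 5 = 0 /\ cursor s (code bs ++ rest) /\ regs s 3 = min B (2 ^ i) /\
  exists acc, regs s dst = min B acc /\ acc + 2 ^ i * bits_value bs = m.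

Definition read (dst m : nat) (rest : list bool) (s : store) : Prop :=
  base s /\ regs s 5 = 1 /\ cursor s rest /\ regs s dst = min B m.

(** Capping each summand does not change a capped sum, so saturated arithmetic tracks the true
    values. The weight is doubled by adding a copy of it made in register 4. *)
Lemma read_bit_more env dst m i b bs rest s : 5 < dst ->
  reading dst m i (b :: bs) rest s ->
  reading dst m (S i) bs rest (psem B env (read_bit dst) s).
Proof.
  intros Hd (Hb & H5 & Hc & H3 & acc & Hacc & Hm).
  change (code (b :: bs) ++ rest) with (true :: b :: (code bs ++ rest)) in Hc.
  pose proof Hb as (H0 & H1 & Hw).
  destruct (cursor_cons s _ _ Hb Hc) as [Ht Hc1].
  set (s1 := setr 2 (S (regs s 2)) s).
  assert (Hb1 : base s1) by exact Hb.
  destruct (cursor_cons s1 _ _ Hb1 Hc1) as [Hbit Hc2].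
  change (regs s1 2) with (S (regs s 2)) in *.
  unfold read_bit. cbn [psem eval val].
  rewrite H5, H1, Ht. cbn [Nat.ltb Nat.leb]. fold s1.
  change (regs s1 2) with (S (regs s 2)). rewrite Hbit.
  set (v := min B (acc + (if b then 2 ^ i else 0))).
  assert (Es2 : (if b then psem B env (p_add dst 3) s1 else s1) = setr dst v s1).
  { assert (Hdst : regs s1 dst = min B acc).
    { unfold s1. rewrite setr_other by lia. exact Hacc. }
    destruct b.
    - rewrite psem_add; try lia.
      + change (regs s1 3) with (regs s 3). rewrite Hdst, H3. f_equal. unfold v. lia.
      + exact H0.
    - unfold v. rewrite Nat.add_0_r, <- Hdst. symmetry. apply setr_id. }
  rewrite Es2. set (s2 := setr dst v s1).
  assert (E2 : regs s2 2 = S (regs s 2)).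
  { unfold s2. rewrite setr_other by lia. reflexivity. }
  rewrite E2. set (s4 := setr 4 0 (setr 2 (S (S (regs s 2))) s2)).
  assert (Es4 : forall r, r <> 4 -> r <> 2 -> r <> dst -> regs s4 r = regs s r).
  { intros r R1 R2 R3. unfold s4, s2, s1. now rewrite !setr_other by assumption. }
  rewrite (psem_add B env 4 3 s4); try lia.
  2: { rewrite Es4 by lia. exact H0. }
  2: { simpl. lia. }
  rewrite (Es4 3) by lia. change (regs s4 4) with 0.
  rewrite psem_add; try lia.
  2: { rewrite setr_other, Es4 by lia. exact H0. }
  2: { rewrite setr_other, Es4 by lia. lia. }
  rewrite setr_same, setr_other, (Es4 3), H3 by lia.
  set (pw := min B (min B (2 ^ i) + _)).
  assert (Hpw : pw = min B (2 ^ S i)) by (unfold pw; rewrite Nat.pow_succ_r'; lia).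
  set (sf := setr 3 pw _).
  assert (Hsf : forall r, r <> 3 -> r <> 4 -> r <> 2 -> r <> dst -> regs sf r = regs s r).
  { intros r R1 R2 R3 R4. unfold sf. rewrite !setr_other by assumption. now apply Es4. }
  split; [|split; [|split; [|split]]].
  - split; [rewrite Hsf; auto; lia|split; [rewrite Hsf; auto; lia|exact Hw]].
  - rewrite Hsf; auto; lia.
  - exact Hc2.
  - exact Hpw.
  - exists (acc + (if b then 2 ^ i else 0)). split.
    + unfold sf, s4. rewrite !setr_other by lia. apply setr_same.
    + rewrite Nat.pow_succ_r'. cbn [bits_value] in Hm.
      destruct b; cbn [Nat.b2n] in Hm; nia.
Qed.

Lemma read_bit_last env dst m i rest s : 5 < dst ->
  reading dst m i [] rest s -> read dst m rest (psem B env (read_bit dst) s).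
Proof.
  intros Hd (Hb & H5 & Hc & H3 & acc & Hacc & Hm).
  change (code [] ++ rest) with (false :: false :: rest) in Hc.
  destruct (cursor_cons s _ _ Hb Hc) as [Ht Hc1].
  destruct (cursor_cons (setr 2 (S (regs s 2)) s) _ _ Hb Hc1) as [_ Hc2].
  destruct Hb as (H0 & H1 & Hw).
  unfold read_bit. cbn [psem eval val].
  rewrite H5, H1, Ht. cbn [Nat.ltb Nat.leb].
  split; [|split; [|split]].
  - split; [exact H0|split; [exact H1|exact Hw]].
  - cbn [setr regs Nat.eqb]. now rewrite H5.
  - exact Hc2.
  - rewrite !setr_other by lia. rewrite Hacc. cbn [bits_value] in Hm. f_equal. lia.
Qed.

Lemma read_bit_done env dst m rest s :
  read dst m rest s -> psem B env (read_bit dst) s = s.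
Proof.
  intros ((H0 & H1 & Hw) & H5 & _). unfold read_bit. cbn [psem eval val].
  now rewrite H1, H5.
Qed.

(** [B] rounds suffice: every bit takes two symbols and the end two more, so there are fewer bits
    than [B]. Rounds after the end mark do nothing. *)
Lemma parse_nat_spec env dst m rest s : 5 < dst -> base s -> cursor s (enc_nat m ++ rest) ->
  let s' := psem B env (parse_nat dst) s in
  base s' /\ cursor s' rest /\ regs s' dst = min B m.
Proof.
  intros Hd Hb Hc.
  pose proof (cursor_length _ _ Hc) as Hlen. rewrite length_app in Hlen.
  change (enc_nat m) with (code (bits m)) in *. rewrite code_length in Hlen.
  set (bs := bits m) in *.
  unfold parse_nat. cbn [psem].
  match goal with |- context [loop B _ ?x] => set (s0 := x) end.
  assert (E0 : s0 = setr 5 0 (setr 3 1 (setr dst 0 s))).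
  { unfold s0. rewrite setr_same. store_eq. }
  assert (Hinv : (B <= length bs /\ reading dst m B (skipn B bs) rest
      (loop B (fun i => psem B (i :: env) (read_bit dst)) s0)) \/
    (length bs < B /\ read dst m rest
      (loop B (fun i => psem B (i :: env) (read_bit dst)) s0))).
  { apply (loop_inv (fun j x => (j <= length bs /\ reading dst m j (skipn j bs) rest x) \/
      (length bs < j /\ read dst m rest x))).
    - left. split; [lia|]. rewrite E0. destruct Hb as (H0 & H1 & Hw).
      split; [|split; [|split; [|split]]].
      + split; [rewrite !setr_other by lia; exact H0|
          split; [rewrite !setr_other by lia; exact H1|exact Hw]].
      + reflexivity.
      + unfold cursor. rewrite !setr_other by lia. exact Hc.
      + cbn [setr regs Nat.eqb Nat.pow]. lia.
      + exists 0. split.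
        * rewrite !setr_other, setr_same by lia. lia.
        * simpl skipn. unfold bs. rewrite bits_value_bits. simpl. lia.
    - intros j x Hj [[Hj' Hr]|[Hj' Hr]].
      + destruct (skipn j bs) as [|b l] eqn:El.
        * right. apply (f_equal (@length bool)) in El. rewrite length_skipn in El.
          simpl in El. split; [lia|]. eapply read_bit_last; eauto.
        * left. pose proof (f_equal (@length bool) El) as Hl. rewrite length_skipn in Hl.
          simpl in Hl. split; [lia|].
          replace (skipn (S j) bs) with l.
          -- eapply read_bit_more; eauto.
          -- change (S j) with (1 + j). rewrite <- skipn_skipn, El. reflexivity.
      + right. split; [lia|]. erewrite read_bit_done; eauto. }
  destruct Hinv as [[Hx _]|[_ (H1 & H2 & H3 & H4)]]; [lia|auto].
Qed.

Lemma enc_list_length_ge {X} (f : X -> list bool) l : S (length l) <= length (enc_list f l).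
Proof.
  unfold enc_list. rewrite length_app. simpl.
  induction l; simpl; rewrite ?length_app; lia.
Qed.

(** [Q d s] is to say that the entries [d] have been absorbed into [s]; it must ignore the position
    and the end flag, which the loop itself updates. Every entry takes a symbol and the end one
    more, so [B] rounds suffice. *)
Lemma parse_list_spec env item (Q : list (nat * nat) -> store -> Prop) l rest s :
  passigns 12 item = false ->
  (forall d s r v, r = 2 \/ r = 12 -> Q d s -> Q d (setr r v s)) ->
  (forall j d x tl s, incl [x] l -> base s -> Q d s -> cursor s (enc_pair x ++ tl) ->
     let s' := psem B (j :: env) item s in base s' /\ Q (d ++ [x]) s' /\ cursor s' tl) ->
  base s -> Q [] s -> cursor s (enc_list enc_pair l ++ rest) ->
  let s' := psem B env (parse_list item) s in base s' /\ Q l s' /\ cursor s' rest.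
Proof.
  intros Hf HQs Hitem Hb HQ Hc.
  pose proof (cursor_length _ _ Hc) as Hlen. rewrite length_app in Hlen.
  pose proof (enc_list_length_ge enc_pair l) as Hge.
  unfold parse_list. cbn [psem].
  match goal with |- context [loop B ?f] => set (body := f) end.
  assert (Hset : forall r v x, r = 2 \/ r = 12 -> base x -> base (setr r v x)).
  { intros r v x Hr (H0 & H1 & Hw). split; [|split; [|exact Hw]];
      rewrite setr_other by lia; assumption. }
  assert (Hinv : forall j, j <= B -> let x := loop j body (setr 12 0 s) in base x /\
    ((j <= length l /\ regs x 12 = 0 /\ Q (firstn j l) x /\
        cursor x (enc_list enc_pair (skipn j l) ++ rest)) \/
     (length l < j /\ regs x 12 = 1 /\ Q l x /\ cursor x rest))).
  { induction j; intros Hj; cbn [loop].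
    - split; [auto|]. left. split; [lia|split; [reflexivity|split; [auto|exact Hc]]].
    - specialize (IHj ltac:(lia)). cbv zeta in *. set (x := loop j body _) in *.
      destruct IHj as [Hbx Hx]. pose proof Hbx as (H0 & H1 & Hw).
      unfold body. cbn [psem eval val]. rewrite H1.
      destruct Hx as [(Hj1 & H12 & HQx & Hcx)|(Hj1 & H12 & HQx & Hcx)]; rewrite H12;
        cbn [Nat.ltb Nat.leb].
      + destruct (skipn j l) as [|y tl] eqn:El.
        * change (enc_list enc_pair [] ++ rest) with (false :: rest) in Hcx.
          destruct (cursor_cons _ _ _ Hbx Hcx) as [-> Hc1].
          apply (f_equal (@length _)) in El as Hl. rewrite length_skipn in Hl. simpl in Hl.
          rewrite firstn_all2 in HQx by lia.
          split; [auto|right]. split; [lia|split; [|split; [auto|exact Hc1]]].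
          rewrite setr_same, setr_other by lia. now rewrite H12.
        * assert (Ec : enc_list enc_pair (y :: tl) ++ rest =
            true :: (enc_pair y ++ enc_list enc_pair tl ++ rest)).
          { unfold enc_list. cbn [flat_map app]. now rewrite <- !app_assoc. }
          rewrite Ec in Hcx. destruct (cursor_cons _ _ _ Hbx Hcx) as [-> Hc1].
          assert (Hl : skipn (S j) l = tl).
          { change (S j) with (1 + j). now rewrite <- skipn_skipn, El. }
          assert (Hy : firstn (S j) l = firstn j l ++ [y]).
          { rewrite <- (firstn_skipn j l) at 1. rewrite El.
            apply (f_equal (@length _)) in El. rewrite length_skipn in El. simpl in El.
            rewrite firstn_app, length_firstn, firstn_all2 by (rewrite length_firstn; lia).
            replace (S j - min j (length l)) with 1 by lia. reflexivity. }
          assert (Hin : incl [y] l).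
          { intros z [<-|[]]. rewrite <- (firstn_skipn j l), El.
            apply in_app_iff. right. now left. }
          apply (f_equal (@length _)) in El as Hll. rewrite length_skipn in Hll.
          simpl in Hll.
          destruct (Hitem j (firstn j l) y (enc_list enc_pair tl ++ rest)
            (setr 2 (S (regs x 2)) x)) as (G1 & G2 & G3); auto.
          split; [assumption|left]. rewrite Hl, Hy. split; [lia|split; [|auto]].
          rewrite psem_regs_frame, setr_other by (auto; lia). exact H12.
      + split; [assumption|right]. split; [lia|auto]. }
  destruct (Hinv B (le_n _)) as [Hbx [(Hj & _)|(_ & _ & HQx & Hcx)]]; [lia|auto].
Qed.
End Parse.

(** * Array assignment and reversal of the input *)

Lemma anyb_ext n f g : (forall i, i < n -> f i = g i) -> anyb n f = anyb n g.
Proof.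
  induction n; intros H; simpl; [reflexivity|]. rewrite IHn, H; auto.
Qed.

Lemma index_eqb B i j i' j' : i < B -> j < B -> i' < B -> j' < B ->
  (index B i j =? index B i' j') = (i =? i') && (j =? j').
Proof.
  intros. unfold index. rewrite !Nat.min_r by lia.
  apply eq_true_iff_eq. rewrite andb_true_iff, !Nat.eqb_eq. split; [|intros [-> ->]; auto].
  intros E. assert (i = i') by nia. subst. split; [auto|lia].
Qed.

Definition assign (a : nat) (e : bexp) : prog :=
  PFor (PIf e (PPut1 a (V 0) true) (PPut1 a (V 0) false)).

(** Entries are overwritten one at a time, so [e] must yield [g i] in every store that differs from
    [s] in array [a] only. *)
Lemma psem_assign B env a e g s :
  (forall i x, i < B -> regs x = regs s -> (forall a', a' <> a -> arrs x a' = arrs s a') ->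
     eval B (i :: env) x e = g i) ->
  let s' := psem B env (assign a e) s in
  regs s' = regs s /\ (forall a', a' <> a -> arrs s' a' = arrs s a') /\
  (forall i, i < B -> arrs s' a i = g i).
Proof.
  intros He. unfold assign. cbn [psem].
  assert (H : forall n, n <= B -> let x := loop n (fun i s =>
      if eval B (i :: env) s e then setb a i true s else setb a i false s) s in
    regs x = regs s /\ (forall a', a' <> a -> arrs x a' = arrs s a') /\
    (forall i, i < n -> arrs x a i = g i)).
  { induction n; intros Hn; cbn [loop].
    - repeat split; auto. intros; lia.
    - destruct IHn as (H1 & H2 & H3); [lia|]. set (x := loop n _ s) in *.
      rewrite (He n x) by (auto; lia).
      replace (if g n then setb a n true x else setb a n false x) with (setb a n (g n) x)
        by now destruct (g n).
      split; [exact H1|split].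
      + intros a' Ha. cbn [setb arrs]. apply functional_extensionality. intros i.
        unfold set2. apply Nat.eqb_neq in Ha as Ha'. rewrite Ha'. cbn [andb].
        now rewrite H2.
      + intros i Hi. cbn [setb arrs]. unfold set2. rewrite Nat.eqb_refl. cbn [andb].
        destruct (Nat.eqb_spec i n) as [->|]; [reflexivity|]. apply H3. lia. }
  apply (H B). lia.
Qed.

(* For position [i], register 14 counts from [i + 1] up to the bound while
   register 13 counts the steps, ending at [B - 1 - i]. *)
Definition reverse : prog :=
  PFor (PSeq (PZero 13) (PSeq (PZero 14)
    (PSeq (PFor (PIf (Lt (V 0) (V 1)) (PInc 14) PSkip))
    (PSeq (PInc 14)
    (PSeq (PFor (PIf (Lt (D 14) (D 0)) (PSeq (PInc 14) (PInc 13)) PSkip))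
          (PIf (Bit1 0 (D 13)) (PPut1 1 (V 0) true) PSkip)))))).

Lemma reverse_spec w : let s := psem (length w) [] reverse (init_store w) in
  base w s /\ regs s 2 = 0 /\ regs s 11 = 0 /\ forall a, 2 <= a -> arrs s a = fun _ => false.
Proof.
  set (B := length w). intros s.
  assert (Hfr : forall a, a <> 1 -> arrs s a = arrs (init_store w) a).
  { intros a Ha. apply psem_arrs_frame. apply Nat.eqb_neq in Ha. simpl. now rewrite Ha. }
  assert (Hr : forall r, r <> 13 -> r <> 14 -> regs s r = regs (init_store w) r).
  { intros r H1 H2. apply psem_regs_frame. apply Nat.eqb_neq in H1, H2.
    unfold reverse. cbn [passigns]. now rewrite H1, H2. }
  split; [|split; [|split]].
  2, 3: now rewrite Hr by lia.
  2: { intros a Ha. rewrite Hfr by lia. apply functional_extensionality. intros j.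
       simpl. destruct a; [lia|reflexivity]. }
  split; [now rewrite Hr by lia|split; [now rewrite Hr by lia|]].
  assert (H : regs s 0 = B /\ (forall j, arrs s 0 j = nth j (rev w) false) /\
    forall j, arrs s 1 j = (j <? B) && nth j w false).
  { unfold s, reverse. cbn [psem].
    apply (loop_inv (fun n x => regs x 0 = B /\ (forall j, arrs x 0 j = nth j (rev w) false) /\
      forall j, arrs x 1 j = (j <? n) && nth j w false)); [now repeat split|].
    intros i x Hi (H0 & Ha & H1).
    set (x1 := setr 14 0 (setr 13 0 x)).
    replace (loop B (fun j s => if eval B [j; i] s (Lt (V 0) (V 1))
        then setr 14 (S (regs s 14)) s else s) x1) with (setr 14 i x1).
    2: { symmetry.
         replace (setr 14 i x1) with (setr 14 (min B i) x1) by (f_equal; lia).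
         apply (loop_inv (fun j y => y = setr 14 (min j i) x1)).
         - store_eq.
         - intros j y Hj ->. cbn [eval val nth]. rewrite setr_same.
           destruct (Nat.ltb_spec j i); store_eq. }
    rewrite setr_same. set (x2 := setr 14 (S i) _).
    match goal with |- context [loop B ?f x2] =>
      replace (loop B f x2) with (setr 14 B (setr 13 (B - 1 - i) x2)) end.
    2: { symmetry.
         replace (setr 14 B (setr 13 (B - 1 - i) x2)) with
           (setr 14 (min B (S i + B)) (setr 13 (min B (B - 1 - i)) x2))
           by (f_equal; [lia|f_equal; lia]).
         apply (loop_inv (fun j y => y = setr 14 (min B (S i + j)) (setr 13 (min j (B - 1 - i)) x2))).
         - unfold x2, x1. store_eq; cbn [setr regs Nat.eqb]; lia.
         - intros j y Hj ->. cbn [eval val]. rewrite setr_same.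
           replace (regs (setr 14 _ (setr 13 (min j (B - 1 - i)) x2)) 0) with B
             by (symmetry; exact H0).
           destruct (Nat.ltb_spec (min B (S i + j)) B); cbn [psem]; store_eq. }
    cbn [eval val].
    replace (arrs (setr 14 B (setr 13 (B - 1 - i) x2)) 0
      (regs (setr 14 B (setr 13 (B - 1 - i) x2)) 13)) with (nth i w false).
    2: { change (arrs (setr 14 B (setr 13 (B - 1 - i) x2)) 0) with (arrs x 0).
         change (regs (setr 14 B (setr 13 (B - 1 - i) x2)) 13) with (B - 1 - i).
         rewrite Ha, rev_nth by (fold B; lia). f_equal. fold B. lia. }
    assert (Hstep : forall j, (j <? S i) && nth j w false =
      if j =? i then nth i w false else (j <? i) && nth j w false).
    { intros j. destruct (Nat.eqb_spec j i) as [->|].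
      - destruct (Nat.ltb_spec i (S i)); [reflexivity|lia].
      - destruct (Nat.ltb_spec j (S i)), (Nat.ltb_spec j i); try lia; reflexivity. }
    destruct (nth i w false) eqn:Eb; cbn [nth val].
    - split; [exact H0|split; [exact Ha|]]. intros j. rewrite Hstep.
      cbn [setb arrs]. unfold set2. cbn [Nat.eqb andb].
      destruct (j =? i); [reflexivity|]. apply H1.
    - split; [exact H0|split; [exact Ha|]]. intros j. rewrite Hstep.
      destruct (Nat.eqb_spec j i) as [->|]; [|apply H1].
      transitivity ((i <? i) && nth i w false); [apply H1|now rewrite Nat.ltb_irrefl]. }
  destruct H as (_ & _ & H). intros j. rewrite H.
  destruct (Nat.ltb_spec j B); [reflexivity|]. now rewrite nth_overflow.
Qed.

(** * Reading edges and targets *)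

Section Items.
Variable w : list bool.
Let B := length w.

Definition edge_item : prog :=
  PSeq (parse_nat 7) (PSeq (parse_nat 8)
    (PSeq (PPut2 2 (D 7) (D 8) true) (PPut2 2 (D 8) (D 7) true))).

Definition holds_adj (E : list (nat * nat)) (s : store) : Prop :=
  forall u v, u < B -> v < B -> arrs s 2 (index B u v) = adjb E u v.

Lemma parse_nat_regs env dst r s : r <> dst -> r = 7 \/ r = 12 ->
  regs (psem B env (parse_nat dst) s) r = regs s r.
Proof.
  intros Hr Hr'. apply psem_regs_frame. apply Nat.eqb_neq in Hr.
  unfold parse_nat, read_bit, p_add. cbn [passigns]. rewrite Hr.
  destruct Hr' as [->| ->]; reflexivity.
Qed.

Lemma parse_nat_arrs env dst s : arrs (psem B env (parse_nat dst) s) = arrs s.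
Proof.
  apply functional_extensionality. intros a. now apply psem_arrs_frame.
Qed.

Lemma edge_item_spec env E u v tl s : u < B -> v < B -> base w s -> holds_adj E s ->
  cursor w s (enc_pair (u, v) ++ tl) ->
  let s' := psem B env edge_item s in
  base w s' /\ holds_adj (E ++ [(u, v)]) s' /\ cursor w s' tl.
Proof.
  intros Hu Hv Hb HE Hc. unfold enc_pair in Hc. simpl in Hc. rewrite <- app_assoc in Hc.
  unfold edge_item. cbn [psem].
  destruct (parse_nat_spec w env 7 u (enc_nat v ++ tl) s) as (Hb1 & Hc1 & H71); auto.
  pose proof (parse_nat_arrs env 7 s) as A1. fold B in Hb1, Hc1, H71.
  set (s1 := psem B env (parse_nat 7) s) in *.
  destruct (parse_nat_spec w env 8 v tl s1) as (Hb2 & Hc2 & H82); auto.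
  pose proof (parse_nat_arrs env 8 s1) as A2. fold B in Hb2, Hc2, H82.
  pose proof (parse_nat_regs env 8 7 s1 ltac:(lia) ltac:(lia)) as H72.
  set (s2 := psem B env (parse_nat 8) s1) in *.
  cbn [val]. rewrite H71, Nat.min_r in H72 by lia. rewrite Nat.min_r in H82 by lia.
  change (regs (setb 2 (index B (regs s2 7) (regs s2 8)) true s2)) with (regs s2).
  rewrite H72, H82.
  split; [exact Hb2|split; [|exact Hc2]].
  intros a b Ha Hb'. cbn [setb arrs]. unfold set2. cbn [Nat.eqb andb].
  rewrite !index_eqb by assumption. rewrite A2, A1, HE by assumption.
  unfold adjb. rewrite existsb_app. cbn [existsb fst snd]. rewrite orb_false_r.
  rewrite (Nat.eqb_sym a v), (Nat.eqb_sym b u), (Nat.eqb_sym a u), (Nat.eqb_sym b v).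
  destruct (v =? a), (u =? b), (u =? a), (v =? b), (existsb _ E); reflexivity.
Qed.

(** The contradiction in the first assignment serves as the constant false, and the negated
    conjunction of negations as a disjunction. Array 6 buffers the next ball, so that a round
    consults only the previous one. *)
Definition compute_ball : prog :=
  PSeq (assign 5 (And (Bit1 5 (V 0)) (Not (Bit1 5 (V 0)))))
  (PSeq (PPut1 5 (D 7) true)
  (PSeq (PFor (PIf (Lt (V 0) (D 8))
          (PSeq (assign 6 (Not (And (Not (Bit1 5 (V 0)))
                   (Not (Ex (And (Bit1 5 (V 0)) (Bit2 2 (V 1) (V 0))))))))
                (assign 5 (Bit1 6 (V 0)))) PSkip))
        (PFor (PIf (Bit1 5 (V 0)) (PPut2 4 (D 7) (V 0) true) PSkip)))).

Lemma compute_ball_spec env E t d s : t < B -> regs s 7 = t -> regs s 8 = min B d ->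
  holds_adj E s ->
  let s' := psem B env compute_ball s in
  (forall u v, u < B -> v < B -> arrs s' 4 (index B u v) =
     arrs s 4 (index B u v) || ((t =? u) && ball E B t (min B d) v)).
Proof.
  intros Ht H7 H8 HE. unfold compute_ball. cbn [psem].
  set (s1 := psem B env (assign 5 _) s).
  assert (H1 : regs s1 = regs s /\ (forall a, a <> 5 -> arrs s1 a = arrs s a) /\
    forall i, i < B -> arrs s1 5 i = false).
  { apply psem_assign with (g := fun _ => false). intros i x _ _ _.
    cbn [eval]. destruct (arrs x 5 _); reflexivity. }
  destruct H1 as (R1 & A1 & F1).
  cbn [val]. rewrite R1, H7. set (s2 := setb 5 t true s1).
  assert (Hloop : forall j, j <= B -> let x := loop j (fun i s0 =>
      if eval B (i :: env) s0 (Lt (V 0) (D 8))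
      then psem B (i :: env) (assign 5 (Bit1 6 (V 0)))
             (psem B (i :: env) (assign 6 (Not (And (Not (Bit1 5 (V 0)))
                   (Not (Ex (And (Bit1 5 (V 0)) (Bit2 2 (V 1) (V 0)))))))) s0)
      else s0) s2 in
    regs x = regs s /\ (forall a, a <> 5 -> a <> 6 -> arrs x a = arrs s a) /\
    forall v, v < B -> arrs x 5 v = ball E B t (min j (min B d)) v).
  { induction j; intros Hj; cbn [loop].
    - split; [exact R1|split].
      + intros a Ha _. rewrite <- A1 by assumption. unfold s2. cbn [setb arrs].
        apply functional_extensionality. intros i. unfold set2.
        apply Nat.eqb_neq in Ha. now rewrite Ha.
      + intros v Hv. unfold s2. cbn [setb arrs]. unfold set2. cbn [Nat.eqb andb].
        rewrite F1 by assumption. cbn [Nat.min ball]. now destruct (v =? t).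
    - destruct IHj as (R & A & Hball); [lia|]. cbv zeta. set (x := loop j _ s2) in *.
      cbn [eval val nth]. rewrite R, H8.
      destruct (Nat.ltb_spec j (min B d)) as [Hlt|Hge].
      2: { replace (min (S j) (min B d)) with (min j (min B d)) by lia. auto. }
      replace (min (S j) (min B d)) with (S j) by lia.
      replace (min j (min B d)) with j in Hball by lia.
      match goal with |- context [psem B (j :: env) (assign 6 ?e) x] =>
        set (y := psem B (j :: env) (assign 6 e) x) end.
      assert (Hy : regs y = regs x /\ (forall a, a <> 6 -> arrs y a = arrs x a) /\
        forall v, v < B -> arrs y 6 v = ball E B t (S j) v).
      { apply psem_assign. intros v z Hv Rz Az. cbn [eval val nth].
        rewrite (Az 5), Hball, <- negb_orb, negb_involutive by lia. cbn [ball]. f_equal.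
        apply anyb_ext. intros u Hu. rewrite Hball by assumption. f_equal.
        rewrite (Az 2), (A 2) by lia. now apply HE. }
      destruct Hy as (Ry & Ay & Fy).
      destruct (psem_assign B (j :: env) 5 (Bit1 6 (V 0)) (ball E B t (S j)) y)
        as (Rz & Az & Fz).
      { intros v z Hv _ Az. cbn [eval val nth]. rewrite (Az 6) by lia. auto. }
      split; [congruence|split].
      + intros a H5 H6. rewrite Az, Ay, A; auto.
      + exact Fz. }
  specialize (Hloop B (le_n B)). cbv zeta in Hloop. set (x := loop B _ s2) in *.
  destruct Hloop as (R & A & Hball).
  replace (min B (min B d)) with (min B d) in Hball by lia.
  intros u v Hu Hv.
  assert (Hfill : forall j, j <= B -> let y := loop j (fun i s0 =>
      if eval B (i :: env) s0 (Bit1 5 (V 0))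
      then setb 4 (index B (regs s0 7) (val (i :: env) s0 (V 0))) true s0 else s0) x in
    regs y = regs s /\ arrs y 5 = arrs x 5 /\
    arrs y 4 (index B u v) = arrs s 4 (index B u v) ||
      ((t =? u) && (v <? j) && ball E B t (min B d) v)).
  { induction j; intros Hj; cbn [loop].
    - split; [assumption|split; [reflexivity|]]. rewrite A by lia.
      change (v <? 0) with false. now rewrite andb_false_r, orb_false_r.
    - destruct IHj as (Ry & A5 & A4); [lia|]. cbv zeta. set (y := loop j _ x) in *.
      cbn [eval val nth]. rewrite Ry, H7, A5, Hball by lia.
      assert (Hlt : (v <? S j) = (v <? j) || (j =? v)).
      { apply eq_true_iff_eq. rewrite orb_true_iff, !Nat.ltb_lt, Nat.eqb_eq. lia. }
      rewrite Hlt. destruct (ball E B t (min B d) j) eqn:Eb.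
      + split; [exact Ry|split; [exact A5|]]. cbn [setb arrs]. unfold set2.
        cbn [Nat.eqb andb]. rewrite index_eqb, A4 by (assumption || lia).
        rewrite (Nat.eqb_sym u t), (Nat.eqb_sym v j).
        destruct (Nat.eqb_spec j v) as [->|].
        * rewrite Eb. destruct (t =? u), (v <? v), (arrs s 4 _); reflexivity.
        * rewrite andb_false_r, orb_false_r. reflexivity.
      + split; [exact Ry|split; [exact A5|]]. rewrite A4.
        destruct (Nat.eqb_spec j v) as [->|].
        * rewrite Eb. now rewrite !andb_false_r.
        * now rewrite orb_false_r. }
  destruct (Hfill B (le_n B)) as (_ & _ & Hf). cbv zeta in Hf.
  etransitivity; [exact Hf|]. apply Nat.ltb_lt in Hv. now rewrite Hv, andb_true_r.
Qed.

Definition target_item : prog :=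
  PSeq (parse_nat 7) (PSeq (parse_nat 8) (PSeq (PPut1 3 (D 7) true) compute_ball)).

Definition holds_targets (E TD : list (nat * nat)) (s : store) : Prop :=
  (forall t, t < B -> arrs s 3 t = existsb (fun p => fst p =? t) TD) /\
  (forall t v, t < B -> v < B -> arrs s 4 (index B t v) =
     existsb (fun p => (fst p =? t) && ball E B t (min B (snd p)) v) TD).

Lemma target_item_spec env E TD t d tl s : t < B -> base w s -> holds_adj E s ->
  holds_targets E TD s -> cursor w s (enc_pair (t, d) ++ tl) ->
  let s' := psem B env target_item s in
  base w s' /\ holds_adj E s' /\ holds_targets E (TD ++ [(t, d)]) s' /\ cursor w s' tl.
Proof.
  intros Ht Hb HE [HT HM] Hc. unfold enc_pair in Hc. simpl in Hc. rewrite <- app_assoc in Hc.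
  unfold target_item. cbn [psem].
  destruct (parse_nat_spec w env 7 t (enc_nat d ++ tl) s) as (Hb1 & Hc1 & H71); auto.
  pose proof (parse_nat_arrs env 7 s) as A1. fold B in Hb1, Hc1, H71.
  set (s1 := psem B env (parse_nat 7) s) in *.
  destruct (parse_nat_spec w env 8 d tl s1) as (Hb2 & Hc2 & H82); auto.
  pose proof (parse_nat_arrs env 8 s1) as A2. fold B in Hb2, Hc2, H82.
  pose proof (parse_nat_regs env 8 7 s1 ltac:(lia) ltac:(lia)) as H72.
  set (s2 := psem B env (parse_nat 8) s1) in *.
  cbn [val]. rewrite H71, Nat.min_r in H72 by lia. rewrite H72.
  set (s3 := setb 3 t true s2).
  assert (HE3 : holds_adj E s3).
  { intros a b Ha Hb'. unfold s3. cbn [setb arrs]. unfold set2. cbn [Nat.eqb andb].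
    rewrite A2, A1. auto. }
  pose proof (compute_ball_spec env E t d s3 Ht H72 H82 HE3) as HM3.
  assert (Hfr : forall a, a <> 4 -> a <> 5 -> a <> 6 ->
    arrs (psem B env compute_ball s3) a = arrs s3 a).
  { intros a N1 N2 N3. apply psem_arrs_frame. apply Nat.eqb_neq in N1, N2, N3.
    unfold compute_ball, assign. cbn [pputs]. now rewrite N1, N2, N3. }
  assert (Hrfr : forall r, regs (psem B env compute_ball s3) r = regs s3 r).
  { intros r. now apply psem_regs_frame. }
  cbv zeta in HM3. set (s4 := psem B env compute_ball s3) in *.
  split; [|split; [|split; [split|]]].
  - destruct Hb2 as (H0 & H1 & Hw). split; [|split].
    + now rewrite Hrfr.
    + now rewrite Hrfr.
    + intros j. rewrite Hfr by lia. exact (Hw j).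
  - intros a b Ha Hb'. rewrite Hfr by lia. auto.
  - intros a Ha. rewrite Hfr by lia. unfold s3. cbn [setb arrs]. unfold set2.
    cbn [Nat.eqb andb]. rewrite existsb_app. cbn [existsb fst].
    rewrite A2, A1, HT, (Nat.eqb_sym a t), orb_false_r by assumption.
    destruct (t =? a), (existsb _ TD); reflexivity.
  - intros a v Ha Hv. rewrite HM3 by assumption. unfold s3. cbn [setb arrs]. unfold set2.
    cbn [Nat.eqb andb]. rewrite A2, A1, HM, existsb_app by assumption.
    cbn [existsb fst snd]. rewrite orb_false_r. f_equal.
    destruct (Nat.eqb_spec t a) as [->|]; reflexivity.
  - unfold cursor. rewrite Hrfr. exact Hc2.
Qed.
End Items.

(** * The solver: greedy search *)

Definition Neq (x y : ref) : bexp := Not (And (Not (Lt x y)) (Not (Lt y x))).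

Lemma eval_Neq B env s x y : eval B env s (Neq x y) = negb (val env s x =? val env s y).
Proof.
  cbn [eval Neq]. f_equal. apply eq_true_iff_eq.
  rewrite andb_true_iff, !negb_true_iff, !Nat.ltb_ge, Nat.eqb_eq. lia.
Qed.

Definition leaf_test : bexp :=
  And (Bit1 7 (V 0)) (Not (Ex (Ex (And (And (And (And (Bit1 7 (V 1)) (Bit1 7 (V 0)))
    (Bit2 2 (V 2) (V 1))) (Bit2 2 (V 2) (V 0))) (Neq (V 1) (V 0)))))).

Definition forced_test : bexp :=
  Ex (And (And (Bit1 8 (V 0)) (Bit2 4 (V 0) (V 1)))
    (Not (Ex (And (And (Bit1 7 (V 0)) (Bit2 4 (V 1) (V 0))) (Neq (V 0) (V 2)))))).

Definition visit_prog : prog :=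
  PIf leaf_test
    (PSeq (PIf forced_test
            (PSeq (PInc 10) (PFor (PIf (Bit2 4 (V 0) (V 1)) (PPut1 8 (V 0) false) PSkip)))
            PSkip)
          (PPut1 7 (V 0) false))
    PSkip.

Definition try_root : prog :=
  PIf (Lt (V 0) (D 6))
    (PSeq (assign 7 (And (Lt (V 0) (D 6)) (Neq (V 0) (V 1))))
    (PSeq (assign 8 (And (Bit1 3 (V 0)) (Not (Bit2 4 (V 0) (V 1)))))
    (PSeq (PZero 10) (PSeq (PInc 10)
    (PSeq (PFor (PFor visit_prog))
          (PIf (Not (Lt (D 9) (D 10))) (PInc 11) PSkip))))))
    PSkip.

(** Register 11 gains 1 for every root within budget, and 1 if there are no targets; only its being
    positive matters. *)
Definition solver : prog :=
  PSeq reverse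
  (PSeq (parse_nat 6)
  (PSeq (parse_list edge_item)
  (PSeq (parse_list target_item)
  (PSeq (parse_nat 9)
  (PSeq (PIf (Ex (Bit1 3 (V 0))) PSkip (PInc 11))
        (PFor try_root)))))).

Section Greedy_program.
Variable B : nat.
Variables A M : nat -> nat -> bool.

Definition tables (s : store) : Prop :=
  (forall u v, u < B -> v < B -> arrs s 2 (index B u v) = A u v) /\
  (forall t v, t < B -> v < B -> arrs s 4 (index B t v) = M t v).

Definition represents (p : peeling) (s : store) : Prop :=
  tables s /\ (forall x, x < B -> arrs s 7 x = inside p x) /\
  (forall t, t < B -> arrs s 8 t = unhit p t) /\ regs s 10 = chosen p.

Lemma visit_prog_spec env v p s : v < B -> represents p s ->
  represents (visit B A M v p) (psem B (v :: env) visit_prog s).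
Proof.
  intros Hv ((HA & HM) & Hin & Hun & Hch).
  assert (Hleaf : eval B (v :: env) s leaf_test = leaf B A (inside p) v).
  { unfold leaf_test, leaf. cbn [eval val nth]. rewrite Hin by assumption.
    f_equal. f_equal. apply anyb_ext. intros u Hu. apply anyb_ext. intros u' Hu'.
    rewrite eval_Neq. cbn [val nth]. now rewrite !Hin, !HA by assumption. }
  assert (Hforced : eval B (v :: env) s forced_test = forced B M (inside p) (unhit p) v).
  { unfold forced_test, forced. cbn [eval val nth].
    apply anyb_ext. intros t Ht. rewrite Hun, HM by assumption. f_equal. f_equal.
    apply anyb_ext. intros u Hu.
    rewrite eval_Neq. cbn [val nth]. now rewrite Hin, HM by assumption. }
  unfold visit_prog, visit. cbn [psem].
  rewrite Hleaf. destruct (leaf B A (inside p) v); [|now repeat split].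
  rewrite Hforced. destruct (forced B M (inside p) (unhit p) v).
  - assert (Hclear : forall j, j <= B -> let y := loop j (fun i s0 =>
        if eval B (i :: v :: env) s0 (Bit2 4 (V 0) (V 1))
        then setb 8 (val (i :: v :: env) s0 (V 0)) false s0 else s0)
        (setr 10 (S (regs s 10)) s) in
      regs y 10 = S (regs s 10) /\ (forall a, a <> 8 -> arrs y a = arrs s a) /\
      forall t, t < B -> arrs y 8 t = unhit p t && negb ((t <? j) && M t v)).
    { induction j; intros Hj; cbn [loop].
      - split; [apply setr_same|split; [reflexivity|]]. intros t Ht.
        change (t <? 0) with false. rewrite andb_true_r. now apply Hun.
      - destruct IHj as (R & Ay & H8); [lia|]. cbv zeta. set (y := loop j _ _) in *.
        cbn [eval val nth]. rewrite (Ay 4), HM by lia.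
        assert (Hlt : forall t, (t <? S j) = (t <? j) || (t =? j)).
        { intros t. apply eq_true_iff_eq. rewrite orb_true_iff, !Nat.ltb_lt, Nat.eqb_eq. lia. }
        destruct (M j v) eqn:Ej.
        + split; [exact R|split].
          * intros a Ha. cbn [setb arrs]. rewrite <- (Ay a Ha).
            apply functional_extensionality. intros i. unfold set2.
            apply Nat.eqb_neq in Ha. now rewrite Ha.
          * intros t Ht. cbn [setb arrs]. unfold set2. cbn [Nat.eqb andb].
            rewrite Hlt, H8 by assumption. destruct (Nat.eqb_spec t j) as [->|].
            -- rewrite Ej, orb_true_r. cbn [andb negb]. now rewrite andb_false_r.
            -- now rewrite orb_false_r.
        + split; [exact R|split; [exact Ay|]]. intros t Ht. rewrite Hlt, H8 by assumption.
          destruct (Nat.eqb_spec t j) as [->|]; [|now rewrite orb_false_r].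
          now rewrite Ej, !andb_false_r. }
    destruct (Hclear B (le_n B)) as (R & Ay & H8). cbv zeta in *.
    match goal with |- represents _ (setb 7 _ false ?y) => set (z := y) end.
    change (regs z 10 = S (regs s 10)) in R.
    change (forall a, a <> 8 -> arrs z a = arrs s a) in Ay.
    change (forall t, t < B -> arrs z 8 t = unhit p t && negb ((t <? B) && M t v)) in H8.
    cbn [val nth]. split; [split|split; [|split]].
    + intros a b Ha Hb. cbn [setb arrs]. unfold set2. cbn [Nat.eqb andb].
      rewrite Ay by lia. auto.
    + intros a b Ha Hb. cbn [setb arrs]. unfold set2. cbn [Nat.eqb andb].
      rewrite Ay by lia. auto.
    + intros x Hx. cbn [setb arrs inside]. unfold set2. cbn [Nat.eqb andb].
      rewrite Ay, Hin by (assumption || lia).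
      destruct (x =? v); cbn [negb]; now rewrite ?andb_true_r, ?andb_false_r.
    + intros t Ht. cbn [setb arrs unhit]. unfold set2. cbn [Nat.eqb andb].
      rewrite H8 by assumption. apply Nat.ltb_lt in Ht. now rewrite Ht.
    + cbn [setb regs chosen]. now rewrite R, Hch.
  - cbn [val nth]. split; [split|split; [|split]]; auto.
    intros x Hx. cbn [setb arrs inside]. unfold set2. cbn [Nat.eqb andb].
    rewrite Hin by assumption.
    destruct (x =? v); cbn [negb]; now rewrite ?andb_true_r, ?andb_false_r.
Qed.

Lemma peel_prog_spec env p s : represents p s ->
  represents (peel B A M p) (psem B env (PFor (PFor visit_prog)) s).
Proof.
  intros H. unfold peel. cbn [psem].
  assert (Hpass : forall i q x, represents q x -> represents (loop B (visit B A M) q)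
    (loop B (fun j => psem B (j :: i :: env) visit_prog) x)).
  { intros i q x Hq.
    assert (Hj : forall j, j <= B -> represents (loop j (visit B A M) q)
      (loop j (fun j => psem B (j :: i :: env) visit_prog) x)); [|auto].
    induction j; intros Hj; cbn [loop]; [assumption|].
    apply visit_prog_spec; [lia|]. apply IHj. lia. }
  (* Only the number of passes is generalised; the bound inside a pass remains [B]. *)
  generalize B at 1 4. intros n. induction n; cbn [loop]; [assumption|].
  now apply Hpass.
Qed.
End Greedy_program.

(** * Correctness of the solver *)

Lemma enc_pairs_length (l : list (nat * nat)) : 5 * length l + 1 <= length (enc_list enc_pair l).
Proof.
  unfold enc_list. rewrite length_app. simpl.
  assert (H : 5 * length l <= length (flat_map (fun x => true :: enc_pair x) l)); [|lia].
  induction l as [|[a b] l IH]; cbn [flat_map length app]; [lia|].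
  rewrite length_app. change (enc_pair (a, b)) with (enc_nat a ++ enc_nat b).
  rewrite length_app. change (enc_nat a) with (code (bits a)). change (enc_nat b) with (code (bits b)).
  rewrite !code_length. lia.
Qed.

Section Correct.
Variables (I : instance) (k : nat).
Let n := inst_n I.
Let E := inst_E I.
Let TD := inst_TD I.
Hypothesis Hgraph : is_tree n E \/ is_cycle n E.
Hypothesis Hval : valid_targets I.
Let w := enc_input I k.
Let B := length w.

(** Although [n] is written in binary, the edges force a long input: a tree has [n - 1] of them, and
    in a cycle every vertex is an end of one, so that [n] is at most twice their number. An edge
    takes at least five symbols, a separator and two to end each number. *)
Lemma vertices_le : n <= B.
Proof.
  assert (HE : 5 * length E + 1 <= B).
  { unfold B, w, enc_input. rewrite !length_app. pose proof (enc_pairs_length E).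
    fold E. lia. }
  destruct Hgraph as [(_ & _ & Hl)|(_ & _ & _ & Hdeg)]; [lia|].
  assert (length (seq 0 n) <= length (map fst E ++ map snd E)).
  { apply NoDup_incl_length; [apply seq_NoDup|]. intros v Hv. apply in_seq in Hv.
    specialize (Hdeg v ltac:(lia)). unfold degree in Hdeg.
    destruct (filter _ E) as [|e l] eqn:Ef; [discriminate|].
    assert (He : In e (e :: l)) by now left. rewrite <- Ef in He.
    apply filter_In in He as [He Hev]. apply in_app_iff.
    rewrite orb_true_iff, !Nat.eqb_eq in Hev.
    destruct Hev as [<-|<-]; [left|right]; now apply in_map. }
  rewrite length_app, !length_map, length_seq in H. lia.
Qed.

Definition parsed (s : store) : Prop :=
  regs s 6 = n /\ regs s 9 = min B k /\
  tables B (adjb E) (coverb I B) s /\ (forall t, t < B -> arrs s 3 t = targetb I t).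

Lemma try_root_spec i s : i < B -> parsed s ->
  let s' := psem B [i] try_root s in parsed s' /\
  regs s' 11 = regs s 11 + (if (i <? n) && (chosen (peel B (adjb E) (coverb I B) (start I B i))
                                            <=? min B k) then 1 else 0).
Proof.
  intros Hi Hp.
  assert (Hparsed : parsed (psem B [i] try_root s)).
  { destruct Hp as (H6 & H9 & (HA & HM) & HT).
    split; [|split; [|split; [split|]]]; intros;
      rewrite ?psem_regs_frame, ?psem_arrs_frame by reflexivity; auto. }
  split; [exact Hparsed|]. destruct Hp as (H6 & H9 & (HA & HM) & HT).
  unfold try_root. cbn [psem]. cbn [eval val nth]. rewrite H6.
  destruct (i <? n); [|cbn [andb]; lia].
  set (s1 := psem B [i] (assign 7 _) s).
  destruct (psem_assign B [i] 7 (And (Lt (V 0) (D 6)) (Neq (V 0) (V 1)))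
    (inside (start I B i)) s) as (R1 & A1 & F1).
  { intros v x Hv Rx Ax. cbn [eval].
    rewrite eval_Neq. cbn [val nth]. now rewrite Rx, H6. }
  fold s1 in R1, A1, F1.
  set (s2 := psem B [i] (assign 8 _) s1).
  destruct (psem_assign B [i] 8 (And (Bit1 3 (V 0)) (Not (Bit2 4 (V 0) (V 1))))
    (unhit (start I B i)) s1) as (R2 & A2 & F2).
  { intros t x Ht Rx Ax. cbn [eval val nth]. rewrite !Ax, !A1, HT, HM by lia.
    reflexivity. }
  fold s2 in R2, A2, F2.
  set (s3 := setr 10 _ _).
  assert (Hrep : represents B (adjb E) (coverb I B) (start I B i) s3).
  { split; [split|split; [|split]].
    - intros u v Hu Hv. change (arrs s3) with (arrs s2). rewrite A2, A1 by lia. auto.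
    - intros u v Hu Hv. change (arrs s3) with (arrs s2). rewrite A2, A1 by lia. auto.
    - intros x Hx. change (arrs s3) with (arrs s2). rewrite A2 by lia. auto.
    - intros t Ht. change (arrs s3) with (arrs s2). auto.
    - reflexivity. }
  apply peel_prog_spec with (env := [i]) in Hrep. cbn [psem] in Hrep.
  set (s4 := loop B _ s3) in *. destruct Hrep as (_ & _ & _ & Hch).
  assert (R4 : forall r, r <> 10 -> r <> 7 -> r <> 8 -> regs s4 r = regs s r).
  { intros r Hr _ _. transitivity (regs s3 r).
    - apply (psem_regs_frame B r (PFor (PFor visit_prog)) [i] s3).
      apply Nat.eqb_neq in Hr. unfold visit_prog. cbn [passigns]. now rewrite Hr.
    - unfold s3. rewrite !setr_other, R2, R1 by auto. reflexivity. }
  rewrite (R4 9), H9, Hch by lia. cbn [andb].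
  rewrite Nat.ltb_antisym, negb_involutive.
  destruct (_ <=? _); cbn [setr regs Nat.eqb]; rewrite R4 by lia; lia.
Qed.

(** A placement consists of distinct vertices, of which there are at most [B]; hence [k] may be read
    saturated. *)
Lemma yes_instance_min : yes_instance I k <-> yes_instance I (min B k).
Proof.
  pose proof vertices_le as HnB. split; intros (P & HP & Hlen); exists P; (split; [assumption|]).
  - assert (length P <= length (seq 0 n)).
    { destruct HP as (Hnd & Hin & _). apply NoDup_incl_length; [assumption|].
      intros p Hp. apply in_seq. specialize (Hin p Hp). fold n in Hin. lia. }
    rewrite length_seq in H. lia.
  - lia.
Qed.

Lemma solver_spec : 0 < regs (psem B [] solver (init_store w)) 11 <-> yes_instance I k.
Proof.
  pose proof vertices_le as HnB.
  rewrite yes_instance_min, (yes_instance_greedy I B (min B k) Hgraph Hval HnB).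
  assert (Hedge : forall u v, In (u, v) E -> u < B /\ v < B).
  { intros u v H. assert (Hs : simple_graph n E) by (destruct Hgraph as [G|G]; apply G).
    destruct Hs as (_ & Hs & _). apply Hs in H. lia. }
  unfold solver. cbn [psem].
  destruct (reverse_spec w) as (Hb0 & Hp0 & Ha0 & Harr0). fold B in Hb0, Hp0, Ha0, Harr0.
  set (s0 := psem B [] reverse (init_store w)) in *.
  assert (Hc0 : cursor w s0 w) by (unfold cursor; now rewrite Hp0).
  unfold w at 2, enc_input in Hc0.
  destruct (parse_nat_spec w [] 6 _ _ s0 ltac:(lia) Hb0 Hc0) as (Hb1 & Hc1 & H6).
  pose proof (parse_nat_arrs w [] 6 s0) as A1. fold B in Hb1, Hc1, H6, A1.
  assert (R1 : regs (psem B [] (parse_nat 6) s0) 11 = regs s0 11)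
    by now apply psem_regs_frame.
  set (s1 := psem B [] (parse_nat 6) s0) in *.
  destruct (parse_list_spec w [] edge_item (holds_adj w) E
    (enc_list enc_pair TD ++ enc_nat k) s1) as (Hb2 & HA2 & Hc2); auto.
  { intros j d [u v] tl s Hin Hb HE Hc. apply edge_item_spec; auto.
    - apply (Hedge u v), Hin. now left.
    - apply (Hedge u v), Hin. now left. }
  { intros u v _ _. now rewrite A1, Harr0. }
  fold B in Hb2, HA2, Hc2.
  assert (Fr2 : forall r, r = 6 \/ r = 11 ->
    regs (psem B [] (parse_list edge_item) s1) r = regs s1 r)
    by (intros r [->| ->]; now apply psem_regs_frame).
  assert (Fa2 : forall a, 3 <= a ->
    arrs (psem B [] (parse_list edge_item) s1) a = fun _ => false).
  { intros a Ha. rewrite psem_arrs_frame; [rewrite A1; apply Harr0; lia|].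
    do 3 (destruct a; [lia|]). reflexivity. }
  set (s2 := psem B [] (parse_list edge_item) s1) in *.
  destruct (parse_list_spec w [] target_item
    (fun d s => holds_adj w E s /\ holds_targets w E d s) TD
    (enc_nat k) s2) as (Hb3 & [HA3 [HT3 HM3]] & Hc3); auto.
  { intros j d [t dt] tl s Hin Hb [HE HT] Hc.
    destruct (target_item_spec w (j :: []) E d t dt tl s) as (G1 & G2 & G3 & G4); auto.
    assert (Ht : In (t, dt) TD) by (apply Hin; now left).
    apply Hval in Ht as [Ht _]. fold n in Ht. fold B. lia. }
  { split; [assumption|]. split; intros; now rewrite Fa2 by lia. }
  fold B in Hb3, HA3, HT3, HM3, Hc3.
  assert (Fr3 : forall r, r = 6 \/ r = 11 ->
    regs (psem B [] (parse_list target_item) s2) r = regs s2 r)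
    by (intros r [->| ->]; now apply psem_regs_frame).
  set (s3 := psem B [] (parse_list target_item) s2) in *.
  rewrite <- (app_nil_r (enc_nat k)) in Hc3.
  destruct (parse_nat_spec w [] 9 k [] s3 ltac:(lia) Hb3 Hc3) as (_ & _ & H9).
  pose proof (parse_nat_arrs w [] 9 s3) as A4. fold B in H9, A4.
  assert (Fr4 : forall r, r = 6 \/ r = 11 ->
    regs (psem B [] (parse_nat 9) s3) r = regs s3 r)
    by (intros r [->| ->]; now apply psem_regs_frame).
  set (s4 := psem B [] (parse_nat 9) s3) in *.
  assert (R11 : regs s4 11 = 0).
  { rewrite Fr4, Fr3, Fr2, R1, Ha0 by auto. reflexivity. }
  assert (Hparsed : parsed s4).
  { split; [|split; [exact H9|split; [split|]]].
    - rewrite Fr4, Fr3, Fr2, H6 by auto. fold n. lia.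
    - rewrite A4. exact HA3.
    - rewrite A4. exact HM3.
    - rewrite A4. exact HT3. }
  set (s5 := if eval B [] s4 (Ex (Bit1 3 (V 0))) then s4 else setr 11 (S (regs s4 11)) s4).
  assert (H5 : parsed s5 /\ (0 < regs s5 11 <-> TD = [])).
  { assert (Hex : eval B [] s4 (Ex (Bit1 3 (V 0))) = true <-> TD <> []).
    { cbn [eval val nth]. rewrite anyb_spec. destruct Hparsed as (_ & _ & _ & HT). split.
      - intros (t & Ht & Hb). rewrite HT in Hb by assumption.
        apply targetb_spec in Hb as (d & Hd). fold TD in Hd. now destruct TD.
      - intros Hne. destruct TD as [|[t d] l] eqn:Etd; [congruence|].
        assert (Hd : In (t, d) (inst_TD I)) by (fold TD; rewrite Etd; now left).
        assert (Ht : t < B) by (apply Hval in Hd as [Hd _]; fold n in Hd; lia).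
        exists t. split; [assumption|]. rewrite HT by assumption.
        apply targetb_spec. eauto. }
    unfold s5. destruct (eval B [] s4 _).
    - split; [assumption|]. rewrite R11. split; [lia|]. intros H0.
      exfalso. now apply (proj1 Hex).
    - split; [exact Hparsed|]. rewrite setr_same. split; [|lia]. intros _.
      destruct TD; [reflexivity|]. exfalso. now assert (false = true) by now apply Hex. }
  clearbody s5. destruct H5 as [Hp5 H5].
  assert (Hloop : forall j, j <= B ->
    let x := loop j (fun i => psem B [i] try_root) s5 in parsed x /\
    (0 < regs x 11 <-> TD = [] \/ exists s, s < j /\ s < n /\
       chosen (peel B (adjb E) (coverb I B) (start I B s)) <= min B k)).
  { induction j; intros Hj; cbn [loop].
    - split; [assumption|]. rewrite H5. split; [auto|]. intros [H|(s & Hs & _)]; [auto|lia].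
    - destruct IHj as [Hpx Hx]; [lia|]. cbv zeta. set (x := loop j _ s5) in *.
      destruct (try_root_spec j x ltac:(lia) Hpx) as [Hp' Hr]. split; [assumption|].
      rewrite Hr.
      destruct ((j <? n) && _) eqn:Et.
      + apply andb_true_iff in Et as [Et1 Et2].
        apply Nat.ltb_lt in Et1. apply Nat.leb_le in Et2.
        split; [|lia]. intros _. right. exists j. auto.
      + rewrite Nat.add_0_r, Hx. split.
        * intros [H|(s & Hs & H)]; [auto|right; exists s; split; [lia|auto]].
        * intros [H|(s & Hs & Hsn & H)]; [auto|right].
          destruct (Nat.eq_dec s j) as [->|].
          -- apply Nat.ltb_lt in Hsn. apply Nat.leb_le in H. rewrite Hsn, H in Et.
             discriminate.
          -- exists s. split; [lia|auto]. }
  destruct (Hloop B (le_n B)) as [_ Hfin]. etransitivity; [exact Hfin|].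
  fold TD n E. split.
  - intros [H|(s & _ & H)]; [auto|eauto].
  - intros [H|(s & Hs & H)]; [auto|right]. exists s. split; [lia|auto].
Qed.
End Correct.

(* There is a Turing machine and a polynomial bound c * |w|^e + c such that,
   on every instance whose graph is a tree or a cycle, the machine decides
   within that many steps whether a covering placement of size <= k exists. *)
Theorem theorem3 :
  exists (M : TM) (c e : nat), tm_wf M /\
    forall (I : instance) (k : nat),
      (is_tree (inst_n I) (inst_E I) \/ is_cycle (inst_n I) (inst_E I)) ->
      valid_targets I ->
      exists b : bool,
        decides_within M (enc_input I k)
          (c * length (enc_input I k) ^ e + c) b /\
        (b = true <-> yes_instance I k).
Proof.
  (* The solver has data registers 0 to 14 and arrays 0 to 8. Of the 40 machine registers, 15 is the
     index register and the other 24 serve 12 nesting levels. The syntactic conditions are checked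
     by computation. *)
  destruct (prog_machine 15 40 9 solver 11) as (M & c & e & HM & H);
    try reflexivity; try lia.
  exists M, c, e. split; [exact HM|]. intros I k HG HV. eexists. split; [apply H|].
  rewrite Nat.ltb_lt. now apply solver_spec.
Qed.
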